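(* Let $\delta\in(0,1)$ and let $d\ge 2$ be an integer. Then there exists $C=C(\delta,d)>0$ such that the following holds. For every $n$, let $T$ be a tree on $n$ vertices with maximum degree at most $d$, let $G_0$ be a graph on vertex set $[n]$ with minimum degree at least $\delta n$, and let $G\sim G_0\cup\mathbf{G}(n,C/n)$ be uniformly edge-coloured in $[n-1]$. Then, with probability tending to $1$ as $n\to\infty$ (uniformly over the choices of $T$ and $G_0$), $G$ contains a rainbow copy of $T$.
   Context: $\mathbf{G}(n,p)$ is the binomial random graph on $[n]$ with edge probability $p$; $G_0\cup\mathbf{G}(n,p)$ has as edge set the union of both edge sets. Uniformly edge-coloured in $\mathcal{C}$: each edge independently gets a uniformly random colour from $\mathcal{C}$. Rainbow: all edges have distinct colours. *)

(* Defs.v *)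
From mathcomp Require Import all_boot all_order all_algebra.
From mathcomp Require Import reals.

Set Implicit Arguments.
Unset Strict Implicit.
Unset Printing Implicit Defensive.

Import Order.TTheory GRing.Theory Num.Theory.
Local Open Scope ring_scope.

Notation edge E := {e | e \in E}.
Notation colouring E k := {ffun edge E -> 'I_k}.

Section Graphs.
Variable V : finType.
Implicit Types E F : {set {set V}}.

(* A simple graph on V is given by its edge set, a set of 2-element subsets
   of V; the union of two graphs is thus the union of these sets. *)
Definition vpairs : {set {set V}} := [set e : {set V} | #|e| == 2%N].

Definition is_graph E : bool := E \subset vpairs.

(* When E is a graph this is irreflexive, since #|[set x; x]| = 1. *)
Definition adj E : rel V := fun x y => [set x; y] \in E.

Definition degree E (x : V) : nat := #|[set y | adj E x y]|.

Definition acyclic E : Prop :=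
  forall s : seq V, (2 < size s)%N -> ~ ucycle (adj E) s.

Definition is_tree E : Prop :=
  [/\ is_graph E, (0 < #|V|)%N, (forall x y, connect (adj E) x y) & acyclic E].

Definition rainbow E k (c : colouring E k) F : bool :=
  dinjectiveb c [pred e : edge E | val e \in F].

End Graphs.

Definition image_graph (U V : finType) (f : U -> V) (T : {set {set U}}) :
    {set {set V}} :=
  [set f @: (e : {set U}) | e in T].

Definition has_rainbow_copy (U V : finType) (T : {set {set U}})
    (E : {set {set V}}) k (c : colouring E k) : bool :=
  [exists f : {ffun U -> V},
    [&& injectiveb f, image_graph f T \subset E & rainbow c (image_graph f T)]].

Section Probability.
Variables (R : realType) (V : finType).
Implicit Types E H : {set {set V}}.

(* Probability that the binomial random graph on V with edge probability p
   equals H; this is a probability mass function when 0 <= p <= 1. *)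
Definition gnp_mass (p : R) H : R :=
  \prod_(e in vpairs V) (if e \in H then p else 1 - p).

(* Probability of the event A when the edges of E are coloured independently
   and uniformly in 'I_k. *)
Definition colouring_prob E k (A : pred (colouring E k)) : R :=
  \sum_(c : colouring E k | A c) \prod_(e : edge E) k%:R^-1.

(* Probability of the event A for the union of E0 with a binomial random graph,
   uniformly edge-coloured in 'I_k. *)
Definition perturbed_prob E0 (p : R) k (A : forall E, pred (colouring E k)) : R :=
  \sum_(H : {set {set V}} | is_graph H)
    gnp_mass p H * colouring_prob (@A (E0 :|: H)).

End Probability.

(* Main.v *)
(* Choose a degree [D] shared by linearly many vertices of [T] (hubs) with pairwise disjoint
   2-neighbourhoods.  A density increment in [G0] gives disjoint D-tuples of vertices and a set [B]
   of the same size such that the bipartite graph "every vertex of the tuple is adjacent in [G0] to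
   the vertex of [B]" is dense in every linear-sized pair of subsets.  The neighbours of the hubs
   are placed on the tuples.

   First phase: the tree without its hubs is embedded using the remaining edges so that the
   uncovered vertices all lie in [B].  The tree is cut into pieces of bounded size, embedded one
   after the other; the only property of the random graph that is needed is that any two disjoint
   linear-sized sets are joined, besides linear degrees into small reserved sets, which [G0]
   provides.  Leftover vertices are covered by free spots of the last pieces, and unused
   reserve vertices replace vertices of [B] at absorbing spots.  Colours are handled as in
   McDiarmid's clutter argument: colouring the edges one at a time and asking the structure to be
   rainbow costs at most a constant factor in the edge probability.

   Second phase: exactly as many colours are unused as edges are missing, and the hubs have to be
   matched to the uncovered vertices by a rainbow perfect matching of the tuple-vertex graph in the
   unused colours.  Any perfect matching can be modified along many short switching chains, so two
   random perfect matchings share few edges and the second moment method applies. *)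

Require Import Defs.
From mathcomp Require Import all_boot all_order all_algebra all_fingroup.
From mathcomp Require Import reals ring lra zify.

Set Implicit Arguments.
Unset Strict Implicit.
Unset Printing Implicit Defensive.

Import Order.TTheory GRing.Theory Num.Theory.

(** * Switching chains in dense bipartite graphs *)

(** The obstacle is that [n - 1] colours face [n - 1] edges. An edge coloured when only [r] colours
    are free costs a factor [r / (n - 1)] in its probability, which degenerates near the end.
    Leaving the [s * D] edges at the hubs aside keeps [s * D] colours, linearly many, free
    throughout the first phase, so the loss is the constant [s * D / (n - 1)]. All pairs used by the
    second phase lie in [G0] and outside [Omega]: their presence is certain and their colours are
    independent of the first phase.

    Even this constant is too much for the reserves. Class 2 must offer every vertex more than
    [d * (s * D)] neighbours; divided by [s * D / (n - 1)] this exceeds the number of vertices.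
    Hence the pairs touching a reserve are coloured first, while at least half of the colours are
    free.

    Which part of [B] stays uncovered is known only after the first phase, so compatibility must be
    dense between all pairs of large subsets. Half of the average density is enough, and density
    increments reach it with explicit constants. *)

Section Switching.
Variables (s : nat) (E : rel 'I_s).
Implicit Types (t u : {perm 'I_s}) (A X S : {set 'I_s}).
Local Notation quad := ('I_s * 'I_s * 'I_s * 'I_s)%type.

Definition perfect_matchings : {set {perm 'I_s}} :=
  [set t : {perm 'I_s} | [forall i, E i (t i)]].

(* replacing [t] by its composition with the 5-cycle through [w] and the four entries of the chain
   preserves perfect matchings *)
Definition chain t (w x : 'I_s) (v : quad) :=
  let: (w1, w2, w3, w4) := v in
  [&& E w (t w1), E w1 (t w2), E w2 (t w3), E w3 (t w4) & E w4 x].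

Definition spread_quad S (v : quad) :=
  let: (w1, w2, w3, w4) := v in
  uniq [:: w1; w2; w3; w4] && all [pred y | y \notin S] [:: w1; w2; w3; w4].

(** A quadruple fails through one of six coincidences or one of four memberships in [S]; each
    coincidence leaves three free coordinates, each membership three besides the element of [S]. *)
Lemma card_not_spread_quad S :
  #|[set v | ~~ spread_quad S v]| <= (6 + 4 * #|S|) * s ^ 3.
Proof.
have c1 : #|{: 'I_s}| = s by rewrite card_ord.
have c3 : #|{: 'I_s * 'I_s * 'I_s}| = s ^ 3 by rewrite !card_prod card_ord; lia.
have cS : #|{: {x | x \in S} * ('I_s * 'I_s * 'I_s)}| = #|S| * s ^ 3.
  by rewrite card_prod c3 card_sig; congr (_ * _); apply: eq_card => x; rewrite inE.
pose img (T : finType) (g : T -> quad) := [set g y | y : T].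
have imgP (T : finType) (g : T -> quad) : #|img T g| <= #|T|.
  exact: leq_imset_card.
pose T3 : finType := ('I_s * 'I_s * 'I_s)%type.
pose TS : finType := ({x | x \in S} * ('I_s * 'I_s * 'I_s))%type.
pose B := [:: img T3 (fun y => (y.1.1, y.1.1, y.1.2, y.2));
  img T3 (fun y => (y.1.1, y.1.2, y.1.1, y.2));
  img T3 (fun y => (y.1.1, y.1.2, y.2, y.1.1));
  img T3 (fun y => (y.1.1, y.1.2, y.1.2, y.2));
  img T3 (fun y => (y.1.1, y.1.2, y.2, y.1.2));
  img T3 (fun y => (y.1.1, y.1.2, y.2, y.2));
  img TS (fun y => (val y.1, y.2.1.1, y.2.1.2, y.2.2));
  img TS (fun y => (y.2.1.1, val y.1, y.2.1.2, y.2.2));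
  img TS (fun y => (y.2.1.1, y.2.1.2, val y.1, y.2.2));
  img TS (fun y => (y.2.1.1, y.2.1.2, y.2.2, val y.1))].
have sub : [set v | ~~ spread_quad S v] \subset \bigcup_(b <- B) b.
  apply/subsetP => -[[[w1 w2] w3] w4]; apply: contraTT => nU.
  have H i : i < 10 -> (w1, w2, w3, w4) \in nth set0 B i -> False.
    move=> i10 wi; move/negP: nU; apply.
    have := mem_nth set0 (i10 : i < size B); move: wi; set b := nth _ _ _ => wb bB.
    by rewrite (big_rem b) //= inE wb.
  rewrite inE negbK /= !inE !negb_or !andbT.
  have n12 : w1 != w2.
    by apply/eqP => e; apply: (H 0) => //; apply/imsetP; exists (w1, w3, w4); rewrite //= e.
  have n13 : w1 != w3.
    by apply/eqP => e; apply: (H 1) => //; apply/imsetP; exists (w1, w2, w4); rewrite //= e.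
  have n14 : w1 != w4.
    by apply/eqP => e; apply: (H 2) => //; apply/imsetP; exists (w1, w2, w3); rewrite //= e.
  have n23 : w2 != w3.
    by apply/eqP => e; apply: (H 3) => //; apply/imsetP; exists (w1, w2, w4); rewrite //= e.
  have n24 : w2 != w4.
    by apply/eqP => e; apply: (H 4) => //; apply/imsetP; exists (w1, w2, w3); rewrite //= e.
  have n34 : w3 != w4.
    by apply/eqP => e; apply: (H 5) => //; apply/imsetP; exists (w1, w2, w3); rewrite //= e.
  have m1 : w1 \notin S.
    apply/negP => wS; apply: (H 6) => //; apply/imsetP.
    by exists (exist _ w1 wS, (w2, w3, w4)).
  have m2 : w2 \notin S.
    apply/negP => wS; apply: (H 7) => //; apply/imsetP.
    by exists (exist _ w2 wS, (w1, w3, w4)).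
  have m3 : w3 \notin S.
    apply/negP => wS; apply: (H 8) => //; apply/imsetP.
    by exists (exist _ w3 wS, (w1, w2, w4)).
  have m4 : w4 \notin S.
    apply/negP => wS; apply: (H 9) => //; apply/imsetP.
    by exists (exist _ w4 wS, (w1, w2, w3)).
  by rewrite n12 n13 n14 n23 n24 n34 m1 m2 m3 m4.
apply: leq_trans (subset_leq_card sub) _.
have bU (r : seq {set quad}) : #|\bigcup_(b <- r) b| <= \sum_(b <- r) #|b|.
  elim: r => [|b r IH]; first by rewrite !big_nil cards0.
  by rewrite !big_cons (leq_trans (leq_card_setU _ _)) // leq_add2l.
apply: leq_trans (bU _) _; rewrite /B !big_cons big_nil.
have i3 g : #|img T3 g| <= s ^ 3 by rewrite -c3; apply: imgP.
have iS g : #|img TS g| <= #|S| * s ^ 3 by rewrite -cS; apply: imgP.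
set a1 := #|_|; have h1 : a1 <= _ := i3 _.
set a2 := #|img T3 _|; have h2 : a2 <= _ := i3 _.
set a3 := #|img T3 _|; have h3 : a3 <= _ := i3 _.
set a4 := #|img T3 _|; have h4 : a4 <= _ := i3 _.
set a5 := #|img T3 _|; have h5 : a5 <= _ := i3 _.
set a6 := #|img T3 _|; have h6 : a6 <= _ := i3 _.
set b1 := #|img TS _|; have k1 : b1 <= _ := iS _.
set b2 := #|img TS _|; have k2 : b2 <= _ := iS _.
set b3 := #|img TS _|; have k3 : b3 <= _ := iS _.
set b4 := #|img TS _|; have k4 : b4 <= _ := iS _.
rewrite mulnDl -mulnA; move: h1 h2 h3 h4 h5 h6 k1 k2 k3 k4.
by set q := s ^ 3; set q' := _ * q; lia.
Qed.

(** Permutations compose from left to right, so on distinct entries this is the cycle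
    [w -> w1 -> w2 -> w3 -> w4 -> w], and its product with [t] sends [w] to [t w1]. *)
Definition cyc5 (w w1 w2 w3 w4 : 'I_s) : {perm 'I_s} :=
  (tperm w w1 * tperm w w2 * tperm w w3 * tperm w w4)%g.

Lemma cyc5E w w1 w2 w3 w4 : uniq [:: w; w1; w2; w3; w4] ->
  [/\ cyc5 w w1 w2 w3 w4 w = w1, cyc5 w w1 w2 w3 w4 w1 = w2,
      cyc5 w w1 w2 w3 w4 w2 = w3, cyc5 w w1 w2 w3 w4 w3 = w4 &
      cyc5 w w1 w2 w3 w4 w4 = w].
Proof.
rewrite /= !inE !negb_or !andbT.
case/and4P=> /and4P[n1 n2 n3 n4] /and3P[n5 n6 n7] /andP[n8 n9] n10.
have sy (a b : 'I_s) : a != b -> b != a by rewrite eq_sym.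
have [[[k1 k2] k3] k4] := (sy _ _ n1, sy _ _ n2, sy _ _ n3, sy _ _ n4).
have [[k5 k6] k7] := (sy _ _ n5, sy _ _ n6, sy _ _ n7).
have [[k8 k9] k10] := (sy _ _ n8, sy _ _ n9, sy _ _ n10).
rewrite !permM; split.
- by rewrite tpermL [tperm w w2 w1]tpermD // [tperm w w3 w1]tpermD // tpermD.
- by rewrite tpermR tpermL [tperm w w3 w2]tpermD // tpermD.
- by rewrite [tperm w w1 w2]tpermD // tpermR tpermL tpermD.
- by rewrite [tperm w w1 w3]tpermD // [tperm w w2 w3]tpermD // tpermR tpermL.
- by rewrite [tperm w w1 w4]tpermD // [tperm w w2 w4]tpermD // [tperm w w3 w4]tpermD // tpermR.
Qed.

Lemma cyc5D w w1 w2 w3 w4 y : y \notin [:: w; w1; w2; w3; w4] ->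
  cyc5 w w1 w2 w3 w4 y = y.
Proof.
rewrite !inE !negb_or => /and5P[n0 n1 n2 n3 n4].
have sy (a b : 'I_s) : a != b -> b != a by rewrite eq_sym.
rewrite !permM [tperm w w1 y]tpermD ?[tperm w w2 y]tpermD ?[tperm w w3 y]tpermD ?tpermD //.
all: exact: sy.
Qed.

Definition agreeing t S : {set {perm 'I_s}} :=
  [set u in perfect_matchings | [forall i in S, (u : {perm _}) i == t i]].

Variable c : nat.
Hypothesis many_chains : forall t w, s ^ 4 <= c * #|[set v | chain t w (t w) v]|.

Definition good_chains t w S :=
  [set v | chain t w (t w) v & spread_quad (w |: S) v].

(** The bound on [s] makes the quadruples that repeat an entry or meet [w |: S] at most half of the
    guaranteed [s ^ 4 / c] chains. *)
Lemma many_good_chains t w S : 2 * c * (6 + 4 * #|S|.+1) <= s ->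
  s ^ 4 <= 2 * c * #|good_chains t w S|.
Proof.
move=> sb; have h := many_chains t w.
have := card_not_spread_quad (w |: S).
have cw : #|w |: S| <= #|S|.+1 by rewrite cardsU1 -add1n leq_add2r leq_b1.
move=> hb.
have h2 : #|[set v | chain t w (t w) v]| <=
   #|good_chains t w S| + #|[set v | ~~ spread_quad (w |: S) v]|.
  rewrite -(cardsID [set v | spread_quad (w |: S) v]) leq_add //.
    by apply: subset_leq_card; apply/subsetP => v; rewrite !inE.
  by apply: subset_leq_card; apply/subsetP => v; rewrite !inE => /andP[].
have h3 : 2 * c * #|[set v | ~~ spread_quad (w |: S) v]| <= s ^ 4.
  apply: (@leq_trans (2 * c * (6 + 4 * #|S|.+1) * s ^ 3)).
    rewrite -[2 * c * (6 + _) * _]mulnA leq_mul2l; apply/orP; right.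
    by apply: leq_trans hb _; rewrite leq_mul2r leq_add2l leq_mul2l cw !orbT.
  by rewrite (expnS s 3) leq_mul2r sb orbT.
move: h h2 h3; set a := #|_|; set b := #|good_chains _ _ _|; set e := #|_|.
set q := s ^ 4; nia.
Qed.

(** Double counting of the pairs of a matching [u] agreeing with [t] on [w |: S] and a good chain
    for [u] at [w]. Switching keeps the agreement on [S], and the result together with [w1], [w2],
    [w3] determines the pair: [w4] is the row that the new matching sends to [t w]. So every [u] has
    at least [s ^ 4 / (2 * c)] switches, while every matching is reached at most [s ^ 3] times. *)
Lemma agreeing_switch t w S : w \notin S -> t \in perfect_matchings ->
  2 * c * (6 + 4 * #|S|.+1) <= s -> 0 < s ->
  s * #|agreeing t (w |: S)| <= 2 * c * #|agreeing t S|.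
Proof.
move=> wS tpm sb s0.
pose Pr := [set p : {perm 'I_s} * quad | (p.1 \in agreeing t (w |: S)) &
   (p.2 \in good_chains p.1 w S)].
pose sw (p : {perm 'I_s} * quad) :=
  let: (u, (w1, w2, w3, w4)) := p in ((cyc5 w w1 w2 w3 w4 * u)%g, (w1, w2, w3)).
have Prlo : s ^ 4 * #|agreeing t (w |: S)| <= 2 * c * #|Pr|.
  have -> : #|Pr| = \sum_(u in agreeing t (w |: S)) #|good_chains u w S|.
    rewrite -sum1_card (eq_bigl (fun p : {perm 'I_s} * quad =>
      (p.1 \in agreeing t (w |: S)) && (p.2 \in good_chains p.1 w S))); last by move=> p; rewrite inE.
    rewrite -(pair_big_dep (fun u => u \in agreeing t (w |: S))
       (fun u v => v \in good_chains u w S) (fun _ _ => 1)) /=.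
    by apply: eq_bigr => u _; rewrite sum1_card.
  rewrite mulnC -sum_nat_const big_distrr /=; apply: leq_sum => u _.
  exact: many_good_chains.
have swP p : p \in Pr -> uniq [:: w; p.2.1.1.1; p.2.1.1.2; p.2.1.2; p.2.2]
   /\ (sw p).1 \in agreeing t S /\ p.1 w = t w /\ (sw p).1 p.2.2 = t w.
  case: p => u [[[w1 w2] w3] w4]; rewrite !inE /= => /andP[/andP[/forallP upm uS]].
  have uSE i : i \in w |: S -> u i = t i.
    by move=> iS; have /forallP/(_ i)/implyP/(_ iS)/eqP := uS.
  case/andP=> /and5P[E0 E1 E2 E3 E4] /andP[un].
  rewrite !andbT !inE !negb_or => /and4P[/andP[a1 b1] /andP[a2 b2] /andP[a3 b3] /andP[a4 b4]].
  have un5 : uniq [:: w; w1; w2; w3; w4].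
    by rewrite cons_uniq !inE !negb_or ![w == _]eq_sym a1 a2 a3 a4.
  have [c0 c1 c2 c3 c4] := cyc5E un5.
  have ew : u w = t w by apply: uSE; rewrite !inE eqxx.
  split; first by move: un5; rewrite /= !inE !negb_or !andbT.
  split; last by rewrite permM c4.
  apply/andP; split.
    apply/forallP => i; rewrite permM.
    have [] := boolP (i \in [:: w; w1; w2; w3; w4]); last by move=> ni; rewrite cyc5D.
    rewrite !inE => /or4P[/eqP->|/eqP->|/eqP->|/orP[/eqP->|/eqP->]];
      by rewrite ?c0 ?c1 ?c2 ?c3 ?c4.
  apply/forallP => i; apply/implyP => iS; rewrite permM cyc5D ?uSE ?inE ?iS ?orbT //.
  rewrite !negb_or; apply/and5P; split; apply: contraTneq iS => ->.
  - exact: wS.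
  - exact: b1.
  - exact: b2.
  - exact: b3.
  - exact: b4.
have swI : {in Pr &, injective sw}.
  move=> [u [[[w1 w2] w3] w4]] [u' [[[w1' w2'] w3'] w4']] pP pP'.
  have [_ [_ [_ e]]] := swP _ pP; have [_ [_ [_ e']]] := swP _ pP'.
  move=> esw; have e1 : (sw (u, (w1, w2, w3, w4))).1 = (sw (u', (w1', w2', w3', w4'))).1.
    by rewrite esw.
  move: e; rewrite e1 -e' => /perm_inj /= e4.
  case: esw => + h1 h2 h3; rewrite -h1 -h2 -h3 -e4 => /mulgI ->.
  by [].
have Prhi : #|Pr| <= #|agreeing t S| * s ^ 3.
  rewrite -(card_in_imset swI).
  have -> : #|agreeing t S| * s ^ 3 =
     #|setX (agreeing t S) [set: 'I_s * 'I_s * 'I_s]|.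
    by rewrite cardsX cardsT !card_prod card_ord; lia.
  apply: subset_leq_card; apply/subsetP => _ /imsetP[p pP ->].
  have [_ [h _]] := swP _ pP; rewrite inE h /=.
  by case: (sw p) => a b /=; rewrite inE.
have := leq_trans Prlo (leq_mul (leqnn (2 * c)) Prhi).
rewrite mulnA [_ * s ^ 3]mulnC (expnSr s 3) -mulnA leq_pmul2l ?expn_gt0 ?s0 //.
Qed.

(** A permutation with the most entries in [E] is perfect, since a chain at a bad row [w] makes all
    five rows of its cycle good and changes no other row. This is why [many_chains] speaks of all
    permutations, not only of perfect matchings. *)
Lemma perfect_matchings_gt0 : 20 * c <= s -> 0 < s -> 0 < #|perfect_matchings|.
Proof.
move=> sb s0.
pose nE t := #|[set i | E i (t i)]|.
case: (arg_maxnP (P := predT) nE (erefl : predT (1%g : {perm 'I_s}))) => t _ tmax.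
suff tpm : t \in perfect_matchings by apply/card_gt0P; exists t.
rewrite inE; apply/forallP => w; apply: contraT => nEw.
have gc : 0 < #|good_chains t w set0|.
  have := @many_good_chains t w set0; rewrite cards0 => /(_ ltac:(lia)).
  by case: #|_| => //; rewrite muln0 leqn0 expn_eq0 => /andP[/eqP ? _]; lia.
case/card_gt0P: gc => -[[[w1 w2] w3] w4]; rewrite inE /=.
case/andP=> /and5P[E0 E1 E2 E3 E4] /andP[un].
rewrite setU0 !inE !andbT => /and4P[a1 a2 a3 a4].
have un5 : uniq [:: w; w1; w2; w3; w4].
  by rewrite cons_uniq !inE !negb_or ![w == _]eq_sym a1 a2 a3 a4.
have [c0 c1 c2 c3 c4] := cyc5E un5.
have : nE (cyc5 w w1 w2 w3 w4 * t)%g <= nE t by apply: tmax.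
rewrite /nE leqNgt => /negP[].
apply: proper_card; apply/properP; split.
  apply/subsetP => i; rewrite !inE permM.
  have [] := boolP (i \in [:: w; w1; w2; w3; w4]); last by move=> ni; rewrite cyc5D.
  rewrite !inE => /or4P[/eqP->|/eqP->|/eqP->|/orP[/eqP->|/eqP->]];
    by rewrite ?c0 ?c1 ?c2 ?c3 ?c4.
by exists w; [rewrite inE permM c0 | rewrite inE].
Qed.

Lemma card_agreeing t S : t \in perfect_matchings -> 0 < s ->
  2 * c * (6 + 4 * #|S|) <= s ->
  s ^ #|S| * #|agreeing t S| <= (2 * c) ^ #|S| * #|perfect_matchings|.
Proof.
move=> tpm s0; have [k] := ubnP #|S|; elim: k S => // k IH S.
have [->|/set0Pn[w wS]] := eqVneq S set0.
  move=> _ _; rewrite cards0 !expn0 !mul1n; apply: subset_leq_card.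
  by apply/subsetP => u; rewrite inE => /andP[].
have e : S = w |: S :\ w by rewrite setD1K.
have cS : #|S| = #|S :\ w|.+1 by rewrite (cardsD1 w) wS.
rewrite cS => kb sb.
have h := @agreeing_switch t w (S :\ w) _ tpm sb s0; rewrite !inE eqxx -e in h.
have := IH (S :\ w) ltac:(lia) ltac:(nia).
move: (h isT); set a := #|agreeing _ _|; set b := #|agreeing _ _|; set p := #|_|.
rewrite !expnS; set x := s ^ _; set y := (2 * c) ^ _ => h1 h2.
rewrite [s * x]mulnC -mulnA; apply: leq_trans (leq_mul (leqnn x) h1) _.
by rewrite [x * _]mulnCA -[2 * c * y * _]mulnA leq_mul2l h2 orbT.
Qed.

Definition n_agree t u := #|[set i | t i == u i]|.

(** The number of entries that a random perfect matching shares with [t] has a Poisson-like tail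
    [(2 * c) ^ i / i!]. This is the union bound over the [i]-sets of agreement, with
    ['C(s, i) * i! <= s ^ i]. *)
Lemma card_agree_ge t i : t \in perfect_matchings -> 0 < s ->
  2 * c * (6 + 4 * i) <= s ->
  #|[set u in perfect_matchings | i <= n_agree t u]| * i`! <=
  (2 * c) ^ i * #|perfect_matchings|.
Proof.
move=> tpm s0 sb.
pose Si := [set S : {set 'I_s} | #|S| == i].
have h1 : #|[set u in perfect_matchings | i <= n_agree t u]| <=
   \sum_(S in Si) #|agreeing t S|.
  have -> : \sum_(S in Si) #|agreeing t S| =
     \sum_(u in perfect_matchings) #|[set S in Si | S \subset [set j | t j == u j]]|.
    under eq_bigr => S _ do rewrite -sum1_card.
    under [RHS]eq_bigr => u _ do rewrite -sum1_card.
    rewrite (exchange_big_dep (mem perfect_matchings)) /=; last first.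
      by move=> S u _; rewrite inE => /andP[].
    apply: eq_bigr => u upm; apply: eq_bigl => S; rewrite [RHS]inE; congr (_ && _).
    rewrite inE upm; apply/forallP/subsetP => [h j jS|h j].
      by have /implyP/(_ jS) := h j; rewrite inE eq_sym.
    by apply/implyP => /h; rewrite inE eq_sym.
  rewrite -sum1_card (eq_bigl (fun u => (u \in perfect_matchings) && (i <= n_agree t u))); last first.
    by move=> u; rewrite inE.
  rewrite big_mkcondr /=; apply: leq_sum => u upm; case: ifP => // /card_geqP[r [ur sr rs]].
  apply/card_gt0P; exists [set:: r]; rewrite !inE; apply/andP; split.
    by rewrite -sr cardsE; apply/eqP/card_uniqP.
  by apply/subsetP => j jr; apply: rs; move: jr; rewrite inE.
have h2 : s ^ i * \sum_(S in Si) #|agreeing t S| <=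
   'C(s, i) * ((2 * c) ^ i * #|perfect_matchings|).
  have -> : 'C(s, i) = #|Si| by rewrite card_draws card_ord.
  rewrite -sum_nat_const big_distrr /=; apply: leq_sum => S; rewrite inE => /eqP e.
  by rewrite -{1 2}e; apply: card_agreeing; rewrite // e.
have h3 : 'C(s, i) * i`! <= s ^ i.
  rewrite bin_ffact; elim: (i) (s) => [|j IH] m; first by rewrite expn0.
  by case: m => [|m]; rewrite ?ffact0n // ffactnS expnS leq_mul // (leq_trans (IH _)) //; case: (j) => // k; rewrite leq_exp2r //.
have si0 : 0 < s ^ i by rewrite expn_gt0 s0.
rewrite -(leq_pmul2l si0); apply: leq_trans (_ : s ^ i * (\sum_(S in Si) #|agreeing t S|) * i`! <= _).
  by rewrite mulnA leq_mul2r leq_mul2l h1 !orbT.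
apply: leq_trans (leq_mul h2 (leqnn _)) _.
by rewrite mulnAC leq_mul2r h3 orbT.
Qed.

End Switching.

(** * Many chains from density between large sets *)

Section ManyChains.
Variable s : nat.
Implicit Types (A X : {set 'I_s}) (r : rel 'I_s).

Definition ecard r A X := \sum_(w in A) \sum_(x in X) (r w x : nat).

Lemma ecard_tr r A X : ecard (fun x w => r w x) X A = ecard r A X.
Proof. exact: exchange_big. Qed.

(** If few columns were popular, every row would keep half of its guaranteed [comp]-degree outside
    them. Then [A] against the unpopular columns would be [comp]-dense, hence [r]-dense, although
    every unpopular column has few [r]-neighbours in [A]. *)
Lemma many_popular (L0 L1 L2 L3 Lk : nat) (comp r : rel 'I_s) A :
  0 < s -> (forall w, s <= L0 * \sum_x (comp w x : nat)) ->
  (forall B X, s ^ 2 <= Lk * ecard comp B X -> s ^ 2 <= L2 * ecard r B X) ->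
  4 * L0 <= L3 -> 2 * L0 * L1 <= Lk -> s <= L1 * #|A| ->
  s <= L3 * #|[set x | s <= L2 * \sum_(w in A) (r w x : nat)]|.
Proof.
move=> s0 Hrow Hs h3 hk hA; set X2 := [set x | _]; rewrite leqNgt; apply/negP => lt.
have rowX w : s <= 2 * L0 * \sum_(x in ~: X2) (comp w x : nat).
  have := Hrow w; rewrite (bigID (mem X2)) /=.
  have a1 : \sum_(x in X2) (comp w x : nat) <= #|X2|.
    by rewrite -sum1_card; apply: leq_sum => x _; apply: leq_b1.
  have -> : \sum_(x in ~: X2) (comp w x : nat) = \sum_(x | x \notin X2) comp w x.
    by apply: eq_bigl => x; rewrite inE.
  move: a1; set a := \sum_(x in X2) _; set b := \sum_(x | _) _ => a1 hab.
  have : 4 * (L0 * a) <= L3 * #|X2| by rewrite mulnA leq_mul.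
  lia.
have e1 : s * #|A| <= 2 * L0 * ecard comp A (~: X2).
  rewrite mulnC -sum_nat_const /ecard big_distrr /=; apply: leq_sum => w _; exact: rowX.
have e2 : s ^ 2 <= Lk * ecard comp A (~: X2).
  apply: leq_trans (leq_mul hk (leqnn _)).
  rewrite -mulnn; apply: leq_trans (leq_mul (leqnn s) hA) _.
  by rewrite mulnCA (mulnC (2 * L0)) -[X in _ <= X]mulnA leq_mul2l e1 orbT.
have := Hs _ _ e2; rewrite -ecard_tr /ecard => e3.
have [z|n0] := eqVneq (~: X2) set0.
  by move: e3; rewrite z big_set0 muln0 leqn0 expn_eq0; lia.
have : L2 * (\sum_(x in ~: X2) \sum_(w in A) (r w x : nat)) < s ^ 2.
  apply: (@leq_trans (\sum_(x in ~: X2) s)); last first.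
    rewrite sum_nat_const -mulnn leq_mul2r; apply/orP; right.
    by have := max_card (mem (~: X2)); rewrite card_ord.
  case/set0Pn: n0 => y yX; rewrite big_distrr /= (bigD1 y) //= [X in _ < X](bigD1 y) //=.
  rewrite -addSn leq_add //; first by move: yX; rewrite !inE -ltnNge.
  by apply: leq_sum => x /andP[+ _]; rewrite !inE -ltnNge => /ltnW.
by rewrite ltnNge e3.
Qed.

(** In the application [E] is a random thinning of [comp] with much smaller degrees. Density of
    [comp] is known only between sets of size at least [s / L3], which one [E]-neighbourhood need
    not reach. Two steps from either end do reach it, and the middle edge from [w2] to [t w3] joins
    the two large sets; this is the reason for four intermediate rows. *)
Lemma many_chains_of_dense (L0 L1 L2 L3 Lk Lb : nat) (comp E : rel 'I_s) :
  0 < s ->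
  (forall w, s <= L0 * \sum_x (comp w x : nat)) ->
  (forall x, s <= L0 * \sum_w (comp w x : nat)) ->
  (forall A X, s <= L3 * #|A| -> s <= L3 * #|X| -> s ^ 2 <= Lb * ecard comp A X) ->
  (forall w, s <= L1 * \sum_x (E w x : nat)) ->
  (forall x, s <= L1 * \sum_w (E w x : nat)) ->
  (forall A X, s ^ 2 <= Lk * ecard comp A X -> s ^ 2 <= L2 * ecard E A X) ->
  4 * L0 <= L3 -> 2 * L0 * L1 <= Lk -> Lb <= Lk ->
  forall (t : {perm 'I_s}) w, s ^ 4 <= L2 ^ 3 * #|[set v | chain E t w (t w) v]|.
Proof.
move=> s0 row col bid rowE colE sur h3 hk hb t w.
have cardsum (P : pred 'I_s) : #|[set y | P y]| = \sum_y (P y : nat).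
  by rewrite -sum1_card big_mkcond /=; apply: eq_bigr => y _; rewrite inE; case: (P y).
pose A1 := [set w1 | E w (t w1)].
have cA1 : s <= L1 * #|A1|.
  rewrite /A1 cardsum; have := rowE w.
  by rewrite (reindex_inj (@perm_inj _ t)).
pose X2 := [set x | s <= L2 * \sum_(w1 in A1) (E w1 x : nat)].
have cX2 : s <= L3 * #|X2| by exact: (many_popular s0 row sur h3 hk cA1).
pose A4 := [set w4 | E w4 (t w)].
pose X4 := t @: A4.
have cX4 : s <= L1 * #|X4|.
  rewrite card_imset; last exact: perm_inj.
  by rewrite /A4 cardsum; apply: colE.
pose W3 := [set w3 | s <= L2 * \sum_(x4 in X4) (E w3 x4 : nat)].
have cW3 : s <= L3 * #|W3|.
  have := @many_popular L0 L1 L2 L3 Lk (fun x y => comp y x) (fun x y => E y x) X4 s0 col.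
  apply => // B X; rewrite (ecard_tr comp) (ecard_tr E); exact: sur.
pose W2 := [set w2 | t w2 \in X2].
have cW2 : s <= L3 * #|W2|.
  suff -> : #|W2| = #|X2| by [].
  rewrite -(card_imset _ (@perm_inj _ t)); apply: eq_card => x.
  apply/imsetP/idP => [[y + ->]|xX]; first by rewrite inE.
  by exists ((t^-1)%g x); [rewrite in_set permKV | rewrite permKV].
pose X3 := t @: W3.
have cX3 : s <= L3 * #|X3| by rewrite card_imset //; exact: perm_inj.
have eE : s ^ 2 <= L2 * ecard E W2 X3.
  apply: sur; apply: leq_trans (bid _ _ cW2 cX3) _; exact: leq_mul.
pose n1 w2 := \sum_w1 (E w (t w1) * E w1 (t w2)).
pose n4 w3 := \sum_w4 (E w3 (t w4) * E w4 (t w)).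
have hn1 w2 : w2 \in W2 -> s <= L2 * n1 w2.
  rewrite !inE => h; apply: leq_trans h _; rewrite leq_mul2l /n1; apply/orP; right.
  rewrite big_mkcond /=; apply: leq_sum => w1 _; rewrite inE.
  by case: (E w (t w1)); rewrite ?mul1n.
have hn4 w3 : w3 \in W3 -> s <= L2 * n4 w3.
  rewrite !inE => h; apply: leq_trans h _; rewrite leq_mul2l /n4; apply/orP; right.
  rewrite big_imset /=; last by move=> ? ? _ _; apply: perm_inj.
  rewrite big_mkcond /=; apply: leq_sum => w4 _; rewrite inE.
  by case: (E w4 (t w)); rewrite ?muln1.
have cch : #|[set v | chain E t w (t w) v]| =
   \sum_w2 \sum_w3 (E w2 (t w3) * (n1 w2 * n4 w3)).
  rewrite -sum1_card big_mkcond /=.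
  transitivity (\sum_w1 \sum_w2 \sum_w3 \sum_w4
     (E w2 (t w3) * ((E w (t w1) * E w1 (t w2)) * (E w3 (t w4) * E w4 (t w))))).
    rewrite !pair_bigA /=; apply: eq_bigr => -[[[w1 w2] w3] w4] _; rewrite inE /=.
    by case: (E w _); case: (E w1 _); case: (E w2 _); case: (E w3 _); case: (E w4 _).
  rewrite exchange_big /=; apply: eq_bigr => w2 _.
  rewrite exchange_big /=; apply: eq_bigr => w3 _.
  rewrite /n1 big_distrl big_distrr /=; apply: eq_bigr => w1 _.
  by rewrite !big_distrr /=.
have lo : \sum_(w2 in W2) \sum_(w3 in W3) (E w2 (t w3) * (n1 w2 * n4 w3)) <=
   #|[set v | chain E t w (t w) v]|.
  rewrite cch [X in _ <= X](bigID (mem W2)) /= (leq_trans _ (leq_addr _ _)) //.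
  apply: leq_sum => w2 _; rewrite [X in _ <= X](bigID (mem W3)) /=; exact: leq_addr.
have -> : s ^ 4 = s ^ 2 * s ^ 2 by rewrite -expnD.
apply: leq_trans (_ : s ^ 2 * (L2 * ecard E W2 X3) <= _); first by rewrite leq_mul2l eE orbT.
rewrite (expnS L2 2) -mulnA mulnCA leq_mul2l; apply/orP; right.
apply: leq_trans (leq_mul (leqnn _) lo).
rewrite /ecard !big_distrr /=; apply: leq_sum => w2 w2W.
rewrite /X3 big_imset /=; last by move=> ? ? _ _; apply: perm_inj.
rewrite !big_distrr /=; apply: leq_sum => w3 w3W.
rewrite mulnC mulnCA leq_mul2l; apply/orP; right.
rewrite -!mulnn mulnACA; apply: leq_mul; [exact: hn1 | exact: hn4].
Qed.

End ManyChains.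

(** * Lower-regular pairs and dense structures *)

Section Averaging.
Variable T : finType.
Implicit Types (f : T -> nat) (A B : {set T}).

(** Discarding an element of least value never lowers the average. *)
Lemma subset_ge_average f A k : k <= #|A| ->
  exists2 B : {set T}, B \subset A & #|B| = k /\
    k * (\sum_(x in A) f x) <= #|A| * (\sum_(x in B) f x).
Proof.
move=> kA; have [j] := ubnP (#|A| - k); elim: j A kA => // j IH A kA lt.
have [e|ne] := eqVneq k #|A|; first by exists A; rewrite // e.
have kA' : k < #|A| by rewrite ltn_neqAle ne kA.
have /card_gt0P[x0 x0A] : 0 < #|A| by lia.
case: (arg_minnP (P := mem A) f x0A) => x xA xmin.
have {}xA : x \in A := xA.
have cA : #|A| = #|A :\ x|.+1 by rewrite (cardsD1 x) xA.
have sA : \sum_(y in A) f y = f x + \sum_(y in A :\ x) f y by rewrite (big_setD1 x).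
have [|| B BA [cB hB]] := IH (A :\ x); [lia|lia|].
exists B; first by apply: subset_trans BA _; apply: subD1set.
split=> //.
have hx : #|A :\ x| * f x <= \sum_(y in A :\ x) f y.
  rewrite -sum_nat_const; apply: leq_sum => y; rewrite !inE => /andP[_ yA].
  exact: xmin.
have cpos : 0 < #|A :\ x| \/ k = 0 by lia.
case: cpos => [cp|->]; last by rewrite mul0n.
rewrite -(leq_pmul2l cp) sA; move: hB hx; rewrite cA.
set a := #|A :\ x|; set b := \sum_(y in A :\ x) _; set c := \sum_(y in B) _; set z := f x.
move=> hB hx.
have h1 : k * (a * z) <= k * b by rewrite leq_mul2l hx orbT.
have h2 : a.+1 * (k * b) <= a.+1 * (a * c) by rewrite leq_mul2l hB orbT.
have -> : a * (k * (z + b)) = k * (a * z) + a * (k * b) by lia.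
have -> : a * (a.+1 * c) = a.+1 * (a * c) by lia.
by apply: leq_trans h2; rewrite mulSn leq_add2r.
Qed.

Lemma subset_le_average f A k : k <= #|A| ->
  exists2 B : {set T}, B \subset A & #|B| = k /\
    #|A| * (\sum_(x in B) f x) <= k * (\sum_(x in A) f x).
Proof.
move=> kA; pose m := \sum_x f x.
have fm x : f x <= m by rewrite /m (bigD1 x) //= leq_addr.
have [B BA [cB hB]] := subset_ge_average (fun x => m - f x) kA.
exists B => //; split=> //.
have e (C : {set T}) : \sum_(x in C) (m - f x) + \sum_(x in C) f x = #|C| * m.
  by rewrite -big_split /= -sum_nat_const; apply: eq_bigr => x _; rewrite subnK.
have := e A; have := e B; rewrite cB.
move: hB; set a := \sum_(x in A) _; set b := \sum_(x in B) _.
set a' := \sum_(x in A) f x; set b' := \sum_(x in B) f x; set c := #|A|.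
move=> h1 h2 h3.
have h4 : c * b + c * b' = c * (k * m) by rewrite -h2; lia.
have h5 : k * a + k * a' = k * (c * m) by rewrite -h3; lia.
have h6 : c * (k * m) = k * (c * m) by lia.
by lia.
Qed.

End Averaging.

(** One increment shrinks the sets by a factor at most [2 * LE], and at most [8 * LE ^ 2 * Lt]
    increments are possible; the additional factor keeps the sets from becoming smaller than
    [LE]. *)
Definition regular_pair_ratio (LE Lt : nat) : nat := (2 * LE) ^ (8 * LE ^ 2 * Lt).+1.

Section DensePair.
Variables (X Y : finType) (r : X -> Y -> bool).
Implicit Types (A : {set X}) (B : {set Y}).

Definition eset A B := \sum_(x in A) \sum_(y in B) (r x y : nat).

Lemma eset_exch A B : eset A B = \sum_(y in B) \sum_(x in A) (r x y : nat).
Proof. exact: exchange_big. Qed.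

Lemma eset_split A A' B : A' \subset A -> eset A B = eset A' B + eset (A :\: A') B.
Proof.
move=> sub; rewrite /eset (bigID (mem A')) /=; congr (_ + _); apply: eq_bigl => x.
  by case: (boolP (x \in A')) => [/(subsetP sub) ->|_]; rewrite ?andbF.
by rewrite !inE andbC.
Qed.

Lemma eset_splitr A B B' : B' \subset B -> eset A B = eset A B' + eset A (B :\: B').
Proof.
move=> sub; rewrite /eset -big_split; apply: eq_bigr => x _.
rewrite (bigID (mem B')) /=; congr (_ + _); apply: eq_bigl => y.
  by case: (boolP (y \in B')) => [/(subsetP sub) ->|_]; rewrite ?andbF.
by rewrite !inE andbC.
Qed.

Lemma eset_le A B : eset A B <= #|A| * #|B|.
Proof.
rewrite /eset -sum_nat_const; apply: leq_sum => x _; rewrite -sum1_card.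
by apply: leq_sum => y _; apply: leq_b1.
Qed.

Lemma dense_subrect A B k l : k <= #|A| -> l <= #|B| -> 0 < #|A| -> 0 < #|B| ->
  exists A' B', [/\ A' \subset A, B' \subset B, #|A'| = k, #|B'| = l &
    k * l * eset A B <= #|A| * #|B| * eset A' B'].
Proof.
move=> kA lB A0 B0.
have [A' sA [cA hA]] := subset_ge_average (fun x => \sum_(y in B) (r x y : nat)) kA.
have [B' sB [cB hB]] := subset_ge_average (fun y => \sum_(x in A') (r x y : nat)) lB.
exists A', B'; split=> //.
have {}hA : k * eset A B <= #|A| * eset A' B := hA.
have {}hB : l * eset A' B <= #|B| * eset A' B' by rewrite !eset_exch.
apply: leq_trans (_ : #|A| * (l * eset A' B) <= _).
  by rewrite mulnCA (mulnC k) -mulnA leq_mul2l hA orbT.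
by rewrite -mulnA leq_mul2l hB orbT.
Qed.

Lemma sparse_subrect A B k l : k <= #|A| -> l <= #|B| ->
  exists A' B', [/\ A' \subset A, B' \subset B, #|A'| = k, #|B'| = l &
    #|A| * #|B| * eset A' B' <= k * l * eset A B].
Proof.
move=> kA lB.
have [A' sA [cA hA]] := subset_le_average (fun x => \sum_(y in B) (r x y : nat)) kA.
have [B' sB [cB hB]] := subset_le_average (fun y => \sum_(x in A') (r x y : nat)) lB.
exists A', B'; split=> //.
have {}hA : #|A| * eset A' B <= k * eset A B := hA.
have {}hB : #|B| * eset A' B' <= l * eset A' B by rewrite !eset_exch.
apply: leq_trans (_ : #|A| * (l * eset A' B) <= _).
  by rewrite -mulnA leq_mul2l hB orbT.
by rewrite mulnCA (mulnC k) -mulnA leq_mul2l hA orbT.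
Qed.

(** One-sided regularity: subsets of the single size [N %/ LE] keep half of the density of the pair.
    Larger subsets follow by averaging over subrectangles. *)
Definition lower_regular (LE N : nat) A B :=
  forall A' B', A' \subset A -> B' \subset B -> #|A'| = N %/ LE -> #|B'| = N %/ LE ->
    (N %/ LE) ^ 2 * eset A B <= 2 * N ^ 2 * eset A' B'.

(** If a [k] by [k] rectangle has less than half of the average density, the rest of the pair is
    denser than average. The rest splits into two rectangles, one of which gains a factor
    [1 + 1 / (8 * LE ^ 2)], because the sparse rectangle covers at least a fraction
    [1 / (4 * LE ^ 2)] of the pair. Averaging inside it yields a [k] by [k] rectangle of that
    density. *)
Lemma density_increment (LE N : nat) A B : 1 < LE -> LE <= N ->
  #|A| = N -> #|B| = N -> lower_regular LE N A B \/
  exists A' B', [/\ A' \subset A, B' \subset B, #|A'| = N %/ LE, #|B'| = N %/ LE &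
    (8 * LE ^ 2 + 1) * (N %/ LE) ^ 2 * eset A B <= 8 * LE ^ 2 * N ^ 2 * eset A' B'].
Proof.
move=> LE1 LEN cA cB; set k := N %/ LE.
have kN : k <= N by rewrite leq_div.
have k0 : 0 < k by rewrite divn_gt0 //; lia.
have N0 : 0 < N by lia.
have kN2 : 2 * k <= N by have := leq_divM N LE; rewrite -/k; nia.
have Nk : N <= 2 * LE * k.
  have : N < k.+1 * LE by apply: ltn_ceil; lia.
  by nia.
pose lr := [forall A' : {set X}, forall B' : {set Y}, [&& A' \subset A, B' \subset B, #|A'| == k & #|B'| == k] ==>
   (k ^ 2 * eset A B <= 2 * N ^ 2 * eset A' B')].
have [/forallP h|] := boolP lr.
  left=> A' B' sA sB cA' cB'; have /forallP/(_ B')/implyP := h A'.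
  by apply; rewrite sA sB cA' cB' !eqxx.
case/forallPn=> A' /forallPn[B']; rewrite negb_imply -ltnNge => /andP[/and4P[sA sB /eqP cA' /eqP cB']] sp.
right; pose e := eset A B; pose c := 8 * LE ^ 2.
have e1 : e = eset A' B' + eset A' (B :\: B') + eset (A :\: A') B.
  by rewrite /e (eset_split B sA) (eset_splitr A' sB).
have cD1 : #|A :\: A'| = N - k by rewrite cardsDS // cA cA'.
have cD2 : #|B :\: B'| = N - k by rewrite cardsDS // cB cB'.
have cc : 2 * N ^ 2 <= c * k ^ 2.
  have : N ^ 2 <= (2 * LE * k) ^ 2 by rewrite leq_exp2r.
  by rewrite !expnMn /c; nia.
have [h|h] : (c + 1) * ((N - k) * N) * e <= c * N ^ 2 * eset (A :\: A') B \/
             (c + 1) * (k * (N - k)) * e <= c * N ^ 2 * eset A' (B :\: B').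
  case: (leqP ((c + 1) * ((N - k) * N) * e) (c * N ^ 2 * eset (A :\: A') B)) => [?|h1]; first by left.
  case: (leqP ((c + 1) * (k * (N - k)) * e) (c * N ^ 2 * eset A' (B :\: B'))) => [?|h2]; first by right.
  exfalso.
  have h3 : c * (2 * N ^ 2 * eset A' B') <= c * (k ^ 2 * e) by rewrite leq_mul2l ltnW ?orbT.
  have h4 : 2 * (c * N ^ 2 * e) < 2 * ((c + 1) * ((N - k) * N) * e) + 2 * ((c + 1) * (k * (N - k)) * e) + c * (k ^ 2 * e).
    have {}h3 : 2 * (c * N ^ 2 * eset A' B') <= c * (k ^ 2 * e) by lia.
    rewrite {1}e1 !mulnDr; move: h1 h2 h3.
    set p1 := c * N ^ 2 * _; set p2 := c * N ^ 2 * _; set p3 := c * N ^ 2 * _.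
    by set p4 := (c + 1) * _ * e; set p5 := (c + 1) * _ * e; set p6 := c * _; lia.
  have h5 : (c + 1) * ((N - k) * N) + (c + 1) * (k * (N - k)) = (c + 1) * (N ^ 2 - k ^ 2).
    have -> : N ^ 2 - k ^ 2 = (N - k) * N + k * (N - k) by nia.
    by rewrite mulnDr.
  have h6 : 2 * (c * N ^ 2) < 2 * ((c + 1) * (N ^ 2 - k ^ 2)) + c * k ^ 2.
    have e0 : 0 < e by case: (e) h4 => //; rewrite !muln0.
    rewrite -(ltn_pmul2r e0).
    have -> : 2 * (c * N ^ 2) * e = 2 * (c * N ^ 2 * e) by rewrite -mulnA.
    apply: leq_trans h4 _; rewrite -h5; clearbody c.
    by set a := (N - k) * N; set b := k * (N - k); set q := k ^ 2; lia.
  have k2N2 : k ^ 2 <= N ^ 2 by rewrite leq_exp2r.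
  move: h6 cc k2N2; set p := N ^ 2; set q := k ^ 2 => h6 cc qp.
  have [D pD] : exists D, p = q + D by exists (p - q); lia.
  by move: h6 cc; rewrite pD addKn; lia.
- have [||||A1 [B1 [sA1 sB1 cA1 cB1 d1]]] := @dense_subrect (A :\: A') B k k; rewrite ?cD1 ?cB; try lia.
  exists A1, B1; split=> //; first by apply: subset_trans sA1 (subsetDl _ _).
  rewrite cD1 cB in d1; rewrite -/e -/c.
  have p0 : 0 < (N - k) * N by nia.
  rewrite -(leq_pmul2l p0).
  have g1 : k ^ 2 * ((c + 1) * ((N - k) * N) * e) <= k ^ 2 * (c * N ^ 2 * eset (A :\: A') B).
    by rewrite leq_mul2l h orbT.
  have g2 : c * N ^ 2 * (k * k * eset (A :\: A') B) <= c * N ^ 2 * ((N - k) * N * eset A1 B1).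
    by rewrite leq_mul2l d1 orbT.
  move: g1 g2; rewrite mulnn; set p := (N - k) * N; set q := k ^ 2; set u := c * N ^ 2.
  set e2 := eset _ _; set e3 := eset A1 B1 => g1 g2.
  have E1 : p * ((c + 1) * q * e) = q * ((c + 1) * p * e) by lia.
  have E2 : q * (u * e2) = u * (q * e2) by lia.
  have E3 : u * (p * e3) = p * (u * e3) by lia.
  by rewrite E1 -E3; apply: leq_trans g1 _; rewrite E2.
- have [||||A1 [B1 [sA1 sB1 cA1 cB1 d1]]] := @dense_subrect A' (B :\: B') k k; rewrite ?cD2 ?cA'; try lia.
  exists A1, B1; split=> //; first by apply: subset_trans sA1 sA.
    by apply: subset_trans sB1 (subsetDl _ _).
  rewrite cD2 cA' in d1; rewrite -/e -/c.
  have p0 : 0 < k * (N - k) by nia.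
  rewrite -(leq_pmul2l p0).
  have g1 : k ^ 2 * ((c + 1) * (k * (N - k)) * e) <= k ^ 2 * (c * N ^ 2 * eset A' (B :\: B')).
    by rewrite leq_mul2l h orbT.
  have g2 : c * N ^ 2 * (k * k * eset A' (B :\: B')) <= c * N ^ 2 * (k * (N - k) * eset A1 B1).
    by rewrite leq_mul2l d1 orbT.
  move: g1 g2; rewrite mulnn; set p := k * (N - k); set q := k ^ 2; set u := c * N ^ 2.
  set e2 := eset _ _; set e3 := eset A1 B1 => g1 g2.
  have E1 : p * ((c + 1) * q * e) = q * ((c + 1) * p * e) by lia.
  have E2 : q * (u * e2) = u * (q * e2) by lia.
  have E3 : u * (p * e3) = p * (u * e3) by lia.
  by rewrite E1 -E3; apply: leq_trans g1 _; rewrite E2.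
Qed.

(** Bernoulli's inequality [(1 + 1 / c) ^ J >= 1 + J / c], cleared of denominators. *)
Lemma pow_gap (c J : nat) : c ^ J * (c + J) <= (c + 1) ^ J * c.
Proof.
elim: J => [|J IH]; first by rewrite !expn0 !mul1n addn0.
rewrite !expnS; apply: leq_trans (_ : (c + 1) * (c ^ J * (c + J)) <= _); last first.
  by rewrite -[_ * _ * c]mulnA leq_mul2l IH orbT.
by set p := c ^ J; nia.
Qed.

(* iterating the density increment stops, since densities are at most 1 *)
Lemma lower_regular_pair (LE Lt : nat) : 1 < LE -> 0 < Lt ->
  forall t A B, regular_pair_ratio LE Lt <= t -> #|A| = t -> #|B| = t ->
    t ^ 2 <= Lt * eset A B ->
    exists N A' B', [/\ t <= regular_pair_ratio LE Lt * N, LE <= N, A' \subset A, B' \subset B &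
      [/\ #|A'| = N, #|B'| = N, lower_regular LE N A' B' & N ^ 2 <= Lt * eset A' B']].
Proof.
move=> LE1 Lt0; pose c := 8 * LE ^ 2; pose J0 := (c * Lt).
have c0 : 0 < c by rewrite /c muln_gt0 expn_gt0; lia.
rewrite /regular_pair_ratio -/c -/J0 => t A B tb cA cB den.
have L2 : 0 < 2 * LE by lia.
suff H j : j <= J0 ->
  (exists N A' B', [/\ t <= (2 * LE) ^ J0.+1 * N, LE <= N, A' \subset A, B' \subset B &
      [/\ #|A'| = N, #|B'| = N, lower_regular LE N A' B' & N ^ 2 <= Lt * eset A' B']]) \/
  (exists N A' B', [/\ t <= (2 * LE) ^ j * N, A' \subset A, B' \subset B, #|A'| = N /\ #|B'| = N &
      (c + 1) ^ j * N ^ 2 <= c ^ j * (Lt * eset A' B')]).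
  (* The initial density is at least [1 / Lt]; after [J0 = c * Lt] increments it would be at least
     [(1 + Lt) / Lt], which exceeds 1. *)
  case: (H J0 (leqnn _)) => // -[N [A' [B' [tN sA sB [cA' cB'] dn]]]].
  exfalso.
  have N0 : 0 < N.
    rewrite lt0n; apply/eqP => N0; move: tN; rewrite N0 muln0 leqn0 => /eqP t0.
    by move: tb; rewrite t0 leqn0 expn_eq0; lia.
  have := eset_le A' B'; rewrite cA' cB' mulnn => le1.
  have h1 : (c + 1) ^ J0 * N ^ 2 <= c ^ J0 * Lt * N ^ 2.
    by apply: leq_trans dn _; rewrite -mulnA !leq_mul2l le1 !orbT.
  rewrite leq_pmul2r ?expn_gt0 ?N0 // in h1.
  have := pow_gap c J0; have cJ : 0 < c ^ J0 by rewrite expn_gt0 c0.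
  have h2 : (c + 1) ^ J0 * c <= c ^ J0 * Lt * c by rewrite leq_mul2r h1 orbT.
  move=> h3; have := leq_trans h3 h2; rewrite -[_ * Lt * c]mulnA leq_pmul2l //.
  by rewrite /J0 mulnC; nia.
elim: j => [|j IH] jJ.
  right; exists t, A, B; split=> //; first by rewrite expn0 mul1n.
  by rewrite !expn0 !mul1n.
case: (IH (ltnW jJ)) => [|[N [A' [B' [tN sA sB [cA' cB'] dn]]]]]; first by left.
have pj : (2 * LE) ^ J0.+1 = (2 * LE) ^ j * (2 * LE) ^ (J0.+1 - j).
  by rewrite -expnD; congr (_ ^ _); lia.
have jj : (2 * LE) ^ 2 <= (2 * LE) ^ (J0.+1 - j) by rewrite leq_pexp2l //; lia.
have jN : 2 * LE <= N.
  have : (2 * LE) ^ j * (2 * LE) ^ (J0.+1 - j) <= (2 * LE) ^ j * N by rewrite -pj; apply: leq_trans tN.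
  rewrite leq_pmul2l ?expn_gt0 ?L2 // => h; have := leq_trans jj h; nia.
have dn' : N ^ 2 <= Lt * eset A' B'.
  have cj : c ^ j <= (c + 1) ^ j by case: (j) => // j'; rewrite leq_exp2r //; lia.
  have cj0 : 0 < c ^ j by rewrite expn_gt0 c0.
  rewrite -(leq_pmul2l cj0); apply: leq_trans dn; rewrite leq_mul2r cj orbT //.
case: (@density_increment LE N A' B' LE1 _ cA' cB'); first by lia.
  move=> lr; left; exists N, A', B'; split=> //; last by lia.
  by rewrite pj; apply: leq_trans tN _; rewrite -mulnA leq_mul2l leq_pmull ?orbT // expn_gt0 L2.
case=> A1 [B1 [sA1 sB1 cA1 cB1 d1]]; right; exists (N %/ LE), A1, B1; split=> //.
- rewrite expnSr; apply: leq_trans tN _; rewrite -mulnA leq_mul2l; apply/orP; right.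
  have : N < (N %/ LE).+1 * LE by apply: ltn_ceil; lia.
  have : 1 <= N %/ LE by rewrite divn_gt0; lia.
  by nia.
- exact: subset_trans sA1 sA.
- exact: subset_trans sB1 sB.
have N2 : 0 < N ^ 2 by rewrite expn_gt0; lia.
have d1' : (c + 1) * (N %/ LE) ^ 2 * eset A' B' <= c * N ^ 2 * eset A1 B1 := d1.
rewrite -(leq_pmul2l N2) (expnS (c + 1)) (expnS c).
have g1 : (c + 1) * (N %/ LE) ^ 2 * ((c + 1) ^ j * N ^ 2) <= (c + 1) * (N %/ LE) ^ 2 * (c ^ j * (Lt * eset A' B')).
  by rewrite leq_mul2l dn orbT.
have g2 : c ^ j * Lt * ((c + 1) * (N %/ LE) ^ 2 * eset A' B') <= c ^ j * Lt * (c * N ^ 2 * eset A1 B1).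
  by rewrite leq_mul2l d1' orbT.
move: g1 g2; set p := (N %/ LE) ^ 2; set q := N ^ 2; set u := (c + 1) ^ j; set v := c ^ j.
set e1 := eset A' B'; set e2 := eset A1 B1 => g1 g2.
have E1 : q * ((c + 1) * u * p) = (c + 1) * p * (u * q) by lia.
have E2 : (c + 1) * p * (v * (Lt * e1)) = v * Lt * ((c + 1) * p * e1) by lia.
have E3 : v * Lt * (c * q * e2) = q * (c * v * (Lt * e2)) by lia.
by rewrite E1 -E3; apply: leq_trans g1 _; rewrite E2.
Qed.

End DensePair.

(** With [Lth = 2 * (2 * Ld) ^ D], a tuple is compatible with at least a fraction [1 / Lth] of the
    vertices outside all tuples. The factor 256 lets degrees of order [N / Lth] survive the removal
    of exceptional vertices. The factor 4 pays for the rounding in [#|V| %/ Lt] and for this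
    removal, a factor 2 each. *)
Definition dense_structure_ratio (Ld D Lt : nat) : nat :=
  4 * Lt.+1 * regular_pair_ratio (256 * (2 * (2 * Ld) ^ D)) (2 * (2 * Ld) ^ D).

Lemma subset_between (T : finType) (S S' : {set T}) k : S \subset S' -> #|S| <= k -> k <= #|S'| ->
   exists S2 : {set T}, [/\ S \subset S2, S2 \subset S' & #|S2| = k].
Proof.
move=> sS c1 c2; have [|C sC [cC _]] := @subset_ge_average T (fun=> 0) (S' :\: S) (k - #|S|).
  by rewrite cardsDS //; lia.
exists (S :|: C); split; first exact: subsetUl.
  by rewrite subUset sS (subset_trans sC (subsetDl _ _)).
rewrite cardsU cC (_ : S :&: C = set0) ?cards0; first by lia.
by apply/setP => x; rewrite !inE; apply/negP => /andP[xS /(subsetP sC)]; rewrite inE xS.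
Qed.

(** * Tuples, reserves and dense compatibility in a graph of linear minimum degree *)

Section DenseGraph.
Variables (V : finType) (G : rel V) (Ld : nat).
Hypothesis Gsym : symmetric G.
Hypothesis Gdeg : forall v, #|V| <= Ld * #|[set w | G v w]|.
Implicit Types (F : {set V}).

(** Double counting: every vertex has at least [#|V| / Ld] neighbours, at most [#|V| / (2 * Ld)] of
    them in [F]. *)
Lemma weighted_average (w : V -> nat) F : 0 < #|V| -> 0 < Ld -> 2 * Ld * #|F| <= #|V| ->
  exists2 c, c \notin F & \sum_v w v <= 2 * Ld * \sum_(v | G c v) w v.
Proof.
move=> V0 Ld0 hF.
case: (pickP [pred c | (c \notin F) && (\sum_v w v <= 2 * Ld * \sum_(v | G c v) w v)]) => [c /andP[]|no].
  by exists c.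
exfalso; set W := \sum_v w v in no.
have hc c : c \notin F -> 2 * Ld * \sum_(v | G c v) w v < W.
  by move=> cF; have := no c; rewrite /= cF /= => /negbT; rewrite -ltnNge.
have FV : #|F| < #|V| by nia.
have nF : ~: F != set0 by rewrite -card_gt0 cardsCs setCK; lia.
have up : 2 * Ld * \sum_(c in ~: F) \sum_(v | G c v) w v < #|V| * W.
  case/set0Pn: nF => c0 c0F; rewrite (big_setD1 c0) //= mulnDr.
  have -> : #|V| * W = W + #|V|.-1 * W by case: (#|V|) V0 => // k _; rewrite mulSn.
  rewrite -addSn; apply: leq_add; first by apply: hc; move: c0F; rewrite inE.
  apply: leq_trans (_ : \sum_(c in ~: F :\ c0) W <= _).
    rewrite big_distrr /=; apply: leq_sum => c; rewrite !inE => /andP[_ cF].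
    exact: ltnW (hc _ cF).
  rewrite sum_nat_const leq_mul2r; apply/orP; right.
  have : #|~: F| = #|~: F :\ c0|.+1 by rewrite (cardsD1 c0) c0F.
  have : #|~: F| <= #|V| by apply: max_card.
  by lia.
have lo : #|V| * W <= 2 * Ld * \sum_(c in ~: F) \sum_(v | G c v) w v.
  rewrite (exchange_big_dep predT) //= !big_distrr /=; apply: leq_sum => v _.
  rewrite sum_nat_const mulnA leq_mul2r; apply/orP; right.
  have -> : #|[pred c in ~: F | G c v]| = #|[set c | G v c] :\: F|.
    by apply: eq_card => c; rewrite !inE Gsym.
  have : #|[set c | G v c]| <= #|[set c | G v c] :\: F| + #|F|.
    by rewrite -(cardsID F) addnC leq_add2l subset_leq_card // subsetIr.
  have := Gdeg v; move: hF; set a := #|[set c | G v c]|; set b := #|_ :\: _|; set f := #|F|.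
  move=> h1 h2 h3; have : Ld * a <= Ld * (b + f) by rewrite leq_mul2l h3 orbT.
  move: h1 h2; rewrite mulnDr -mulnA; move: (Ld * f) (Ld * a) (#|V|) => x y z h1 h2 h4.
  rewrite -mulnA; move: (Ld * b) h4 => u h4; lia.
by move: up; rewrite ltnNge lo.
Qed.

(** Greedy choice: the next vertex keeps a fraction [1 / (2 * Ld)] of the current common
    neighbourhood, by [weighted_average] for its indicator. *)
Lemma good_tuple D F : 0 < #|V| -> 0 < Ld -> 2 * Ld * (#|F| + D) <= #|V| ->
  exists s : seq V, [/\ size s = D, uniq s, all [predC F] s &
    #|V| <= (2 * Ld) ^ D * #|[set v | all (fun c => G c v) s]|].
Proof.
move=> V0 Ld0; elim: D => [|D IH] h.
  exists [::]; split=> //; rewrite expn0 mul1n (_ : [set v | _] = setT) ?cardsT //.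
have [s [sz us sF hs]] := IH ltac:(nia).
pose S := [set v | all (fun c => G c v) s].
have cF : #|F :|: [set c in s]| <= #|F| + D.
  apply: leq_trans (leq_card_setU _ _) _; rewrite leq_add2l cardsE -sz; exact: card_size.
have [|c cn hc] := @weighted_average (fun v => v \in S : nat) (F :|: [set c in s]) V0 Ld0; first by nia.
move: cn; rewrite !inE negb_or => /andP[ncF ncs].
exists (c :: s); split; rewrite /= ?sz ?ncs ?ncF ?sF //.
have e1 : \sum_v (v \in S : nat) = #|S|.
  by rewrite -sum1_card [RHS]big_mkcond; apply: eq_bigr => v _; case: (v \in S).
have e2 : \sum_(v | G c v) (v \in S : nat) = #|[set v | G c v && all (fun c => G c v) s]|.
  rewrite -sum1_card [RHS]big_mkcond [LHS]big_mkcond; apply: eq_bigr => v _.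
  by rewrite !inE; case: (G c v) => //=; case: (all _ _).
rewrite e1 e2 in hc; apply: leq_trans hs _; rewrite expnSr -mulnA leq_mul2l.
by rewrite hc orbT.
Qed.

Lemma good_tuples D t : 0 < #|V| -> 0 < Ld -> 2 * Ld * (D * t.+1) <= #|V| ->
  exists a : nat -> seq V, (forall i, i < t -> [/\ size (a i) = D, uniq (a i) &
      #|V| <= (2 * Ld) ^ D * #|[set v | all (fun c => G c v) (a i)]|]) /\
    (forall i j v, i < t -> j < t -> v \in a i -> v \in a j -> i = j).
Proof.
move=> V0 Ld0; elim: t => [|t IH] h; first by exists (fun => [::]).
have [a [ha hd]] := IH ltac:(nia).
pose F := [set v | has (fun i => v \in a i) (iota 0 t)].
have cF : #|F| <= D * t.
  have -> : F = \bigcup_(i < t) [set v in a i].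
    apply/setP => v; rewrite inE; apply/hasP/bigcupP => [[i]|[i _]].
      rewrite mem_iota add0n => /= it vi; exists (Ordinal it) => //.
      by rewrite inE.
    by rewrite inE => vi; exists (val i); rewrite // mem_iota /= ltn_ord.
  apply: leq_trans (_ : \sum_(i < t) D <= _); last by rewrite sum_nat_const card_ord mulnC.
  elim/big_ind2: _ => [|A x B y hA hB|i _]; rewrite ?cards0 //.
    by apply: leq_trans (leq_card_setU _ _) _; apply: leq_add.
  have [<- _ _] := ha i (ltn_ord i); rewrite cardsE; exact: card_size.
have [|s [sz us sF hs]] := @good_tuple D F V0 Ld0; first by nia.
exists (fun i => if i == t then s else a i); split=> [i|i j v].
  rewrite ltnS leq_eqVlt; case: eqP => [_ _|_ /= it]; [by split | exact: ha].
have nF k u : k < t -> u \in a k -> u \in s -> False.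
  move=> it wi ws; have /allP/(_ u ws) := sF; rewrite /= inE => /negP; apply.
  by apply/hasP; exists k; rewrite // mem_iota.
rewrite !ltnS [i <= t]leq_eqVlt [j <= t]leq_eqVlt.
case: (eqVneq i t) => [->|_] /=; case: (eqVneq j t) => [->|_] //= it jt vi vj.
- by case: (nF _ _ jt vj vi).
- by case: (nF _ _ it vi vj).
exact: hd vi vj.
Qed.

(** The method of conditional expectations for a random [t]-set. The next vertex is chosen so that
    its neighbours carry a fraction [1 / (2 * Ld)] of the potential, the sum of [2 ^ (t - cnt Y v)]
    over all [v]. Their terms are halved, so the potential drops by a factor [1 - 1 / (4 * Ld)]. A
    vertex with fewer than [t / K] neighbours in [Y] would alone exceed the final value. The shift
    by [t] in the exponent keeps the terms natural numbers. *)
Lemma dominating_set F t K : 0 < #|V| -> 0 < Ld -> 2 * Ld * (#|F| + t) <= #|V| ->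
  4 * (4 * Ld - 1) ^ K <= (4 * Ld) ^ K -> #|V| ^ K < 2 ^ t ->
  exists Y : {set V}, [/\ [disjoint Y & F], #|Y| = t &
    forall v, t <= K * #|[set y in Y | G v y]|].
Proof.
move=> V0 Ld0 hF hK hV.
pose cnt (Y : {set V}) v := #|[set y in Y | G v y]|.
have [Y [dY cY hY]] : exists Y : {set V}, [/\ [disjoint Y & F], #|Y| = t &
   (4 * Ld) ^ t * \sum_v 2 ^ (t - cnt Y v) <= (4 * Ld - 1) ^ t * (#|V| * 2 ^ t)].
  suff H i : i <= t -> exists Y : {set V}, [/\ [disjoint Y & F], #|Y| = i &
     (4 * Ld) ^ i * \sum_v 2 ^ (t - cnt Y v) <= (4 * Ld - 1) ^ i * (#|V| * 2 ^ t)].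
    exact: H.
  elim: i => [_|i IH it].
    exists set0; split; rewrite ?cards0 //; first by rewrite -setI_eq0 set0I.
    rewrite !expn0 !mul1n -sum_nat_const; apply: leq_sum => v _.
    by rewrite leq_exp2l // leq_subr.
  have [Y [dY cY hY]] := IH (ltnW it).
  have cFY : #|F :|: Y| <= #|F| + i by rewrite (leq_trans (leq_card_setU _ _)) // cY.
  have [|c cn hc] := @weighted_average (fun v => 2 ^ (t - cnt Y v)) (F :|: Y) V0 Ld0; first by nia.
  move: cn; rewrite !inE negb_or => /andP[ncF ncY].
  exists (c |: Y); split.
  - rewrite -setI_eq0 setIUl setU_eq0 [Y :&: F == _]setI_eq0 dY andbT setI_eq0.
    by rewrite disjoints1.
  - by rewrite cardsU1 ncY cY.
  pose Phi := \sum_v 2 ^ (t - cnt Y v); pose Hit := \sum_(v | G c v) 2 ^ (t - cnt Y v).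
  pose Phi' := \sum_v 2 ^ (t - cnt (c |: Y) v).
  have cntU v : cnt (c |: Y) v = G c v + cnt Y v.
    rewrite /cnt; case: (boolP (G c v)) => gv.
      have -> : [set y in c |: Y | G v y] = c |: [set y in Y | G v y].
        by apply/setP => y; rewrite !inE; case: eqVneq => //= ->; rewrite Gsym gv.
      by rewrite cardsU1 inE (negbTE ncY).
    rewrite add0n; apply: eq_card => y; rewrite !inE; case: eqVneq => //= ->.
    by rewrite Gsym (negbTE gv) andbF.
  have cntle v : cnt Y v <= i.
    by rewrite -cY; apply: subset_leq_card; apply/subsetP => y; rewrite inE => /andP[].
  have eP : 2 * Phi' + Hit = 2 * Phi.
    rewrite /Phi' /Hit /Phi (bigID (G c)) /= [X in _ = 2 * X](bigID (G c)) /= !mulnDr.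
    rewrite addnAC; congr (_ + _); last first.
      by congr (_ * _); apply: eq_bigr => v /negbTE gv; rewrite cntU gv.
    rewrite !big_distrr -big_split /=; apply: eq_bigr => v gv.
    rewrite cntU gv; have := cntle v; set q := cnt Y v => qi.
    have -> : t - q = (t - (true + q)).+1 by rewrite /=; lia.
    by rewrite expnS; lia.
  have hc' : Phi <= 2 * Ld * Hit := hc.
  have step : 4 * Ld * Phi' <= (4 * Ld - 1) * Phi.
    have : 2 * Ld * (2 * Phi' + Hit) = 2 * Ld * (2 * Phi) by rewrite eP.
    have : 2 * Ld * (2 * Phi' + Hit) = 4 * Ld * Phi' + 2 * Ld * Hit by lia.
    move=> h1 h2; have : 4 * Ld * Phi' + Phi <= 4 * Ld * Phi by lia.
    have : (4 * Ld - 1) * Phi + Phi = 4 * Ld * Phi.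
      by rewrite -mulSnr; congr (_ * _); lia.
    by lia.
  rewrite !expnSr -mulnA.
  apply: leq_trans (leq_mul (leqnn _) step) _.
  rewrite mulnCA [_ * (4 * Ld - 1) * _]mulnAC mulnC leq_mul2r.
  by rewrite -/Phi in hY; rewrite hY orbT.
exists Y; split=> // v.
rewrite leqNgt; apply/negP => lt; set q := #|[set y in Y | G v y]| in lt.
have h1 : (4 * Ld) ^ t * 2 ^ (t - q) <= (4 * Ld - 1) ^ t * (#|V| * 2 ^ t).
  by apply: leq_trans hY; rewrite leq_mul2l (bigD1 v) //= leq_addr orbT.
have qt : q <= t by rewrite -cY; apply: subset_leq_card; apply/subsetP => y; rewrite inE => /andP[].
have h2 : (4 * Ld) ^ t <= (4 * Ld - 1) ^ t * (#|V| * 2 ^ q).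
  have p2 : 0 < 2 ^ (t - q) by rewrite expn_gt0.
  rewrite -(leq_pmul2r p2); apply: leq_trans h1 _.
  by rewrite -!mulnA -expnD subnKC.
have h3 : ((4 * Ld) ^ t) ^ K <= ((4 * Ld - 1) ^ t * (#|V| * 2 ^ q)) ^ K.
  by case: (K) => // K'; rewrite leq_exp2r.
have h4 : 4 ^ t * ((4 * Ld - 1) ^ K) ^ t <= ((4 * Ld) ^ K) ^ t.
  by rewrite -expnMn; case: (t) => // t'; rewrite leq_exp2r.
rewrite -!expnM in h3 h4; rewrite !expnMn -!expnM in h3.
rewrite [K * t]mulnC in h4.
have p0 : 0 < (4 * Ld - 1) ^ (t * K) by rewrite expn_gt0; clear -Ld0; lia.
have h5 : 4 ^ t <= #|V| ^ K * 2 ^ (q * K).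
  by rewrite -(leq_pmul2r p0); apply: leq_trans h4 _; rewrite expnMn [leqRHS]mulnC.
have h6 : 2 ^ (q * K) <= 2 ^ t by rewrite leq_exp2l // mulnC ltnW.
have : 4 ^ t < 2 ^ t * 2 ^ t.
  apply: leq_ltn_trans h5 _; apply: leq_ltn_trans (leq_mul (leqnn _) h6) _.
  by rewrite ltn_mul2r expn_gt0.
by rewrite -expnMn ltnn.
Qed.

(** Disjoint tuples with large common neighbourhoods face equally many vertices outside all tuples,
    chosen of at least average compatibility, so that the density is at least [1 / Lth]. A
    lower-regular pair is extracted, and the few tuples and vertices of low degree are deleted. *)
Lemma dense_structure D : 0 < D -> 0 < Ld ->
  forall Lt, dense_structure_ratio Ld D Lt <= #|V| -> 4 * Ld * D <= Lt ->
  2 * (2 * Ld) ^ D * D <= Lt ->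
  let Lth := 2 * (2 * Ld) ^ D in
  exists (N : nat) (a : 'I_N -> 'I_D -> V) (B : {set V}),
   [/\ injective (fun p : 'I_N * 'I_D => a p.1 p.2), #|B| = N,
      (forall i l, a i l \notin B), #|V| <= dense_structure_ratio Ld D Lt * N & Lt * N <= #|V|] /\
   [/\ (forall i, N <= 8 * Lth * #|[set w in B | [forall l, G (a i l) w]]|),
       (forall w : V, w \in B -> N <= 8 * Lth * #|[set i | [forall l, G (a i l) w]]|) &
       (forall (A' : {set 'I_N}) (B' : {set V}), B' \subset B ->
          N <= 128 * Lth * #|A'| -> N <= 128 * Lth * #|B'| ->
          #|A'| * #|B'| <= 2 * Lth * \sum_(i in A') \sum_(w in B') [forall l, G (a i l) w])].
Proof.
move=> D0 Ld0 Lt; pose Lth := 2 * (2 * Ld) ^ D; pose LE := 256 * Lth.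
have Lth0 : 0 < Lth by rewrite /Lth muln_gt0 expn_gt0; lia.
pose LN1 := regular_pair_ratio LE Lth.
have LN10 : 0 < LN1 by rewrite /LN1 /regular_pair_ratio expn_gt0 muln_gt0 /LE; case: (Lth) Lth0.
have Hlr := fun t r => @lower_regular_pair 'I_t V r LE Lth ltac:(rewrite /LE; lia) Lth0 t.
rewrite -/LN1 in Hlr.
rewrite /dense_structure_ratio -/Lth -/LE -/LN1 => VL hLt hLt2.
clearbody LN1.
have Lt0 : 0 < Lt by nia.
pose t := #|V| %/ Lt.
have tV : Lt * t <= #|V| by rewrite mulnC leq_divM.
have Vt : #|V| < Lt * t.+1 by rewrite mulnC ltn_ceil.
have t4 : 4 * LN1 <= t by rewrite /t leq_divRL //; nia.
have t0 : 0 < t by lia.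
have V0 : 0 < #|V| by nia.
have [a [ha hd]] := @good_tuples D t V0 Ld0 ltac:(nia).
have /card_gt0P[v0 _] := V0.
pose r (i : 'I_t) v := all (fun c => G c v) (a i).
pose A0 := \bigcup_(i < t) [set v in a i].
have cA0 : #|A0| <= t * D.
  apply: leq_trans (_ : \sum_(i < t) D <= _); last by rewrite sum_nat_const card_ord.
  rewrite /A0; elim/big_rec2: _ => [|i x y _ h]; first by rewrite cards0.
  apply: leq_trans (leq_card_setU _ _) _; apply: leq_add => //.
  have [<- _ _] := ha i (ltn_ord i); rewrite cardsE; exact: card_size.
have row (i : 'I_t) : #|V| <= Lth * \sum_(v in ~: A0) (r i v : nat).
  have [_ _ hi] := ha i (ltn_ord i).
  have -> : \sum_(v in ~: A0) (r i v : nat) = #|[set v | r i v] :\: A0|.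
    rewrite -sum1_card [RHS]big_mkcond [LHS]big_mkcond; apply: eq_bigr => v _.
    by rewrite !inE; case: (v \in A0) => //=; case: (r i v).
  have h1 : #|[set v | r i v]| <= #|[set v | r i v] :\: A0| + #|A0|.
    by rewrite -(cardsID A0) addnC leq_add2l subset_leq_card // subsetIr.
  have h2 : Lth * #|[set v | r i v]| <= Lth * (#|[set v | r i v] :\: A0| + #|A0|).
    by rewrite leq_mul2l h1 orbT.
  have h3 : Lth * #|A0| <= #|V|.
    apply: leq_trans (leq_mul (leqnn _) cA0) _; apply: leq_trans tV.
    rewrite mulnCA mulnC leq_mul2r; apply/orP; right; exact: hLt2.
  have h4 : 2 * #|V| <= Lth * #|[set v | r i v]| by rewrite /Lth -mulnA leq_mul2l hi orbT.
  by move: h2 h3 h4; rewrite mulnDr; lia.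
have eT : t * #|V| <= Lth * eset r [set: 'I_t] (~: A0).
  rewrite /eset big_distrr /= -[X in X * _](card_ord t) -cardsT -sum_nat_const.
  by apply: leq_sum => i _; exact: row.
have ctA0 : t <= #|~: A0|.
  have : #|A0| + #|~: A0| = #|V| by rewrite cardsC.
  have : 4 * (t * D) <= #|V| by apply: leq_trans tV; nia.
  by nia.
have [B0 sB0 [cB0 hB0]] := subset_ge_average (fun v => \sum_(i in [set: 'I_t]) (r i v : nat)) ctA0.
rewrite -!eset_exch in hB0.
have dB0 : t ^ 2 <= Lth * eset r setT B0.
  rewrite -(leq_pmul2l V0).
  have h1 : t * (t * #|V|) <= t * (Lth * eset r [set: 'I_t] (~: A0)) by rewrite leq_mul2l eT orbT.
  have h2 : Lth * (t * eset r setT (~: A0)) <= Lth * (#|~: A0| * eset r setT B0) by rewrite leq_mul2l hB0 orbT.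
  have h3 : #|~: A0| * (Lth * eset r setT B0) <= #|V| * (Lth * eset r setT B0).
    by rewrite leq_mul2r max_card orbT.
  move: h1 h2 h3; rewrite -mulnn; set x := eset r setT (~: A0); set y := eset r setT B0.
  set p := #|~: A0|; set q := #|V|; clearbody Lth; lia.
have cT : #|[set: 'I_t]| = t by rewrite cardsT card_ord.
have [N [A' [B' [tN LEN sA sB [cA cB lr dn]]]]] := Hlr t r setT B0 ltac:(lia) cT cB0 dB0.
pose N' := N %/ LE.
have LE0 : 0 < LE by lia.
have N'0 : 0 < N' by rewrite divn_gt0.
have N'N : LE * N' <= N by rewrite mulnC leq_divM.
have N0 : 0 < N by lia.
(* Lower regularity covers one size only; for larger sets it is applied to a subrectangle of at most
   average density. *)
have bid (A3 : {set 'I_t}) (B3 : {set V}) : A3 \subset A' -> B3 \subset B' -> N' <= #|A3| -> N' <= #|B3| ->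
   #|A3| * #|B3| <= 2 * Lth * eset r A3 B3.
  move=> sA3 sB3 kA kB.
  have [A4 [B4 [sA4 sB4 cA4 cB4 sp]]] := @sparse_subrect _ _ r A3 B3 N' N' kA kB.
  have := lr A4 B4 (subset_trans sA4 sA3) (subset_trans sB4 sB3) cA4 cB4; rewrite -/N' => h1.
  have p1 : 0 < N' ^ 2 by rewrite expn_gt0 N'0.
  have p2 : 0 < N ^ 2 by rewrite expn_gt0 N0.
  rewrite -(leq_pmul2l p1) -(leq_pmul2l p2).
  move: h1 sp dn; rewrite mulnn; set q := N' ^ 2; set m := N ^ 2; set x := #|A3| * #|B3|.
  set e1 := eset r A' B'; set e3 := eset r A3 B3; set e4 := eset r A4 B4 => h1 h2 h3.
  have g1 : q * x * m <= q * x * (Lth * e1) by rewrite leq_mul2l h3 orbT.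
  have g2 : x * Lth * (q * e1) <= x * Lth * (2 * m * e4) by rewrite leq_mul2l h1 orbT.
  have g3 : Lth * 2 * m * (x * e4) <= Lth * 2 * m * (q * e3) by rewrite leq_mul2l h2 orbT.
  by clearbody q m x e1 e3 e4 Lth; clear -g1 g2 g3; lia.
pose Al := [set x in A' | 4 * Lth * \sum_(y in B') (r x y : nat) < N].
pose Bl := [set y in B' | 4 * Lth * \sum_(x in A') (r x y : nat) < N].
have sAl : Al \subset A' by apply/subsetP => x; rewrite inE => /andP[].
have sBl : Bl \subset B' by apply/subsetP => x; rewrite inE => /andP[].
have N'N1 : N' <= N by apply: leq_trans N'N; rewrite leq_pmull.
have cAl : #|Al| < N'.
  rewrite ltnNge; apply/negP => h; have := bid Al B' sAl (subxx _) h; rewrite cB => /(_ N'N1) h1.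
  have /card_gt0P[x0 x0A] : 0 < #|Al| by lia.
  have : 4 * Lth * eset r Al B' < #|Al| * N.
    rewrite /eset big_distrr -sum_nat_const /= (bigD1 x0) //= [X in _ < X](bigD1 x0) //= -addSn.
    apply: leq_add; first by move: x0A; rewrite inE => /andP[].
    by apply: leq_sum => x /andP[+ _]; rewrite inE => /andP[_ /ltnW].
  by move: h1; set e := eset _ _ _; clearbody Lth e; clear; lia.
have cBl : #|Bl| < N'.
  rewrite ltnNge; apply/negP => h; have := bid A' Bl (subxx _) sBl; rewrite cA => /(_ N'N1 h) h1.
  have /card_gt0P[x0 x0A] : 0 < #|Bl| by lia.
  have : 4 * Lth * eset r A' Bl < #|Bl| * N.
    rewrite eset_exch big_distrr -sum_nat_const /= (bigD1 x0) //= [X in _ < X](bigD1 x0) //= -addSn.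
    apply: leq_add; first by move: x0A; rewrite inE => /andP[].
    by apply: leq_sum => x /andP[+ _]; rewrite inE => /andP[_ /ltnW].
  by move: h1; set e := eset _ _ _; clearbody Lth e; clear; lia.
(* The deleted sets are padded to exactly [N'] elements, so that the tuples and [B] stay
   equinumerous. *)
have [Ar [sAr1 sAr2 cAr]] := subset_between sAl (ltnW cAl) ltac:(by rewrite cA).
have [Br [sBr1 sBr2 cBr]] := subset_between sBl (ltnW cBl) ltac:(by rewrite cB).
pose A1 := A' :\: Ar; pose B1 := B' :\: Br.
have cA1 : #|A1| = N - N' by rewrite cardsDS // cA cAr.
have cB1 : #|B1| = N - N' by rewrite cardsDS // cB cBr.
have sA1 : A1 \subset A' by apply: subsetDl.
have sB1 : B1 \subset B' by apply: subsetDl.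
pose xi (i : 'I_#|A1|) : 'I_t := enum_val i.
pose aa (i : 'I_#|A1|) (l : 'I_D) := nth v0 (a (xi i)) l.
have aaE i w : [forall l, G (aa i l) w] = r (xi i) w.
  have [sz _ _] := ha (xi i) (ltn_ord _).
  apply/forallP/(all_nthP v0) => [h l|h l]; first by rewrite sz => lD; apply: (h (Ordinal lD)).
  by apply: h; rewrite sz.
have rowA x : x \in A1 -> N <= 8 * Lth * \sum_(y in B1) (r x y : nat).
  rewrite !inE => /andP[xAr xA'].
  have : x \notin Al by apply: contra xAr; apply: (subsetP sAr1).
  rewrite inE xA' /= -leqNgt => h.
  have : \sum_(y in B') (r x y : nat) <= \sum_(y in B1) (r x y : nat) + N'.
    rewrite (bigID (mem Br)) /= addnC leq_add //.
      by rewrite (eq_bigl (mem B1)) // => y; rewrite !inE andbC.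
    rewrite -cBr -sum1_card [X in X <= _](eq_bigl (fun y => (y \in Br) && (y \in B'))).
      by rewrite big_mkcondr; apply: leq_sum => y _; case: ifP => // _; apply: leq_b1.
    by move=> y; rewrite andbC.
  move: h; set p := \sum_(y in B') _; set q := \sum_(y in B1) _ => h1 h2.
  have : 8 * Lth * p <= 8 * Lth * (q + N') by rewrite leq_mul2l h2 orbT.
  by move=> h3; move: N'N; rewrite /LE; clearbody Lth p q N'; clear -h1 h3; lia.
have colB y : y \in B1 -> N <= 8 * Lth * \sum_(x in A1) (r x y : nat).
  rewrite !inE => /andP[xAr xA'].
  have : y \notin Bl by apply: contra xAr; apply: (subsetP sBr1).
  rewrite inE xA' /= -leqNgt => h.
  have : \sum_(x in A') (r x y : nat) <= \sum_(x in A1) (r x y : nat) + N'.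
    rewrite (bigID (mem Ar)) /= addnC leq_add //.
      by rewrite (eq_bigl (mem A1)) // => x; rewrite !inE andbC.
    rewrite -cAr -sum1_card [X in X <= _](eq_bigl (fun x => (x \in Ar) && (x \in A'))).
      by rewrite big_mkcondr; apply: leq_sum => x _; case: ifP => // _; apply: leq_b1.
    by move=> x; rewrite andbC.
  move: h; set p := \sum_(x in A') _; set q := \sum_(x in A1) _ => h1 h2.
  have : 8 * Lth * p <= 8 * Lth * (q + N') by rewrite leq_mul2l h2 orbT.
  by move=> h3; move: N'N; rewrite /LE; clearbody Lth p q N'; clear -h1 h3; lia.
have sumB (P : pred V) : \sum_(y in B1) (P y : nat) = #|[set y in B1 | P y]|.
  rewrite -sum1_card [RHS]big_mkcond [LHS]big_mkcond; apply: eq_bigr => y _.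
  by rewrite !inE; case: (y \in Br); case: (y \in B') => //=; case: (P y).
have sumA (P : pred 'I_t) (S : {set 'I_#|A1|}) :
   \sum_(i in S) (P (xi i) : nat) = \sum_(x in xi @: S) (P x : nat).
  by rewrite big_imset //= => i j _ _; apply: enum_val_inj.
exists #|A1|, aa, B1; split; split.
- move=> [i l] [j l'] /= e.
  have [szi ui _] := ha (xi i) (ltn_ord _); have [szj uj _] := ha (xi j) (ltn_ord _).
  have mi : aa i l \in a (xi i) by rewrite mem_nth // szi.
  have mj : aa j l' \in a (xi j) by rewrite mem_nth // szj.
  rewrite -e in mj; have /val_inj/enum_val_inj eij := hd _ _ _ (ltn_ord _) (ltn_ord _) mi mj.
  move: e; rewrite -eij /aa => /eqP; rewrite nth_uniq ?szi // => /eqP/val_inj ->.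
  by [].
- by rewrite cB1 cA1.
- move=> i l; apply/negP => h.
  have := subsetP sB0 _ (subsetP sB _ (subsetP sB1 _ h)); rewrite inE => /negP; apply.
  have [szi ui _] := ha (xi i) (ltn_ord _).
  by apply/bigcupP; exists (xi i); rewrite // inE mem_nth // szi.
- have : N <= 2 * #|A1| by rewrite cA1; move: N'N; rewrite /LE; clearbody N'; clear -Lth0; nia.
  have : #|V| <= 2 * Lt * t.
    apply: leq_trans (ltnW Vt) _; rewrite [2 * Lt]mulnC -mulnA leq_mul2l; apply/orP; right.
    by move: t0; move: (t) => t'; clear; lia.
  have : LN1 * N <= LN1 * (2 * #|A1|) -> t <= LN1 * (2 * #|A1|) by apply: leq_trans.
  move=> h1 h2 h3; have {}h1 := h1 (leq_mul (leqnn _) h3).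
  have : 2 * Lt * t <= 2 * Lt * (LN1 * (2 * #|A1|)) by rewrite leq_mul2l h1 orbT.
  by move: h2; move: (#|A1|) => z; move: (t) (#|V|) => t' v; clear; lia.
- have : #|A1| <= t by rewrite -[X in _ <= X](card_ord t) max_card.
  by move=> h; apply: leq_trans tV; rewrite leq_mul2l h orbT.
- move=> i; rewrite -/Lth (_ : [set w in B1 | _] = [set w in B1 | r (xi i) w]); last first.
    by apply/setP => w; rewrite !inE aaE.
  rewrite -sumB; by apply: leq_trans (rowA _ (enum_valP i)); rewrite cA1 leq_subr.
- move=> w wB; rewrite -/Lth.
  have -> : #|[set i | [forall l, G (aa i l) w]]| = \sum_(x in A1) (r x w : nat).
    have eA1 : A1 = xi @: setT.
      apply/setP => x; apply/idP/imsetP => [xA|[i _ ->]]; last exact: enum_valP.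
      by exists (enum_rank_in xA x); rewrite // /xi enum_rankK_in.
    rewrite [RHS](eq_bigl (mem (xi @: setT))); last by move=> x; rewrite -eA1.
    rewrite -(sumA (r^~ w)) -sum1_card [LHS]big_mkcond /=; apply: eq_big => [i|i _]; rewrite ?inE //.
    by rewrite aaE; case: (r _ _).
  by apply: leq_trans (colB _ wB); rewrite cA1 leq_subr.
move=> S B3 sB3; rewrite -/Lth => h1 h2.
have cS : #|xi @: S| = #|S| by rewrite card_imset //; apply: enum_val_inj.
have N2 : N <= 2 * #|A1| by rewrite cA1; move: N'N; rewrite /LE; clearbody N'; clear -Lth0; nia.
have := bid (xi @: S) B3; rewrite cS.
have -> : eset r (xi @: S) B3 = \sum_(i in S) \sum_(w in B3) [forall l, G (aa i l) w].
  rewrite /eset big_imset /=; last by move=> ? ? _ _; apply: enum_val_inj.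
  by apply: eq_bigr => i _; apply: eq_bigr => w _; rewrite aaE.
apply.
- by apply/subsetP => _ /imsetP[i _ ->]; apply: (subsetP sA1); apply: enum_valP.
- exact: subset_trans sB3 sB1.
- by move: N'N h1 N2; rewrite /LE; move: (#|S|) => y; move: (#|A1|) => z; move: (N') => N''; clear -Lth0; nia.
by move: N'N h2 N2; rewrite /LE; move: (#|B3|) => y; move: (#|A1|) => z; move: (N') => N''; clear -Lth0; nia.
Qed.

End DenseGraph.

(** * Rooted trees and their decomposition into pieces *)

Lemma card_bigcup_le (I V : finType) (P : pred I) (F : I -> {set V}) :
  #|\bigcup_(i | P i) F i| <= \sum_(i | P i) #|F i|.
Proof.
elim/big_rec2: _ => [|i x y _ h]; first by rewrite cards0.
by apply: leq_trans (leq_card_setU _ _) _; rewrite leq_add2l.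
Qed.

Section RootedTree.
Variables (U : finType) (T : {set {set U}}).
Hypothesis tree : is_tree T.

Lemma adj_sym : symmetric (adj T).
Proof. by move=> x y; rewrite /adj setUC. Qed.

Lemma adj_irr x : adj T x x = false.
Proof.
case: tree => /subsetP gT _ _ _; apply/negP => /gT.
by rewrite inE setUid cards1.
Qed.

Section Root.
Variable rho : U.

Definition reach k u := [exists p : k.-tuple U, path (adj T) rho p && (last rho p == u)].

Lemma ex_reach u : exists k, reach k u.
Proof.
case: tree => _ _ /(_ rho u)/connectP[p pp ->] _.
by exists (size p); apply/existsP; exists (in_tuple p); rewrite pp eqxx.
Qed.

Definition depth u := ex_minn (ex_reach u).

Lemma depth_reach u : reach (depth u) u.
Proof. by rewrite /depth; case: ex_minnP. Qed.

Lemma depth_min u k : reach k u -> depth u <= k.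
Proof. by rewrite /depth; case: ex_minnP => m _; apply. Qed.

Lemma reach_step k u v : reach k u -> adj T u v -> reach k.+1 v.
Proof.
case/existsP=> p /andP[pp /eqP lp] uv; apply/existsP.
have sz : size (rcons p v) == k.+1 by rewrite size_rcons size_tuple.
by exists (Tuple sz); rewrite /= rcons_path pp lp uv last_rcons eqxx.
Qed.

Lemma depth_adj u v : adj T u v -> depth v <= (depth u).+1.
Proof. by move=> uv; apply: depth_min; apply: reach_step uv; apply: depth_reach. Qed.

Lemma depth_root : depth rho = 0.
Proof.
apply/eqP; rewrite -leqn0; apply: depth_min; apply/existsP.
by exists [tuple]; rewrite /= eqxx.
Qed.

Lemma ex_parent u : u != rho -> exists2 v, adj T v u & depth u = (depth v).+1.
Proof.
move=> nu; have /existsP[[p /eqP sz] /= /andP[pp /eqP lp]] := depth_reach u.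
case/lastP: p sz pp lp => [|p v] sz.
  by move=> _ /= e; rewrite e eqxx in nu.
rewrite rcons_path last_rcons => /andP[pp av] e; rewrite {v}e in av sz *.
exists (last rho p) => //; apply/eqP; rewrite eqn_leq; apply/andP; split; first exact: depth_adj.
rewrite -sz size_rcons ltnS; apply: depth_min; apply/existsP.
by exists (in_tuple p); rewrite pp eqxx.
Qed.

Definition parent u := odflt u [pick v | adj T v u && (depth u == (depth v).+1)].

Lemma parentP u : u != rho -> adj T (parent u) u /\ depth u = (depth (parent u)).+1.
Proof.
move=> nu; rewrite /parent; case: pickP => [v /andP[a /eqP]|/=] //.
have [v av dv] := ex_parent nu; move=> /(_ v).
by rewrite av dv eqxx.
Qed.

Lemma depth_eq0 u : (depth u == 0) = (u == rho).
Proof.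
apply/eqP/eqP => [d0|->]; last exact: depth_root.
by apply: contraPeq d0 => /parentP[_ ->].
Qed.

Lemma depth_iter i u : i <= depth u -> depth (iter i parent u) = depth u - i.
Proof.
elim: i => [|i IH] iu; first by rewrite subn0.
have di := IH (ltnW iu).
have nr : iter i parent u != rho by rewrite -depth_eq0 di subn_eq0 -ltnNge.
by have [_] := parentP nr; rewrite -iterS di => h; lia.
Qed.

Lemma path_traject i u : i <= depth u -> path (adj T) u (traject parent (parent u) i).
Proof.
elim: i u => [|i IH] u iu //=.
have nu : u != rho by rewrite -depth_eq0; lia.
have [a du] := parentP nu; rewrite adj_sym a /=; apply: IH; lia.
Qed.

Lemma traject_uniq i u : i <= depth u -> uniq (traject parent u i.+1).
Proof.
move=> iu; apply/(uniqP u) => p q; rewrite !inE size_traject => pi qi.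
rewrite !nth_traject // => /(congr1 depth); rewrite !depth_iter; lia.
Qed.

(** For an edge that is not a parent edge, climb from both ends to a common ancestor with the least
    total number of steps. By minimality the two climbs meet only there, and the edge closes them to
    a cycle. *)
Lemma adj_parent x y : adj T x y ->
  (x != rho /\ parent x = y) \/ (y != rho /\ parent y = x).
Proof.
move=> xy.
case: (boolP ((x != rho) && (parent x == y))) => [/andP[? /eqP]|nx]; first by left.
case: (boolP ((y != rho) && (parent y == x))) => [/andP[? /eqP]|ny]; first by right.
exfalso.
pose P n := [exists i : 'I_n.+1, [&& i <= depth x, n - i <= depth y &
   iter i parent x == iter (n - i) parent y]].
have exP : exists n, P n.
  exists (depth x + depth y); apply/existsP.
  have lt : depth x < (depth x + depth y).+1 by lia.
  exists (Ordinal lt); rewrite /= leqnn addKn leqnn /=.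
  have rt u : iter (depth u) parent u = rho.
    by apply/eqP; rewrite -depth_eq0 depth_iter // subnn.
  by rewrite !rt.
case: (ex_minnP exP) => n /existsP[[i ilt] /= /and3P[ix]].
set j := n - i => jy /eqP eij nmin.
have nij : n = i + j by rewrite /j; lia.
have min p q : p <= depth x -> q <= depth y -> iter p parent x = iter q parent y -> i + j <= p + q.
  move=> px qy epq; rewrite -nij; apply: nmin; apply/existsP.
  have lt : p < (p + q).+1 by lia.
  by exists (Ordinal lt); rewrite /= addKn px qy epq eqxx.
(* The cycle has [i + j + 1] vertices. The smaller cases are a loop and the two excluded parent
   edges. *)
have ij2 : 2 <= i + j.
  rewrite leqNgt; apply/negP => lt; case: i j {ilt nmin} ix jy eij nij lt min => [|[|i]] [|[|j]] //=.
  - by move=> _ _ e; rewrite e adj_irr in xy.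
  - move=> _ jy e _ _ _; case/negP: ny; rewrite -e eqxx andbT -depth_eq0; lia.
  - move=> ix _ e _ _ _; case/negP: nx; rewrite e eqxx andbT -depth_eq0; lia.
pose s := traject parent x i.+1 ++ rev (traject parent y j).
case: tree => _ _ _ /(_ s); apply.
  by rewrite size_cat size_rev !size_traject; lia.
apply/andP; split; last first.
  rewrite cat_uniq traject_uniq // rev_uniq /=; apply/andP; split.
    apply/hasPn => z; rewrite mem_rev => /trajectP[q qj ->].
    apply/negP => pz; have /trajectP[p pi e] : iter q parent y \in traject parent x i.+1 := pz.
    by have := min p q ltac:(lia) ltac:(lia) (esym e); lia.
  by case: (j) jy => [|j'] jy //; apply: traject_uniq; lia.
rewrite /s /= rcons_cat cat_path path_traject //=.
have lst u i' : last u (traject parent (parent u) i') = iter i' parent u.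
  by case: i' => // i'; rewrite last_traject iterSr.
rewrite lst eij -rev_cons.
have -> : x :: traject parent y j = belast x (traject parent y j.+1).
  by rewrite trajectSr belast_rcons.
have -> : iter j parent y = last x (traject parent y j.+1).
  by rewrite trajectSr last_rcons.
rewrite rev_path /= [adj T y x]adj_sym xy /=.
rewrite (eq_path (e' := adj T)) ?path_traject // => u v; exact: adj_sym.
Qed.

End Root.

Lemma rooted_tree : exists (rho : U) (par : U -> U) (dep : U -> nat),
  [/\ dep rho = 0, (forall u, u != rho -> dep u = (dep (par u)).+1),
      (forall u, u != rho -> adj T (par u) u) &
      (forall x y, adj T x y ->
        (x != rho /\ par x = y) \/ (y != rho /\ par y = x))].
Proof.
have [rho _] : exists rho : U, rho \in U by case: tree => _ /card_gt0P[r ?] _ _; exists r.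
exists rho, (parent rho), (depth rho); split.
- exact: depth_root.
- by move=> u /parentP[].
- by move=> u /parentP[].
- exact: adj_parent.
Qed.

End RootedTree.

Section Cutting.
Variables (U : finType) (rho : U) (par : U -> U) (dep : U -> nat) (d h : nat).
Hypothesis dep_root : dep rho = 0.
Hypothesis dep_par : forall u, u != rho -> dep u = (dep (par u)).+1.
Hypothesis few_children : forall x, #|[set u | (u != rho) && (par u == x)]| <= d.
Hypothesis h0 : 0 < h.
Hypothesis d0 : 0 < d.

Lemma dep_gt0 u : 0 < dep u -> u != rho.
Proof. by apply: contraTneq => ->; rewrite dep_root. Qed.

Lemma card_iter_par j x : #|[set u | (j <= dep u) && (iter j par u == x)]| <= d ^ j.
Proof.
elim: j x => [|j IH] x.
  rewrite expn0 -(cards1 x); apply: subset_leq_card; apply/subsetP => u.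
  by rewrite !inE.
pose Ch := [set v | (v != rho) && (par v == x)].
have sub : [set u | (j < dep u) && (iter j.+1 par u == x)] \subset
   \bigcup_(v in Ch) [set u | (j <= dep u) && (iter j par u == v)].
  apply/subsetP => u; rewrite inE => /andP[ju /eqP e]; apply/bigcupP.
  exists (iter j par u); last by rewrite inE eqxx (ltnW ju).
  rewrite inE -e iterS eqxx andbT; apply: dep_gt0.
  have : forall i, i <= dep u -> dep (iter i par u) = dep u - i.
    elim=> [|i IHi] iu; first by rewrite subn0.
    have := dep_par (u := iter i par u); rewrite (IHi (ltnW iu)) => H.
    rewrite iterS; have := H (dep_gt0 _); rewrite (IHi (ltnW iu)); lia.
  by move=> ->; lia.
apply: leq_trans (subset_leq_card sub) _.
apply: leq_trans (_ : \sum_(v in Ch) d ^ j <= _); last first.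
  by rewrite sum_nat_const expnS leq_mul2r few_children orbT.
apply: leq_trans (card_bigcup_le _ _) _; exact: leq_sum.
Qed.

(** The cut vertices are the root and all vertices whose depth is congruent to [r] modulo [h], for a
    residue [r] with at most an average number of vertices. A piece consists of the vertices with
    the same nearest cut ancestor, fewer than [h] levels. Pieces are numbered by the depth of their
    cut vertex, so the parent of a cut vertex lies in an earlier piece. *)
Lemma tree_cut : exists (Ct : {set U}) (pos : U -> nat),
  [/\ rho \in Ct, #|Ct| * h <= #|U| + h,
      (forall u, u \notin Ct -> pos (par u) = pos u),
      (forall u, u \in Ct -> u != rho -> pos (par u) < pos u) &
      [/\ {in Ct &, injective pos}, (forall u, pos u < #|Ct|) &
      (forall i, #|[set u | pos u == i]| <= h * d ^ h)]].
Proof.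
have [r rh rsmall] : exists2 r, r < h & #|[set u | dep u %% h == r]| * h <= #|U|.
  case: (leqP (\sum_(r < h) 1) 0) => [|_]; first by rewrite sum_nat_const card_ord; lia.
  have tot : \sum_(r < h) #|[set u | dep u %% h == r]| = #|U|.
    under eq_bigr => r _ do rewrite -sum1dep_card big_mkcond.
    rewrite exchange_big -sum1_card /=; apply: eq_bigr => u _.
    rewrite (bigD1 (Ordinal (ltn_pmod (dep u) h0))) //= eqxx big1 // => r /negbTE nr.
    by rewrite -[X in if X then _ else _]/(val (Ordinal (ltn_pmod (dep u) h0)) == val r) val_eqE eq_sym nr.
  case: (pickP (fun r : 'I_h => #|[set u | dep u %% h == r]| * h <= #|U|)) => [r hr|no].
    by exists (val r); [exact: ltn_ord | exact: hr].
  have : \sum_(r < h) #|U| < \sum_(r < h) #|[set u | dep u %% h == r]| * h.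
    rewrite (bigD1 (Ordinal h0)) //= [X in _ < X](bigD1 (Ordinal h0)) //= -addSn.
    have nolt (r : 'I_h) : #|U| < #|[set u | dep u %% h == r]| * h.
      by rewrite ltnNge; apply/negbT; exact: (no r).
    by apply: leq_add; [exact: (nolt (Ordinal h0)) | apply: leq_sum => r _; exact: ltnW].
  by rewrite -big_distrl /= tot sum_nat_const card_ord mulnC ltnn.
pose Ct := [set u | (u == rho) || (dep u %% h == r)].
(* The number of steps up to the nearest cut vertex; for depths below [r] this is the root. *)
pose st u := if dep u < r then dep u else (dep u - r) %% h.
pose rof u := iter (st u) par u.
have stdep u : st u <= dep u.
  by rewrite /st; case: ltnP => // _; apply: leq_trans (leq_mod _ _) (leq_subr _ _).
have sth u : st u < h.
  by rewrite /st; case: (ltnP (dep u) r) => [lt|_]; [exact: ltn_trans lt rh | rewrite ltn_pmod].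
have stCt u : (u \in Ct) = (st u == 0).
  rewrite inE /st; case: ltnP => [lt|ge].
    rewrite modn_small; last exact: ltn_trans rh.
    rewrite (ltn_eqF lt) orbF; apply/eqP/eqP => [->|d0']; first exact: dep_root.
    by apply: contraPeq d0' => /dep_par ->.
  have e : (dep u %% h == r) = ((dep u - r) %% h == 0).
    by have := eqn_modDr r (dep u - r) 0 h; rewrite subnK // add0n (modn_small rh) mod0n.
  rewrite -e; case: eqVneq => //= ur; apply/esym/eqP.
  by move: ge; rewrite ur dep_root leqn0 => /eqP ->; rewrite mod0n.
have stS u : u \notin Ct -> st u = (st (par u)).+1.
  move=> nC; have nr : u != rho by apply: contraNneq nC => ->; rewrite inE eqxx.
  move: nC; rewrite stCt /st (dep_par nr); set a := dep (par u).
  case: (ltnP a.+1 r) => ar; first by rewrite (ltn_trans (ltnSn a) ar).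
  case: (ltnP a r) => ar'.
    have -> : a.+1 - r = 0 by lia.
    by rewrite mod0n.
  rewrite subSn //; set b := a - r.
  rewrite modnS; case: ifP => //.
have rofS u : u \notin Ct -> rof u = rof (par u).
  by move=> nC; rewrite /rof (stS u nC) iterSr.
have deprof u : dep (rof u) = dep u - st u.
  have : forall i, i <= dep u -> dep (iter i par u) = dep u - i.
    elim=> [|i IHi] iu; first by rewrite subn0.
    have di := IHi (ltnW iu).
    have nr : iter i par u != rho by apply: dep_gt0; rewrite di; lia.
    by have := dep_par nr; rewrite di -iterS; lia.
  by apply.
have rofC u : rof u \in Ct.
  have [k] := ubnP (st u); elim: k u => // k IH u.
  have [|nC] := boolP (u \in Ct).
    by move=> uC; move: (uC); rewrite {1}stCt /rof => /eqP ->.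
  by rewrite (stS _ nC) (rofS _ nC) ltnS; apply: IH.
have rofid u : u \in Ct -> rof u = u by rewrite stCt /rof => /eqP ->.
pose le x y := dep x <= dep y.
pose ell := sort le (enum Ct).
have letr : transitive le by move=> y x z; apply: leq_trans.
have letot : total le by move=> x y; apply: leq_total.
have srt : sorted le ell by apply: sort_sorted.
have mem_ell u : (u \in ell) = (u \in Ct) by rewrite mem_sort mem_enum.
pose pos u := index (rof u) ell.
exists Ct, pos; split.
- by rewrite inE eqxx.
- have : #|Ct| <= #|[set u | dep u %% h == r]| + 1.
    have -> : Ct = rho |: [set u | dep u %% h == r] by apply/setP => u; rewrite !inE.
    by rewrite cardsU1 addnC leq_add2l leq_b1.
  by nia.
- by move=> u nC; rewrite /pos -rofS.
- move=> u uC nr; rewrite /pos [rof u]rofid // ltnNge; apply/negP => le1.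
  have := sorted_leq_index letr (fun x => leqnn _) srt; rewrite /prop_in2 => H.
  have := H u (rof (par u)); rewrite !mem_ell uC rofC => /(_ isT isT le1).
  by rewrite /le deprof (dep_par nr); lia.
split.
- move=> u v uC vC; rewrite /pos !rofid // => e.
  by rewrite -(nth_index u (s := ell) (x := u)) ?mem_ell // e nth_index ?mem_ell.
- by move=> u; rewrite /pos cardE -(size_sort le) index_mem mem_ell.
- move=> i; case: (ltnP i (size ell)) => ilt; last first.
    rewrite (_ : [set u | _] = set0) ?cards0 //; apply/setP => u; rewrite !inE.
    by apply/eqP => e; move: ilt; rewrite -e leqNgt index_mem mem_ell rofC.
  pose x := nth rho ell i.
  have sub : [set u | pos u == i] \subset
     \bigcup_(j < h) [set u | (j <= dep u) && (iter j par u == x)].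
    apply/subsetP => u; rewrite inE => /eqP pu; apply/bigcupP.
    exists (Ordinal (sth u)) => //; rewrite inE /= stdep /=.
    by rewrite /x -pu nth_index // mem_ell rofC.
  apply: leq_trans (subset_leq_card sub) _.
  apply: leq_trans (_ : \sum_(j < h) d ^ h <= _); last by rewrite sum_nat_const card_ord.
  apply: leq_trans (card_bigcup_le _ _) _; apply: leq_sum => j _.
  apply: leq_trans (card_iter_par _ _) _.
  by case: (d) d0 => // -[|d'] _; rewrite ?exp1n // leq_exp2l // ltnW.
Qed.

End Cutting.

(** * Embedding a forest piece by piece *)

Lemma subset_card (T : finType) (S : {set T}) k : k <= #|S| ->
  exists2 S2 : {set T}, S2 \subset S & #|S2| = k.
Proof.
move=> h; have [|S2 [_ s2 c2]] := @subset_between T set0 S k (sub0set _) _ h; first by rewrite cards0.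
by exists S2.
Qed.

Lemma disjoint_subsets (U V : finType) (K : {set U}) (X : U -> {set V}) k m :
  #|K| <= k -> (forall u, u \in K -> k * m <= #|X u|) ->
  exists X' : U -> {set V}, [/\ forall u, u \in K -> X' u \subset X u,
    forall u, u \in K -> #|X' u| = m &
    forall u v, u \in K -> v \in K -> u != v -> [disjoint X' u & X' v]].
Proof.
move=> + hX.
suff H j (K' : {set U}) : #|K'| = j -> j <= k -> K' \subset K ->
  exists X' : U -> {set V}, [/\ forall u, u \in K' -> X' u \subset X u,
    forall u, u \in K' -> #|X' u| = m &
    forall u v, u \in K' -> v \in K' -> u != v -> [disjoint X' u & X' v]].
  by move=> cK; apply: (H #|K|).
elim: j K' => [|j IH] K' cK' jk sK.
  move/eqP: cK'; rewrite cards_eq0 => /eqP ->; exists X.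
  by split=> [u|u|u v]; rewrite inE.
have /card_gt0P[u uK'] : 0 < #|K'| by rewrite cK'.
have cD : #|K' :\ u| = j by move: cK'; rewrite (cardsD1 u) uK' => -[].
have [X1 [s1 c1 d1]] := IH _ cD (ltnW jk) (subset_trans (subsetDl _ _) sK).
pose used := \bigcup_(v in K' :\ u) X1 v.
have cU : #|used| <= j * m.
  apply: (@leq_trans (\sum_(v in K' :\ u) m)); last by rewrite sum_nat_const cD.
  apply: (@leq_trans (\sum_(v in K' :\ u) #|X1 v|)).
    rewrite /used; elim/big_rec2: _ => [|v x y _ h]; first by rewrite cards0.
    by apply: leq_trans (leq_card_setU _ _) _; apply: leq_add.
  by apply: leq_sum => v vK; rewrite c1.
have cX : m <= #|X u :\: used|.
  have := hX u (subsetP sK _ uK'); rewrite cardsD.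
  have : #|X u :&: used| <= #|used| by rewrite subset_leq_card // subsetIr.
  have : j.+1 * m <= k * m by rewrite leq_mul2r jk orbT.
  by rewrite mulSn; lia.
have [Xu sXu cXu] := subset_card cX.
exists (fun v => if v == u then Xu else X1 v); split=> [v|v|v w].
- case: eqP => [-> _|/eqP vu vK]; first exact: subset_trans sXu (subsetDl _ _).
  by apply: s1; rewrite !inE vu.
- case: eqP => // /eqP vu vK; by apply: c1; rewrite !inE vu.
have dj v1 : v1 \in K' -> v1 != u -> [disjoint Xu & X1 v1].
  move=> vK vu; rewrite -setI_eq0; apply/eqP/setP => x; rewrite !inE.
  apply/negP => /andP[/(subsetP sXu)]; rewrite !inE => /andP[/negP nx _] x1; apply: nx.
  by apply/bigcupP; exists v1; rewrite // !inE vu.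
case: (eqVneq v u) => [->|vu]; case: (eqVneq w u) => [->|wu] vK wK vw.
- by case/negP: vw.
- exact: dj.
- by rewrite disjoint_sym; apply: dj.
by apply: d1; rewrite // !inE ?vu ?wu.
Qed.

Section Embedding.
Variables (U V : finType) (par : U -> U) (dep pos : U -> nat) (Ct : {set U}).
Variables (d s0 beta : nat) (G : rel V) (A : {set V}).

(** In a rooted tree this singles out the vertices other than the root, where [par] is arbitrary;
    the embedding then needs no mention of the root. *)
Definition is_child v := dep v == (dep (par v)).+1.
Definition te : rel U := fun u v => (is_child v && (par v == u)) || (is_child u && (par u == v)).

Hypothesis posN : forall v, is_child v -> v \notin Ct -> pos (par v) = pos v.
Hypothesis posC : forall v, is_child v -> v \in Ct -> pos (par v) < pos v.
Hypothesis few_children : forall u, #|[set v | is_child v && (par v == u)]| <= d.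
Hypothesis piece_size : forall i, #|[set u | pos u == i]| <= s0.
Hypothesis Gsym : symmetric G.
Hypothesis beta0 : 0 < beta.
Hypothesis joined : forall X Z : {set V}, X \subset ~: A -> Z \subset ~: A -> [disjoint X & Z] ->
  beta <= #|X| -> beta <= #|Z| -> exists x y, [/\ x \in X, y \in Z & G x y].

Lemma te_sym : symmetric te.
Proof. by move=> u v; rewrite /te orbC. Qed.

Lemma te_pos u v : te u v -> u \notin Ct -> v \notin Ct -> pos u = pos v.
Proof. by case/orP=> /andP[c /eqP <-] uC vC; rewrite posN. Qed.

(* the deepest vertex of the forest is removed, and the target of its parent is
   reduced to the vertices having a neighbour in the removed target *)
Lemma piece_embed (psi0 : U -> V) (K : {set U}) (X : U -> {set V}) :
  (forall u, u \in K -> X u \subset ~: A) ->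
  (forall u v, u \in K -> v \in K -> u != v -> [disjoint X u & X v]) ->
  (forall u, u \in K -> d.+1 * beta <= #|X u|) ->
  exists2 psi : U -> V, (forall u, u \in K -> psi u \in X u) &
    forall v, v \in K -> is_child v -> par v \in K -> G (psi (par v)) (psi v).
Proof.
move=> XA Xd Xs.
suff H k (F : {set U}) (Y : U -> {set V}) : #|F| = k ->
  F \subset [set v in K | is_child v && (par v \in K)] ->
  (forall u, u \in K -> Y u \subset X u) ->
  (forall u, u \in K -> #|[set v in F | par v == u]|.+1 * beta <= #|Y u|) ->
  exists2 psi : U -> V, (forall u, u \in K -> psi u \in Y u) &
    forall v, v \in F -> G (psi (par v)) (psi v).
  have [|//||psi p1 p2] := H _ [set v in K | is_child v && (par v \in K)] X erefl.
  - exact: subxx.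
  - move=> u uK; apply: leq_trans (Xs _ uK); rewrite leq_mul2r ltnS; apply/orP; right.
    apply: leq_trans (few_children u); apply: subset_leq_card; apply/subsetP => v.
    by rewrite !inE => /andP[/and3P[_ -> _] ->].
  exists psi => // v vK cv pv; apply: p2; by rewrite inE vK cv.
elim: k F Y => [|k IH] F Y cF sF sY hY.
  move/eqP: cF; rewrite cards_eq0 => /eqP F0.
  have ne u : u \in K -> exists x, x \in Y u.
    by move=> uK; apply/card_gt0P; apply: leq_trans (hY _ uK); rewrite muln_gt0 beta0.
  exists (fun u => odflt (psi0 u) [pick x in Y u]) => [u uK|v]; last by rewrite F0 inE.
  case: pickP => // h; have [x xY] := ne _ uK.
  by rewrite h in xY.
have /card_gt0P[v1 v1F] : 0 < #|F| by rewrite cF.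
case: (arg_maxnP dep v1F) => v vF vmax.
have {}vF : v \in F := vF.
have : v \in [set v in K | is_child v && (par v \in K)] := subsetP sF _ vF.
rewrite inE => /and3P[vK cv pK]; set p := par v in pK.
have pv : p != v by apply/eqP => e; move: cv; rewrite /is_child -/p e => /eqP; lia.
pose Y' u := if u == p then [set x in Y p | [exists y in Y v, G x y]] else Y u.
have cFv : #|F :\ v| = k by move: cF; rewrite (cardsD1 v) vF => -[].
have bv : beta <= #|Y v| by apply: leq_trans (hY _ vK); rewrite leq_pmull.
have lost : #|Y p| < #|Y' p| + beta.
  rewrite /Y' eqxx; set Y1 := [set x in Y p | _].
  have -> : #|Y p| = #|Y1| + #|Y p :\: Y1|.
    by rewrite -(cardsID Y1) (setIidPr _) //; apply/subsetP => x; rewrite inE => /andP[].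
  rewrite ltn_add2l ltnNge; apply/negP => h.
  have [|||x [y [xY yY gxy]]] := @joined (Y p :\: Y1) (Y v) _ _ _ h bv.
  - by apply: subset_trans (subset_trans (subsetDl _ _) (sY _ pK)) (XA _ pK).
  - exact: subset_trans (sY _ vK) (XA _ vK).
  - apply: disjointWl (subset_trans (subsetDl _ _) (sY _ pK)) _.
    by apply: disjointWr (sY _ vK) _; apply: Xd.
  move: xY; rewrite !inE => /andP[/negP nx xp]; apply: nx; rewrite xp /=.
  by apply/existsP; exists y; rewrite yY.
have [|u uK|u uK|psi p1 p2] := IH (F :\ v) Y' cFv.
- exact: subset_trans (subsetDl _ _) sF.
- rewrite /Y'; case: eqP => [->|_]; last exact: sY.
  by apply: subset_trans (sY _ pK); apply/subsetP => x; rewrite inE => /andP[].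
- have [->|up] := eqVneq u p; last first.
    rewrite /Y' (negbTE up); apply: leq_trans (hY _ uK); rewrite leq_mul2r ltnS.
    apply/orP; right; apply: subset_leq_card; apply/subsetP => w; rewrite !inE.
    by case/andP=> /andP[_ ->].
  have := hY _ pK; have -> : #|[set w in F | par w == p]| = #|[set w in F :\ v | par w == p]|.+1.
    rewrite (cardsD1 v) inE vF eqxx /= add1n; congr _.+1; apply: eq_card => w.
    by rewrite !inE andbA.
  by rewrite mulSn; move: lost; lia.
have : psi p \in Y' p by apply: p1.
rewrite {1}/Y' eqxx inE => /andP[_ /existsP[y /andP[yv gy]]].
exists (fun u => if u == v then y else psi u) => [u uK|w wF].
  case: eqP => [->//|/eqP uv]; have := p1 _ uK; rewrite /Y'; case: eqP => [->|//].
  by rewrite inE => /andP[].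
have pwv : par w == v = false.
  apply/eqP => e; have := vmax w wF; have := subsetP sF _ wF.
  by rewrite inE => /and3P[_ /eqP -> _]; rewrite e; lia.
rewrite pwv; case: eqP => [->|/eqP wv]; first exact: gy.
by apply: p2; rewrite !inE wv.
Qed.

Section Extend.
Variables (P Dn : {set U}) (phi0 : U -> V) (Bs : U -> {set V}) (pc : U -> nat) (sp : pred U).
Definition cand v w := te v w && ((w \in Dn) || (w \in P) && (pos w < pos v)).
Hypothesis PDn : [disjoint P & Dn].
Hypothesis inj0 : {in Dn &, injective phi0}.
Hypothesis edge0 : forall u v, u \in Dn -> v \in Dn -> te u v -> G (phi0 u) (phi0 v).
Hypothesis cand_uniq : forall v w1 w2, v \in P -> cand v w1 -> cand v w2 -> w1 = w2.
Hypothesis cand_sp : forall v w, v \in P -> cand v w -> sp v.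
Hypothesis BsA : forall v, v \in P -> Bs v \subset ~: A.
Hypothesis BsD : forall u v, u \in Dn -> v \in P -> phi0 u \notin Bs v.
Hypothesis Bs_pool : forall u v, u \in P -> v \in P -> pc u != pc v -> [disjoint Bs u & Bs v].
Hypothesis BsN : forall v, v \in P -> ~~ sp v ->
  #|[set u in P | pc u == pc v]| + s0 * (d.+1 * beta) <= #|Bs v|.
Hypothesis BsS : forall v x, v \in P -> sp v ->
  #|[set u in P | pc u == pc v]| + s0 * (d.+1 * beta) <= #|[set y in Bs v | G x y]|.

(** Pieces are embedded in the order of [pos]. A vertex has at most one neighbour embedded before
    its piece, and in that case its target is a neighbourhood inside its pool. A pool has room for
    everything else sent to it, and [s0 * (d.+1 * beta)] further vertices provide the at most [s0]
    vertices of the piece with disjoint targets of the size needed by [piece_embed]. *)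
Lemma embed_extend : exists phi : U -> V, [/\ forall u, u \in Dn -> phi u = phi0 u,
  {in Dn :|: P &, injective phi},
  (forall u v, u \in Dn :|: P -> v \in Dn :|: P -> te u v -> G (phi u) (phi v)) &
  forall v, v \in P -> phi v \in Bs v].
Proof.
pose Q i := Dn :|: [set u in P | pos u < i].
suff H i : exists phi : U -> V, [/\ forall u, u \in Dn -> phi u = phi0 u,
  {in Q i &, injective phi},
  (forall u v, u \in Q i -> v \in Q i -> te u v -> G (phi u) (phi v)) &
  forall v, v \in P -> pos v < i -> phi v \in Bs v].
  have [phi [h1 h2 h3 h4]] := H (\max_u pos u).+1.
  have Qe : Q (\max_u pos u).+1 = Dn :|: P.
    by apply/setP => u; rewrite !inE ltnS leq_bigmax andbT.
  rewrite Qe in h2 h3; exists phi; split=> // v vP; apply: h4 => //.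
  by rewrite ltnS leq_bigmax.
elim: i => [|i [phi [h1 h2 h3 h4]]].
  have Q0 : Q 0 = Dn by apply/setP => u; rewrite !inE ltn0 andbF orbF.
  by exists phi0; rewrite Q0; split.
pose K := [set u in P | pos u == i].
pose used := phi @: [set u in P | pos u < i].
pose ext v := [pick w | cand v w].
(* A special vertex without embedded neighbour is given the neighbourhood of the arbitrary vertex
   [phi v]; [BsS] holds for every vertex, so this default is harmless. *)
pose X v := (if sp v then [set y in Bs v | G (if ext v is Some w then phi w else phi v) y] else Bs v) :\: used.
have cX v : v \in K -> s0 * (d.+1 * beta) <= #|X v|.
  rewrite inE => /andP[vP _].
  pose Bv := if sp v then [set y in Bs v | G (if ext v is Some w then phi w else phi v) y] else Bs v.
  have big : #|[set u in P | pc u == pc v]| + s0 * (d.+1 * beta) <= #|Bv|.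
    by rewrite /Bv; case: (boolP (sp v)) => sv; [apply: BsS | apply: BsN].
  have sBv : Bv \subset Bs v.
    by rewrite /Bv; case: (sp v) => //; apply/subsetP => y; rewrite inE => /andP[].
  have : #|Bv :&: used| <= #|[set u in P | pc u == pc v]|.
    apply: leq_trans (leq_imset_card phi _); apply: subset_leq_card.
    apply/subsetP => y; rewrite inE => /andP[yB /imsetP[u]]; rewrite inE => /andP[uP ui] e.
    apply/imsetP; exists u => //; rewrite inE uP; apply/negPn/negP => ne.
    have := Bs_pool uP vP ne; rewrite -setI_eq0 => /eqP/setP/(_ y).
    by rewrite !inE (subsetP sBv _ yB) e h4.
  by rewrite /X -/Bv cardsD; lia.
have cK : #|K| <= s0.
  by apply: leq_trans (piece_size i); apply: subset_leq_card; apply/subsetP => u; rewrite !inE => /andP[].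
have [X' [sX' cX' dX']] := @disjoint_subsets U V K X s0 (d.+1 * beta) cK cX.
have XB v : v \in K -> X v \subset Bs v.
  move=> _; apply: subset_trans (subsetDl _ _) _; case: (sp v) => //.
  by apply/subsetP => y; rewrite inE => /andP[].
have [|//|u uK|psi p1 p2] := @piece_embed phi K X'.
- move=> u uK; apply: subset_trans (subset_trans (sX' _ uK) (XB _ uK)) (BsA _).
  by move: uK; rewrite inE => /andP[].
- by rewrite cX'.
have KP u : u \in K -> u \in P by rewrite inE => /andP[].
have KQ u : u \in K -> u \in Q i = false.
  rewrite !inE => /andP[uP /eqP ->]; rewrite ltnn andbF orbF.
  by apply/negP => uD; move: PDn; rewrite disjoint_subset => /subsetP/(_ u uP); rewrite inE uD.
have psiX u : u \in K -> psi u \in X u by move=> uK; apply: (subsetP (sX' _ uK)); apply: p1.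
have QE u : (u \in Q i.+1) = (u \in Q i) || (u \in K).
  rewrite !inE ltnS leq_eqVlt; case: (u \in P); rewrite ?orbF //= -orbA; congr (_ || _).
  by rewrite orbC.
pose phi' u := if u \in K then psi u else phi u.
have phiQ u : u \in Q i -> phi' u = phi u.
  by move=> uQ; rewrite /phi'; case: ifP => // uK; rewrite KQ in uQ.
have phiK u : u \in K -> phi' u = psi u by rewrite /phi' => ->.
have new u w : u \in K -> w \in Q i -> psi u != phi w.
  move=> uK; rewrite !inE => /orP[wD|wP].
    rewrite h1 //; apply: contraNneq (BsD wD (KP _ uK)) => <-.
    by apply: (subsetP (XB _ uK)); apply: psiX.
  apply: contraTneq (psiX _ uK) => ->; rewrite !inE negb_and negbK; apply/orP; left.
  by apply: imset_f; rewrite inE.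
have edgeKQ u w : u \in K -> w \in Q i -> te u w -> G (psi u) (phi w).
  move=> uK wQ tuw; have uP := KP _ uK.
  have cw : cand u w.
    rewrite /cand tuw /=; move: wQ uK; rewrite !inE => /orP[->//|/andP[-> wi]] /andP[_ /eqP ->].
    by rewrite wi orbT.
  have := psiX _ uK; rewrite /X (cand_sp uP cw) !inE => /andP[_ /andP[_]].
  rewrite /ext; case: pickP => [w' cw'|/(_ w)]; last by rewrite cw.
  by rewrite (cand_uniq uP cw' cw) Gsym.
exists phi'; split.
- by move=> u uD; rewrite phiQ ?h1 // inE uD.
- move=> u v; rewrite !QE => /orP[uQ|uK] /orP[vQ|vK].
  + by rewrite !phiQ //; apply: h2.
  + by rewrite phiQ // phiK // => e; have := new _ _ vK uQ; rewrite e eqxx.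
  + by rewrite phiK // phiQ // => e; have := new _ _ uK vQ; rewrite e eqxx.
  rewrite !phiK // => e; apply/eqP/negPn/negP => uv.
  have := dX' _ _ uK vK uv; rewrite -setI_eq0 => /eqP/setP/(_ (psi u)).
  by rewrite !inE p1 // e p1.
- move=> u v; rewrite !QE => /orP[uQ|uK] /orP[vQ|vK] tuv.
  + by rewrite !phiQ //; apply: h3.
  + by rewrite phiQ // phiK // Gsym; apply: edgeKQ; rewrite // te_sym.
  + by rewrite phiK // phiQ //; apply: edgeKQ.
  rewrite !phiK //; case/orP: tuv => /andP[c /eqP e].
    by rewrite -e; apply: p2; rewrite // e.
  by rewrite Gsym -e; apply: p2; rewrite // e.
move=> v vP; rewrite ltnS leq_eqVlt => /orP[/eqP e|vi].
  have vK : v \in K by rewrite inE vP e eqxx.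
  by rewrite phiK //; apply: (subsetP (XB _ vK)); apply: psiX.
by rewrite phiQ ?h4 // !inE vP vi orbT.
Qed.

End Extend.
End Embedding.

(** * The deterministic embedding *)

Lemma card_set_bij (U V : finType) (f0 : U -> V) (Q : {set U}) (L : {set V}) : #|Q| = #|L| ->
  exists f : U -> V, {in Q &, injective f} /\ f @: Q = L.
Proof.
move=> e; pose f u := nth (f0 u) (enum L) (index u (enum Q)).
have ix u : u \in Q -> index u (enum Q) < size (enum L).
  by move=> uQ; rewrite -cardE -e cardE index_mem mem_enum.
have fi : {in Q &, injective f}.
  move=> u v uQ vQ; rewrite /f (set_nth_default (f0 u) (f0 v)) ?ix //.
  move/eqP; rewrite nth_uniq ?ix ?enum_uniq // => /eqP ei.
  have := nth_index u (s := enum Q) (x := u); have := nth_index u (s := enum Q) (x := v).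
  by rewrite !mem_enum uQ vQ ei => -> // -> //.
exists f; split=> //; apply/eqP; rewrite eqEcard; apply/andP; split.
  by apply/subsetP => _ /imsetP[u uQ ->]; rewrite -mem_enum mem_nth // ix.
by rewrite card_in_imset // e.
Qed.

(** * Balls of radius two in the tree *)

Section TreeBalls.
Variables (U : finType) (par : U -> U) (dep : U -> nat).
Notation te := (te par dep).

Lemma te_dep u v : te u v -> (dep v = (dep u).+1 /\ par v = u) \/ (dep u = (dep v).+1 /\ par u = v).
Proof. by case/orP=> /andP[/eqP c /eqP e]; [left|right]; rewrite -e. Qed.

Lemma te_irr u : te u u = false.
Proof. by apply/negP => /te_dep[] []; lia. Qed.

Lemma te_tri q u v : te q u -> te u v -> te q v -> False.
Proof.
by move=> /te_dep[] [a b] /te_dep[] [c e] /te_dep[] [x y]; lia.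
Qed.

Lemma te_no4 q v w1 w2 : q != v -> te q w1 -> te w1 v -> te q w2 -> te w2 v -> w1 = w2.
Proof.
move=> /eqP qv /te_dep[] [a a'] /te_dep[] [b b'] /te_dep[] [x x'] /te_dep[] [y y'];
  try (by rewrite -x'); try lia; try (by rewrite -b' -y'); try (by rewrite -a' -x');
  try (by case: qv; rewrite -a' -b'); try (by case: qv; rewrite -x' -y'); try congruence.
Qed.

Definition within2 q v := [|| q == v, te q v | [exists w, te q w && te w v]].

Lemma within2_refl q : within2 q q.
Proof. by rewrite /within2 eqxx. Qed.

Lemma within2_step q v : te q v -> within2 q v.
Proof. by rewrite /within2 => ->; rewrite orbT. Qed.

Lemma within2_step2 q w v : te q w -> te w v -> within2 q v.
Proof. by move=> a b; rewrite /within2; apply/or3P/Or33/existsP; exists w; rewrite a. Qed.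

Lemma within2_sym u v : within2 u v = within2 v u.
Proof.
rewrite /within2 eq_sym (te_sym par dep); congr [|| _, _ | _].
by apply: eq_existsb => w; rewrite andbC (te_sym par dep v) (te_sym par dep u).
Qed.

(** Places of the tree that can be treated independently. A ball without cut vertices lies inside
    one piece. Radius two is needed because a vertex within two steps of two spots could have two
    neighbours fixed in advance. *)
Definition spots (Ct S : {set U}) :=
  (forall q v, q \in S -> within2 q v -> v \notin Ct) /\
  (forall q q' v, q \in S -> q' \in S -> within2 q v -> within2 q' v -> q = q').

Lemma spotsW (Ct S S' : {set U}) : S' \subset S -> spots Ct S -> spots Ct S'.
Proof.
move=> /subsetP s [h1 h2]; split=> [q v /s|q q' v /s qS /s]; first exact: h1.
exact: h2.
Qed.

(** For a maximal set of spots, every vertex of [E] is within two of a cut vertex or within two of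
    the ball of a chosen spot, and balls have at most [(d + 1) ^ 2] elements. *)
Lemma many_spots (d : nat) (Ct E : {set U}) : (forall u, #|[set v | te u v]| <= d) ->
  exists2 S : {set U}, S \subset E /\ spots Ct S &
    #|E| <= (d + 1) ^ 2 * #|Ct| + (d + 1) ^ 4 * #|S|.
Proof.
move=> deg; pose z := (d + 1) ^ 2.
pose b2 u := [set v | within2 u v].
have cb u : #|b2 u| <= z.
  have -> : b2 u = [set u] :|: \bigcup_(w in [set v | te u v]) ([set w] :|: [set v | te w v]).
    apply/setP => v; rewrite !inE /within2 [u == v]eq_sym; case: eqP => //= _.
    apply/orP/bigcupP => [[tuv|/existsP[w /andP[a b]]]|[w]].
    - by exists v; rewrite !inE ?eqxx.
    - by exists w; rewrite !inE ?b ?orbT.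
    rewrite !inE => tuw /orP[/eqP->|twv]; [by left|right].
    by apply/existsP; exists w; rewrite tuw.
  apply: leq_trans (leq_card_setU _ _) _; rewrite cards1.
  have : #|\bigcup_(w in [set v | te u v]) ([set w] :|: [set v | te w v])| <= d * d.+1.
    apply: leq_trans (card_bigcup_le _ _) _.
    apply: (@leq_trans (\sum_(w in [set v | te u v]) d.+1)).
      apply: leq_sum => w _; apply: leq_trans (leq_card_setU _ _) _; rewrite cards1 add1n ltnS.
      exact: deg.
    by rewrite sum_nat_const leq_mul2r deg orbT.
  by rewrite /z; nia.
pose ok (S : {set U}) := [&& S \subset E, [forall q in S, [disjoint b2 q & Ct]] &
   [forall q in S, forall q' in S, (q != q') ==> [disjoint b2 q & b2 q']]].
have ok0 : ok set0.
  by rewrite /ok sub0set /=; apply/andP; split; apply/forall_inP => q; rewrite inE.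
case: (arg_maxnP (fun S : {set U} => #|S|) ok0) => S okS maxS.
case/and3P: (okS) => sSE /forall_inP hC /forall_inP hD.
exists S.
  split=> //; split=> [q v qS b|q q' v qS q'S b b'].
    apply/negP => vC; have := hC q qS; rewrite disjoint_subset => /subsetP/(_ v).
    by rewrite !inE b vC => /(_ isT).
  apply/eqP/negPn/negP => ne; have /forall_inP/(_ q' q'S) := hD q qS; rewrite ne /=.
  by rewrite disjoint_subset => /subsetP/(_ v); rewrite !inE b b' => /(_ isT).
have sub : E \subset (\bigcup_(v in Ct) b2 v) :|: \bigcup_(q in S) \bigcup_(v in b2 q) b2 v.
  apply/subsetP => u uE; rewrite inE.
  case: (boolP [disjoint b2 u & Ct]) => [dC|]; last first.
    rewrite -setI_eq0 => /set0Pn[v]; rewrite !inE => /andP[bv vC]; apply/orP; left.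
    by apply/bigcupP; exists v; rewrite // inE within2_sym.
  apply/orP; right; apply/negPn/negP => nu.
  have nq q : q \in S -> [disjoint b2 u & b2 q].
    move=> qS; rewrite -setI_eq0; apply/negPn/negP => /set0Pn[v]; rewrite !inE => /andP[bu bq].
    case/negP: nu; apply/bigcupP; exists q => //; apply/bigcupP; exists v; rewrite inE //.
    by rewrite within2_sym.
  have uS : u \notin S.
    apply/negP => uS; have := nq u uS; rewrite -setI_eq0 => /eqP/setP/(_ u).
    by rewrite !inE within2_refl.
  have : ok (u |: S).
    rewrite /ok subUset sub1set uE sSE /=; apply/andP; split.
      by apply/forall_inP => q; rewrite !inE => /orP[/eqP->//|/hC].
    apply/forall_inP => q; rewrite !inE => /orP[/eqP->|qS]; apply/forall_inP => q'; rewrite !inE => /orP[/eqP->|q'S].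
    - by rewrite eqxx.
    - by rewrite nq ?implybT.
    - by rewrite disjoint_sym nq ?implybT.
    by have /forall_inP := hD q qS; apply.
  by move=> /maxS; rewrite cardsU1 uS; lia.
apply: leq_trans (subset_leq_card sub) _; apply: leq_trans (leq_card_setU _ _) _.
apply: leq_add.
  apply: leq_trans (card_bigcup_le _ _) _; rewrite mulnC -sum_nat_const.
  by apply: leq_sum => v _; apply: cb.
have -> : (d + 1) ^ 4 = z * z by rewrite /z -expnD.
apply: leq_trans (card_bigcup_le _ _) _; rewrite mulnC -sum_nat_const.
apply: leq_sum => q _; apply: leq_trans (card_bigcup_le _ _) _.
apply: (@leq_trans (\sum_(v in b2 q) z)); first by apply: leq_sum => v _; apply: cb.
by rewrite sum_nat_const leq_mul2r cb orbT.
Qed.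

End TreeBalls.

(** * Embedding the tree without its hubs, leaving only vertices of [B] uncovered *)

Section MainEmbedding.
Variables (U V : finType) (par : U -> U) (dep pos : U -> nat) (Ct : {set U}).
Variables (d s0 beta : nat) (G : rel V) (cls : V -> nat).
Notation te := (te par dep).
Notation is_child := (is_child par dep).

(* Vertex classes: 0 receives the neighbours of the hubs and 1 is [B]; 2, 3 and 4 are the reserves
   for vertices having a neighbour that is already embedded, in the early, middle and late part of
   the tree; the other vertices go to 6 in the early and middle part and to 5 in the late part. *)
Definition Cl k := [set x : V | cls x == k].

Hypothesis posN : forall v, is_child v -> v \notin Ct -> pos (par v) = pos v.
Hypothesis posC : forall v, is_child v -> v \in Ct -> pos (par v) < pos v.
Hypothesis deg : forall u, #|[set v | te u v]| <= d.
Hypothesis piece_size : forall i, #|[set u | pos u == i]| <= s0.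
Hypothesis Gsym : symmetric G.
Hypothesis beta0 : 0 < beta.
Hypothesis cls7 : forall x, cls x < 7.
Hypothesis joined : forall X Z : {set V}, X \subset ~: Cl 0 -> Z \subset ~: Cl 0 -> [disjoint X & Z] ->
  beta <= #|X| -> beta <= #|Z| -> exists x y, [/\ x \in X, y \in Z & G x y].

Variables (i1 i3 : nat) (I Qa Qc : {set U}) (phi0 yq : U -> V) (g0 g1 g2 ell : nat).
Definition early := [set u | pos u < i1].
Definition late := [set u | i3 <= pos u].
Definition N1 := [set w | [exists q in I, te q w]].
Notation sl := (s0 * (d.+1 * beta)).
Hypothesis i13 : i1 <= i3.
Hypothesis Iearly : I \subset early.
Hypothesis Qaearly : Qa \subset early.
Hypothesis Qclate : Qc \subset late.
Hypothesis IQa : [disjoint I & Qa].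
Hypothesis spotsE : spots par dep Ct (I :|: Qa).
Hypothesis spotsL : spots par dep Ct Qc.
Hypothesis phi0_inj : {in N1 &, injective phi0}.
Hypothesis phi0_im : phi0 @: N1 = Cl 0.
Hypothesis yq_inj : {in Qa &, injective yq}.
Hypothesis yq_im : yq @: Qa = Cl 4 :|: Cl 5.
Hypothesis deg0 : forall x, g0 <= #|[set y in Cl 2 | G x y]|.
Hypothesis deg1 : forall x, g1 <= #|[set y in Cl 3 | G x y]|.
Hypothesis deg2 : forall x, g2 <= #|[set y in Cl 4 | G x y]|.
Hypothesis sUV : #|U| = #|V|.
(* makes the number of vertices left uncovered before the late part equal to [ell] *)
Hypothesis count : #|I| + #|late| = #|Cl 1| + ell.
Hypothesis cQc : #|Qc| = ell.
Hypothesis szB : #|Qa| + sl <= #|Cl 1|.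
Hypothesis sz0 : #|Ct| + d * #|N1| + d * #|Qa| + sl <= g0.
Hypothesis szM0 : #|early| + sl <= #|Cl 6|.
Hypothesis sz1 : #|Ct| + sl <= g1.
Hypothesis szL : #|Cl 3| + sl <= ell.
Hypothesis sz2 : #|Ct| + d * ell + sl <= g2.
Hypothesis szM2 : #|late| + sl <= #|Cl 5|.

Lemma few_children u : #|[set v | is_child v && (par v == u)]| <= d.
Proof.
apply: leq_trans (deg u); apply: subset_leq_card; apply/subsetP => v; rewrite !inE => h.
by apply/orP; left.
Qed.

Lemma te_earlier v w : te v w -> pos w < pos v -> v \in Ct /\ w = par v.
Proof.
case/orP=> /andP[c /eqP e] lt.
  have : pos (par w) <= pos w by case: (boolP (w \in Ct)) => h; [rewrite ltnW // posC | rewrite posN].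
  by rewrite e; lia.
split=> //; apply/negPn/negP => h; by move: (posN c h); rewrite e; lia.
Qed.

Lemma spot_pos (S : {set U}) q v : spots par dep Ct S -> q \in S -> te q v -> pos v = pos q.
Proof.
move=> [h _] qS t; rewrite (te_pos posN t) //; first exact: h qS (within2_refl _ _ _).
exact: h qS (within2_step t).
Qed.

Lemma card_nbrs (S : {set U}) : #|[set v | [exists q in S, te q v]]| <= d * #|S|.
Proof.
have -> : [set v | [exists q in S, te q v]] = \bigcup_(q in S) [set v | te q v].
  apply/setP => v; rewrite inE; apply/existsP/bigcupP => [[q /andP[qS t]]|[q qS]].
    by exists q; rewrite // inE.
  by rewrite inE => t; exists q; rewrite qS.
apply: leq_trans (card_bigcup_le _ _) _; rewrite mulnC -sum_nat_const.
by apply: leq_sum => q _.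
Qed.

Definition P0 := early :\: (I :|: N1).
Definition absorber_nbr v := [exists q in Qa, te q v].
Definition absorber_of v := odflt v [pick q | (q \in Qa) && te q v].
(** The vertices that may have a neighbour embedded before their piece: a cut vertex its parent, the
    others a neighbour of a hub. *)
Definition special0 v := (v \in Ct) || [exists w in N1, te v w].
(* The neighbours of an absorbing spot [q] are placed in the neighbourhood of [yq q], so that [q],
   which sits in [B], can be moved to [yq q] at the end. *)
Definition target0 v := if v \in Qa then Cl 1 else if absorber_nbr v then [set y in Cl 2 | G (yq (absorber_of v)) y]
  else if special0 v then Cl 2 else Cl 6.

Lemma N1_early : N1 \subset early.
Proof.
apply/subsetP => w; rewrite !inE => /existsP[q /andP[qI t]].
rewrite (spot_pos spotsE _ t) ?inE ?qI //.
by have := subsetP Iearly _ qI; rewrite inE.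
Qed.

Lemma N1P w : w \in N1 -> exists2 q, q \in I & te q w.
Proof. by rewrite inE => /existsP[q /andP[a b]]; exists q. Qed.

Lemma IE q : q \in I -> q \in I :|: Qa. Proof. by rewrite inE => ->. Qed.
Lemma QE q : q \in Qa -> q \in I :|: Qa. Proof. by rewrite inE => ->; rewrite orbT. Qed.
Hint Resolve IE QE : rainbow_copy_bound.

Lemma IQaF q : q \in I -> q \in Qa -> False.
Proof. by move=> a b; move: IQa; rewrite disjoint_subset => /subsetP/(_ q a); rewrite inE b. Qed.

Lemma N1I w : w \in N1 -> w \in I -> False.
Proof.
case/N1P=> q qI t wI; have e := spotsE.2 q w w (IE qI) (IE wI) (within2_step t) (within2_refl _ _ _).
by rewrite e te_irr in t.
Qed.

Lemma N1Qa w : w \in N1 -> w \in Qa -> False.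
Proof.
case/N1P=> q qI t wI; have e := spotsE.2 q w w (IE qI) (QE wI) (within2_step t) (within2_refl _ _ _).
by rewrite e te_irr in t.
Qed.

Lemma Qa_P0 q : q \in Qa -> q \in P0.
Proof.
move=> qQ; rewrite !in_setD in_setU (subsetP Qaearly _ qQ) andbT negb_or.
apply/andP; split; apply/negP => h; first exact: IQaF h qQ.
exact: N1Qa h qQ.
Qed.

Lemma special0_Qa v : v \in Qa -> ~~ special0 v.
Proof.
move=> vQ; rewrite negb_or (spotsE.1 v v (QE vQ) (within2_refl _ _ _)) /=.
apply/existsPn => w; rewrite negb_and -implybE; apply/implyP => /N1P[q qI t].
apply/negP => tv; rewrite te_sym in tv.
have e := spotsE.2 q v v (IE qI) (QE vQ) (within2_step2 t tv) (within2_refl _ _ _).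
by apply: (@IQaF v) => //; rewrite -e.
Qed.

Lemma absorber_nbrP v : absorber_nbr v -> exists2 q, q \in Qa & te q v.
Proof. by case/existsP=> q /andP[a b]; exists q. Qed.

Lemma special0_absorber_nbr v : absorber_nbr v -> ~~ special0 v.
Proof.
case/absorber_nbrP=> q qQ tq; rewrite negb_or (spotsE.1 q v (QE qQ) (within2_step tq)) /=.
apply/existsPn => w; rewrite negb_and -implybE; apply/implyP => /N1P[q' qI t].
apply/negP => tv; have e := spotsE.2 q q' w (QE qQ) (IE qI) (within2_step2 tq tv) (within2_step t).
by apply: (@IQaF q) => //; rewrite e.
Qed.

Lemma absorber_nbr_Qa v : absorber_nbr v -> v \in Qa -> False.
Proof.
case/absorber_nbrP=> q qQ t vQ; have e := spotsE.2 q v v (QE qQ) (QE vQ) (within2_step t) (within2_refl _ _ _).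
by rewrite e te_irr in t.
Qed.

Lemma absorber_ofE q v : q \in Qa -> te q v -> absorber_of v = q.
Proof.
move=> qQ t; rewrite /absorber_of; case: pickP => [q' /andP[q'Q t']|/(_ q)]; last by rewrite qQ t.
exact: spotsE.2 (QE q'Q) (QE qQ) (within2_step t') (within2_step t).
Qed.

Lemma target0_cls v x : x \in target0 v -> [/\ v \in Qa -> cls x = 1, v \notin Qa -> (cls x = 2) \/ (cls x = 6) &
   cls x \in [:: 1; 2; 6]].
Proof.
rewrite /target0; case: ifP => vQ; last case: ifP => nv; last case: ifP => sv;
  rewrite !inE; try (case/andP=> + _); move=> /eqP e; split=> //; rewrite ?e //; by [left|right].
Qed.

Lemma target0E v x : x \in target0 v -> cls x = if v \in Qa then 1 else if absorber_nbr v || special0 v then 2 else 6.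
Proof.
rewrite /target0; case: (v \in Qa); first by rewrite inE => /eqP.
case nv : (absorber_nbr v) => /=; first by rewrite !inE => /andP[/eqP].
by case: (special0 v); rewrite inE => /eqP.
Qed.

Lemma late_notin : forall u, pos u < i3 -> u \notin Qc.
Proof. by move=> u h; apply/negP => /(subsetP Qclate); rewrite inE; lia. Qed.

Lemma card_special0 : #|[set v | absorber_nbr v || special0 v]| <= #|Ct| + d * #|N1| + d * #|Qa|.
Proof.
have sub : [set v | absorber_nbr v || special0 v] \subset Ct :|: [set v | [exists q in N1, te q v]] :|: [set v | [exists q in Qa, te q v]].
  apply/subsetP => v; rewrite !inE /special0 /absorber_nbr => /or3P[->|->|/existsP[w /andP[wN t]]].
  - by rewrite orbT.
  - by [].
  by rewrite (_ : [exists q in N1, te q v]) ?orbT //; apply/existsP; exists w; rewrite wN te_sym.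
apply: leq_trans (subset_leq_card sub) _; apply: leq_trans (leq_card_setU _ _) _.
apply: leq_add; last exact: card_nbrs.
apply: leq_trans (leq_card_setU _ _) _; apply: leq_add => //; exact: card_nbrs.
Qed.

(** The early part. Three disjoint pools are used: class 1 for absorbing spots, class 2 for their
    neighbours and for special vertices, class 6 for the rest. A vertex sees at most one embedded
    neighbour: balls around hubs are disjoint and contain no cut vertex, so two such neighbours
    would belong to the same hub and form a 4-cycle with it. *)
Lemma stage0 : exists phi : U -> V, [/\ forall u, u \in N1 -> phi u = phi0 u,
  {in N1 :|: P0 &, injective phi},
  (forall u v, u \in N1 :|: P0 -> v \in N1 :|: P0 -> te u v -> G (phi u) (phi v)) &
  forall v, v \in P0 -> phi v \in target0 v].
Proof.
have PI v : v \in P0 -> v \notin I by rewrite !in_setD in_setU negb_or => /andP[/andP[]].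
have PN v : v \in P0 -> v \notin N1 by rewrite !in_setD in_setU negb_or => /andP[/andP[]].
pose pc v := if v \in Qa then 0 else if absorber_nbr v || special0 v then 1 else 2.
apply: (@embed_extend U V par dep pos d s0 beta G (Cl 0) few_children piece_size Gsym beta0 joined
  P0 N1 phi0 target0 pc special0) => //.
- by rewrite disjoint_subset; apply/subsetP => v /PN; rewrite !inE.
- move=> u v /N1P[q qI t] /N1P[q' q'I t'] tuv.
  have e := spotsE.2 q q' v (IE qI) (IE q'I) (within2_step2 t tuv) (within2_step t').
  by case: (@te_tri _ par dep q u v) => //; rewrite e.
- move=> v w1 w2 vP /andP[t1 c1] /andP[t2 c2].
  have cE w : te v w -> (w \in N1) || (w \in P0) && (pos w < pos v) ->
     (exists2 q, q \in I & te q w) \/ (v \in Ct /\ w = par v).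
    by move=> t /orP[/N1P|/andP[_ lt]]; [left|right; apply: te_earlier].
  case: (cE _ t1 c1) => [[q1 q1I tq1]|[vC1 ->]]; case: (cE _ t2 c2) => [[q2 q2I tq2]|[vC2 ->]] //.
  + rewrite te_sym in t1; rewrite te_sym in t2.
    have e := spotsE.2 q1 q2 v (IE q1I) (IE q2I) (within2_step2 tq1 t1) (within2_step2 tq2 t2).
    apply: (@te_no4 _ par dep q1 v) => //; last by rewrite e.
    by apply: contraNneq (PI _ vP) => <-.
  + by rewrite te_sym in t1; have := spotsE.1 q1 v (IE q1I) (within2_step2 tq1 t1); rewrite vC2.
  by rewrite te_sym in t2; have := spotsE.1 q2 v (IE q2I) (within2_step2 tq2 t2); rewrite vC1.
- move=> v w vP /andP[t /orP[wN|/andP[_ lt]]]; rewrite /special0.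
    by apply/orP; right; apply/existsP; exists w; rewrite wN t.
  by have [-> _] := te_earlier t lt.
- move=> v _; apply/subsetP => x /target0_cls[_ _]; rewrite !inE.
  by case/or3P=> /eqP->.
- move=> u v uN _; apply/negP => /target0_cls[_ _].
  have : phi0 u \in Cl 0 by rewrite -phi0_im imset_f.
  by rewrite inE => /eqP->.
- move=> u v _ _ ne; rewrite -setI_eq0; apply/eqP/setP => x; rewrite in_set0 in_setI.
  apply/negP => /andP[/target0E e1 /target0E e2]; move: ne e1; rewrite e2 /pc.
  by do 2![case: (_ \in Qa) => //; case: (_ || _) => //].
- move=> v vP nsp; rewrite /target0 /pc; case: (boolP (v \in Qa)) => vQ.
    apply: leq_trans szB; rewrite leq_add2r; apply: subset_leq_card; apply/subsetP => u.
    by rewrite inE => /andP[_]; case: (u \in Qa) => //; case: (_ || _).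
  case: (boolP (absorber_nbr v)) => nv /=.
    apply: leq_trans (deg0 _); apply: leq_trans sz0; rewrite leq_add2r.
    apply: leq_trans card_special0; apply: subset_leq_card; apply/subsetP => u; rewrite !inE => /andP[_].
    by case: (u \in Qa) => //; case: (_ || _).
  rewrite (negbTE nsp); apply: leq_trans szM0; rewrite leq_add2r; apply: subset_leq_card.
  by apply/subsetP => u; rewrite inE => /andP[+ _]; rewrite in_setD => /andP[].
move=> v x vP sv; have vQ : v \in Qa = false by apply/negP => h; have := special0_Qa h; rewrite sv.
have nv : absorber_nbr v = false by case h : (absorber_nbr v) => //; have := special0_absorber_nbr h; rewrite sv.
have -> : target0 v = Cl 2 by rewrite /target0 vQ nv sv.
apply: leq_trans (deg0 _); apply: leq_trans sz0; rewrite leq_add2r.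
apply: leq_trans card_special0; apply: subset_leq_card; apply/subsetP => u; rewrite !inE => /andP[_].
by rewrite /pc vQ nv sv /=; case: (u \in Qa) => //; case: (_ || _).
Qed.

Definition P1 := [set u | i1 <= pos u < i3].
Definition Wc := [set x | cls x \in [:: 2; 3; 6]].

Lemma posD0 u : u \in N1 :|: P0 -> pos u < i1.
Proof.
rewrite in_setU => /orP[/(subsetP N1_early)|]; first by rewrite inE.
by rewrite in_setD => /andP[_]; rewrite inE.
Qed.

Lemma card_Cl (f : V -> bool) (l : seq nat) : uniq l -> (forall x, f x = (cls x \in l)) ->
  #|[set x | f x]| = \sum_(k <- l) #|Cl k|.
Proof.
elim: l f => [|k l IH] f /=.
  by move=> _ h; rewrite big_nil; apply: eq_card0 => x; rewrite inE h.
case/andP=> kl ul h; rewrite big_cons -(IH (fun x => cls x \in l)) //.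
rewrite -cardsUI (_ : Cl k :&: _ = set0) ?cards0 ?addn0.
  by apply: eq_card => x; rewrite !inE h inE.
by apply/setP => x; rewrite !inE; apply/negP => /andP[/eqP e]; rewrite e (negbTE kl).
Qed.

Lemma card_all : #|Cl 0| + #|Cl 1| + #|Cl 4 :|: Cl 5| + #|Wc| = #|V|.
Proof.
have -> : #|V| = #|[set x : V | true]| by rewrite -cardsT; apply: eq_card => x; rewrite !inE.
have -> : #|Cl 4 :|: Cl 5| = #|[set x | cls x \in [:: 4; 5]]|.
  by apply: eq_card => x; rewrite !inE.
rewrite (@card_Cl (fun=> true) [:: 0; 1; 2; 3; 4; 5; 6]) //; last first.
  by move=> x; have := cls7 x; case: (cls x) => [|[|[|[|[|[|[]]]]]]].
rewrite (@card_Cl (fun x => cls x \in [:: 4; 5]) [:: 4; 5]) //.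
rewrite (@card_Cl (fun x => cls x \in [:: 2; 3; 6]) [:: 2; 3; 6]) // !big_cons !big_nil; lia.
Qed.

Lemma cQaY : #|Qa| = #|Cl 4 :|: Cl 5|.
Proof. by rewrite -yq_im card_in_imset. Qed.

Lemma cN1 : #|N1| = #|Cl 0|.
Proof. by rewrite -phi0_im card_in_imset. Qed.

Lemma card_tree : #|I| + #|N1| + #|P0| + #|P1| + #|late| = #|U|.
Proof.
have cE : #|early| = #|I| + #|N1| + #|P0|.
  rewrite -(cardsID (I :|: N1) early) (setIidPr _); last first.
    by rewrite subUset Iearly N1_early.
  rewrite cardsU (_ : I :&: N1 = set0) ?cards0 ?subn0 //.
  by apply/setP => u; rewrite in_setI in_set0; apply/negP => /andP[a b]; apply: N1I b a.
have -> : #|U| = #|early| + (#|P1| + #|late|).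
  rewrite -(cardsC early); congr (_ + _).
  have -> : ~: early = P1 :|: late.
    by apply/setP => u; rewrite !inE -leqNgt; have := i13; lia.
  rewrite cardsU (_ : P1 :&: late = set0) ?cards0 ?subn0 //.
  by apply/setP => u; rewrite !inE; lia.
lia.
Qed.

(** By [count] and the bijections [phi0] and [yq], exactly [ell] vertices of the classes 2, 3 and 6
    are uncovered after the early and middle parts. *)
Lemma card_W : #|Wc| = #|P0 :\: Qa| + #|P1| + ell.
Proof.
have cP : #|P0| = #|P0 :\: Qa| + #|Qa|.
  rewrite -(cardsID Qa P0) (setIidPr _) 1?addnC //; apply/subsetP => q; exact: Qa_P0.
have := card_all; have := card_tree; rewrite -cQaY -cN1 sUV; have := count; lia.
Qed.

(** The middle part. Cut vertices go to class 3, all others to what is left of the classes 6 and 2.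
    Room never runs out, since the [ell] vertices that remain at the end exceed class 3 by the slack
    of one piece. *)
Lemma stage1 : exists phi : U -> V, [/\ forall u, u \in N1 -> phi u = phi0 u,
  {in N1 :|: P0 :|: P1 &, injective phi},
  (forall u v, u \in N1 :|: P0 :|: P1 -> v \in N1 :|: P0 :|: P1 -> te u v -> G (phi u) (phi v)),
  (forall v, v \in P0 -> phi v \in target0 v) & forall v, v \in P1 -> phi v \in Wc].
Proof.
have [phi [h1 h2 h3 h4]] := stage0.
pose D := N1 :|: P0; rewrite -/D in h2 h3 *.
pose Bs v := if v \in Ct then Cl 3 else (Cl 6 :|: Cl 2) :\: phi @: D.
have clsD u : u \in D -> cls (phi u) != 3.
  rewrite in_setU => /orP[uN|/h4/target0_cls[_ _]]; last by rewrite !inE => /or3P[] /eqP->.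
  have : phi u \in Cl 0 by rewrite h1 // -phi0_im imset_f.
  by rewrite inE => /eqP->.
have [||||||||||psi [k1 k2 k3 k4]] := @embed_extend U V par dep pos d s0 beta G (Cl 0)
   few_children piece_size Gsym beta0 joined P1 D phi Bs (fun v => v \in Ct : nat) (fun v => v \in Ct).
- rewrite disjoint_subset; apply/subsetP => v; rewrite inE => /andP[lo _].
  by apply/negP => /posD0; lia.
- exact: h2.
- exact: h3.
- have cE v w : v \in P1 -> cand par dep pos P1 D v w -> w = par v.
    move=> vP /andP[t c]; case: (te_earlier t) => //; case/orP: c => [/posD0|/andP[_]//].
    by move: vP; rewrite inE; lia.
  by move=> v w1 w2 vP /(cE _ _ vP) -> /(cE _ _ vP) ->.
- move=> v w vP /andP[t c]; case: (te_earlier t) => //; case/orP: c => [/posD0|/andP[_]//].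
  by move: vP; rewrite inE; lia.
- move=> v _; rewrite /Bs; case: ifP => _; apply/subsetP => x; rewrite !inE; first by move/eqP->.
  by case/andP=> _ /orP[] /eqP->.
- move=> u v uD _; rewrite /Bs; case: ifP => _; first by rewrite inE clsD.
  by rewrite in_setD imset_f.
- move=> u v _ _; rewrite /Bs => ne; rewrite -setI_eq0; apply/eqP/setP => x.
  rewrite in_set0 in_setI; apply/negP; move: ne.
  case: (u \in Ct); case: (v \in Ct) => //= _; rewrite !inE.
    by case/and3P=> /eqP-> _.
  by case/andP=> /andP[_ /orP[] /eqP->].
- move=> v vP nv; rewrite /Bs (negbTE nv).
  apply: leq_trans (_ : #|P1| + sl <= _); first by rewrite leq_add2r subset_leq_card //; apply/subsetP => u; rewrite inE => /andP[].
  have : #|(Cl 6 :|: Cl 2) :&: phi @: D| <= #|P0 :\: Qa|.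
    apply: leq_trans (leq_imset_card phi _); apply: subset_leq_card; apply/subsetP => x.
    rewrite in_setI => /andP[xW /imsetP[u uD e]]; apply/imsetP; exists u => //.
    move: xW; rewrite in_setD; have := uD; rewrite [u \in D]in_setU => /orP[uN|uP].
      have : phi u \in Cl 0 by rewrite h1 // -phi0_im imset_f.
      by rewrite !inE e => /eqP->.
    rewrite uP andbT !inE e => c; apply/negP => uQ.
    by have [/(_ uQ) e1 _ _] := target0_cls (h4 _ uP); rewrite e1 in c.
  have : #|Wc| = #|Cl 6 :|: Cl 2| + #|Cl 3|.
    have -> : #|Cl 6 :|: Cl 2| = #|[set x | cls x \in [:: 6; 2]]|.
      by apply: eq_card => x; rewrite !inE.
    rewrite (@card_Cl (fun x => cls x \in [:: 6; 2]) [:: 6; 2]) //.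
    rewrite (@card_Cl (fun x => cls x \in [:: 2; 3; 6]) [:: 2; 3; 6]) // !big_cons !big_nil; lia.
  rewrite (cardsD (Cl 6 :|: Cl 2)) card_W; move: szL; clear; lia.
- move=> v x vP vC; rewrite /Bs vC; apply: leq_trans (deg1 _); apply: leq_trans sz1.
  rewrite leq_add2r subset_leq_card //; apply/subsetP => u; rewrite !inE => /andP[_].
  by case: (u \in Ct).
have kP v : v \in P0 -> psi v = phi v by move=> vP; apply: k1; rewrite in_setU vP orbT.
exists psi; split=> //.
- by move=> u uN; rewrite k1 ?h1 // in_setU uN.
- by move=> v vP; rewrite kP // h4.
move=> v vP; have := k4 v vP; rewrite /Bs; case: ifP => _; rewrite !inE; first by move/eqP->.
by case/andP=> _ /orP[] /eqP->.
Qed.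

(** The late part. The [ell] uncovered vertices of [Wc] are assigned to the spots [Qc] before
    anything else, which puts all of [Wc] into the image. The neighbours of these spots now have a
    fixed neighbour and join the cut vertices in class 4; the rest goes to class 5. Two spots are
    never adjacent, so the assignment itself may be an arbitrary bijection. *)
Lemma stage2 : exists phi : U -> V, [/\ forall u, u \in N1 -> phi u = phi0 u,
  {in ~: I &, injective phi},
  (forall u v, u \in ~: I -> v \in ~: I -> te u v -> G (phi u) (phi v)),
  (forall v, v \in P0 -> phi v \in target0 v) &
  Wc \subset phi @: (~: I :\: Qa)].
Proof.
have [phi [h1 h2 h3 h4 h5]] := stage1.
pose D := N1 :|: P0 :|: P1; rewrite -/D in h2 h3.
have posD u : u \in D -> pos u < i3.
  rewrite in_setU => /orP[/posD0|]; last by rewrite inE => /andP[].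
  by have := i13; lia.
pose E := (P0 :\: Qa) :|: P1.
have ED : E \subset D.
  by apply/subsetP => u; rewrite !in_setU in_setD => /orP[/andP[_ ->]|->]; rewrite !orbT.
have EW : phi @: E \subset Wc.
  apply/subsetP => _ /imsetP[u + ->]; rewrite in_setU => /orP[|/h5//].
  rewrite in_setD => /andP[nQ /h4/target0_cls[_ /(_ nQ) c _]]; rewrite inE.
  by case: c => ->.
pose L := Wc :\: phi @: E.
have cL : #|Qc| = #|L|.
  rewrite cQc cardsDS // card_in_imset; last by move=> u v uE vE; apply: h2; apply: (subsetP ED).
  rewrite cardsU (_ : _ :&: P1 = set0) ?cards0 ?subn0 ?card_W; first by lia.
  apply/setP => u; rewrite in_set0 in_setI in_setD; apply/negP => /andP[/andP[_ uP]].
  by have := @posD0 u; rewrite in_setU uP orbT inE => /(_ isT); lia.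
have [zq [zi zL]] := card_set_bij phi cL.
have DQc u : u \in D -> u \notin Qc by move=> uD; apply: late_notin; apply: posD.
have QcS q : q \in Qc -> i3 <= pos q by move/(subsetP Qclate); rewrite inE.
pose phi' u := if u \in Qc then zq u else phi u.
have pQ u : u \in Qc -> phi' u = zq u by rewrite /phi' => ->.
have pD u : u \in D -> phi' u = phi u by move/DQc => /negbTE h; rewrite /phi' h.
have zLq u : u \in Qc -> zq u \in L by move=> uQ; rewrite -zL imset_f.
have LD u w : u \in Qc -> w \in D -> zq u != phi w.
  move=> /zLq; rewrite in_setD => /andP[nE zW] wD; apply/eqP => e.
  case/negP: nE; rewrite e; apply: imset_f; rewrite e in zW.
  move: wD; rewrite !in_setU in_setD => /orP[/orP[wN|wP]|->]; last by rewrite orbT.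
    have : phi w \in Cl 0 by rewrite h1 // -phi0_im imset_f.
    by move: zW; rewrite !inE => + /eqP e0; rewrite e0.
  rewrite wP andbT; apply/orP; left; apply/negP => wQ.
  have [/(_ wQ) e1 _ _] := target0_cls (h4 _ wP); by move: zW; rewrite inE e1.
pose D' := D :|: Qc; pose P2 := late :\: Qc.
have DE u : (u \in D') = (u \in D) || (u \in Qc) by rewrite [LHS]in_setU.
pose sp v := (v \in Ct) || [exists q in Qc, te q v].
pose Bs v := if sp v then Cl 4 else Cl 5.
have clsD u : u \in D' -> (cls (phi' u) != 4) && (cls (phi' u) != 5).
  rewrite DE => /orP[uD|uQ]; last first.
    by rewrite pQ //; have := zLq _ uQ; rewrite !inE => /andP[_ /or3P[] /eqP->].
  rewrite pD //; move: uD; rewrite !in_setU => /orP[/orP[uN|/h4/target0_cls[_ _]]|/h5].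
  - have : phi u \in Cl 0 by rewrite h1 // -phi0_im imset_f.
    by rewrite inE => /eqP->.
  - by rewrite !inE => /or3P[] /eqP->.
  by rewrite !inE => /or3P[] /eqP->.
(* A spot is not a cut vertex, hence has no neighbour in an earlier piece. *)
have te_late u q : u \in D -> q \in Qc -> te u q -> False.
  move=> uD qQ; rewrite te_sym => t; case: (te_earlier t); first by have := posD _ uD; have := QcS _ qQ; lia.
  by have := spotsL.1 q q qQ (within2_refl _ _ _); move/negP.
have candE v w : v \in P2 -> cand par dep pos P2 D' v w -> (v \in Ct /\ w = par v) \/ (w \in Qc /\ te w v).
  rewrite in_setD => /andP[_]; rewrite inE => vl /andP[t].
  rewrite DE => /orP[/orP[wD|wQ]|/andP[_ lt]].
  - by left; apply: te_earlier => //; have := posD w wD; lia.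
  - by right; rewrite te_sym.
  by left; apply: te_earlier.
have [||||||||||psi [k1 k2 k3 k4]] := @embed_extend U V par dep pos d s0 beta G (Cl 0)
   few_children piece_size Gsym beta0 joined P2 D' phi' Bs (fun v => sp v : nat) sp.
- rewrite disjoint_subset; apply/subsetP => v; rewrite in_setD => /andP[vQ vl].
  rewrite inE DE (negbTE vQ) orbF; apply/negP => /posD; by move: vl; rewrite inE; lia.
- move=> u v; rewrite !DE => /orP[uD|uQ] /orP[vD|vQ].
  + by rewrite !pD //; apply: h2.
  + by rewrite pD // pQ // => e; have := LD _ _ vQ uD; rewrite e eqxx.
  + by rewrite pQ // pD // => e; have := LD _ _ uQ vD; rewrite e eqxx.
  by rewrite !pQ //; apply: zi.
- move=> u v; rewrite !DE => /orP[uD|uQ] /orP[vD|vQ] t.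
  + by rewrite !pD //; apply: h3.
  + by case: (te_late _ _ uD vQ t).
  + by rewrite te_sym in t; case: (te_late _ _ vD uQ t).
  have e := spotsL.2 u v v uQ vQ (within2_step t) (within2_refl _ _ _).
  by rewrite e te_irr in t.
- move=> v w1 w2 vP /(candE _ _ vP) c1 /(candE _ _ vP) c2.
  case: c1 => [[vC1 ->]|[w1Q t1]]; case: c2 => [[vC2 ->]|[w2Q t2]] //.
  + by have := spotsL.1 w2 v w2Q (within2_step t2); rewrite vC1.
  + by have := spotsL.1 w1 v w1Q (within2_step t1); rewrite vC2.
  exact: spotsL.2 w1Q w2Q (within2_step t1) (within2_step t2).
- move=> v w vP /(candE _ _ vP) [[vC _]|[wQ t]]; rewrite /sp ?vC //.
  by apply/orP; right; apply/existsP; exists w; rewrite wQ.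
- move=> v _; rewrite /Bs; case: ifP => _; apply/subsetP => x; rewrite !inE => /eqP->; by [].
- move=> u v /clsD/andP[n4 n5] _; rewrite /Bs; case: ifP => _; by rewrite inE.
- move=> u v _ _; rewrite /Bs => ne; rewrite -setI_eq0; apply/eqP/setP => x.
  rewrite in_set0 in_setI; apply/negP; move: ne.
  by case: (sp u); case: (sp v) => //= _; rewrite !inE => /andP[/eqP->].
- move=> v vP nv; rewrite /Bs (negbTE nv); apply: leq_trans szM2; rewrite leq_add2r.
  by apply: subset_leq_card; apply/subsetP => u; rewrite inE => /andP[+ _]; rewrite in_setD => /andP[].
- move=> v x vP sv; rewrite /Bs sv; apply: leq_trans (deg2 _); apply: leq_trans sz2.
  rewrite leq_add2r -cQc.
  apply: (@leq_trans #|Ct :|: [set v | [exists q in Qc, te q v]]|).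
    by apply: subset_leq_card; apply/subsetP => u; rewrite !inE => /andP[_]; rewrite /sp; case: (_ || _).
  apply: leq_trans (leq_card_setU _ _) _; rewrite leq_add2l; exact: card_nbrs.
have DI : D' :|: P2 = ~: I.
  apply/setP => u; rewrite !in_setU !in_setD in_setC !in_setU.
  case: (boolP (u \in I)) => uI.
    have ue := subsetP Iearly _ uI; have := ue; rewrite inE => lt.
    have -> : u \in N1 = false by apply/negP => h; apply: N1I h uI.
    have -> : u \in P1 = false by rewrite inE; lia.
    have -> : u \in late = false by rewrite inE; have := i13; lia.
    have -> : u \in Qc = false by apply/negP => /QcS; have := i13; lia.
    by [].
  rewrite /=; case: (u \in N1) => //=; rewrite !inE.
  case: (u \in Qc); rewrite ?orbT //=; lia.
have kD u : u \in D -> psi u = phi u by move=> uD; rewrite k1 ?pD // DE uD.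
have ND u : u \in N1 -> u \in D by move=> uN; rewrite !in_setU uN.
have PD u : u \in P0 -> u \in D by move=> uN; rewrite !in_setU uN orbT.
rewrite DI in k2 k3; exists psi; split=> //.
- by move=> u uN; rewrite kD ?h1 ?ND.
- by move=> v vP; rewrite kD ?h4 ?PD.
apply/subsetP => x xW; case: (boolP (x \in phi @: E)) => [/imsetP[u uE ->]|nE].
  rewrite -kD; last exact: (subsetP ED).
  apply: imset_f; rewrite in_setD -DI in_setU DE (subsetP ED _ uE) andbT.
  apply/negP => uQ; have := Qa_P0 uQ => uP; move: uE; rewrite in_setU in_setD uQ /= inE.
  by have := @posD0 u; rewrite in_setU uP orbT => /(_ isT); lia.
have : x \in L by rewrite in_setD nE.
rewrite -zL => /imsetP[q qQ ->]; have -> : zq q = psi q by rewrite k1 ?pQ // DE qQ orbT.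
apply: imset_f; rewrite in_setD -DI in_setU DE qQ !orbT andbT.
by apply/negP => /(subsetP Qaearly); rewrite inE; have := QcS _ qQ; have := i13; lia.
Qed.

(** Outside [B], only classes 4 and 5 may still contain uncovered vertices. Such a vertex is [yq q]
    for an absorbing spot [q] placed in [B], whose neighbours were placed next to [yq q]. Moving [q]
    there frees a vertex of [B] instead. All moves can be made at once, since no neighbour of a
    moved spot is moved. *)
Theorem main_embedding : exists phi : U -> V, [/\ forall u, u \in N1 -> phi u = phi0 u,
  {in ~: I &, injective phi},
  (forall u v, u \notin I -> v \notin I -> te u v -> G (phi u) (phi v)) &
  forall x, x \notin phi @: (~: I) -> cls x = 1].
Proof.
have [phi [h1 h2 h3 h4 h5]] := stage2.
pose im := phi @: (~: I).
pose sw u := (u \in Qa) && (yq u \notin im).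
pose psi u := if sw u then yq u else phi u.
have N1sw u : u \in N1 -> sw u = false.
  by move=> uN; apply/negP => /andP[uQ _]; apply: N1Qa uN uQ.
have psiN u : sw u = false -> psi u = phi u by rewrite /psi => ->.
have psiS u : sw u -> psi u = yq u by rewrite /psi => ->.
have QI u : u \in Qa -> u \in ~: I by rewrite in_setC => uQ; apply/negP => h; apply: IQaF h uQ.
have edge u w : sw u -> w \notin I -> te u w -> G (yq u) (psi w).
  case/andP=> uQ _ wI t.
  have nw : absorber_nbr w by apply/existsP; exists u; rewrite uQ.
  have wQ : w \notin Qa by apply/negP; apply: absorber_nbr_Qa.
  have wN : w \notin N1.
    apply/negP => /N1P[q qI tq]; have e := spotsE.2 q u w (IE qI) (QE uQ) (within2_step tq) (within2_step t).
    by apply: (@IQaF u) => //; rewrite -e.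
  have wP : w \in P0.
    rewrite in_setD in_setU negb_or wI wN /= inE (spot_pos spotsE (QE uQ) t).
    by have := subsetP Qaearly _ uQ; rewrite inE.
  rewrite psiN; last by rewrite /sw (negbTE wQ).
  by have := h4 _ wP; rewrite /target0 (negbTE wQ) nw (absorber_ofE uQ t) inE => /andP[].
exists psi; split.
- by move=> u uN; rewrite psiN ?N1sw ?h1.
- move=> u v uI vI; rewrite /psi; case: (boolP (sw u)) => su; case: (boolP (sw v)) => sv.
  + by case/andP: su => uQ _; case/andP: sv => vQ _; apply: yq_inj.
  + by move=> e; case/andP: su => _; rewrite e imset_f.
  + by move=> e; case/andP: sv => _; rewrite -e imset_f.
  exact: h2.
- move=> u v uI vI t; case: (boolP (sw u)) => su; first by rewrite psiS //; apply: edge.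
  case: (boolP (sw v)) => sv.
    by rewrite (psiS v) // Gsym; apply: edge => //; rewrite te_sym.
  by rewrite !psiN ?(negbTE su) ?(negbTE sv) //; apply: h3; rewrite // in_setC.
have inP u : u \in ~: I -> sw u = false -> phi u \in psi @: (~: I).
  by move=> uI su; rewrite -psiN //; apply: imset_f.
move=> x xn; apply/eqP/negPn/negP => c1; case/negP: xn.
case: (boolP (x \in Wc)) => [/(subsetP h5)/imsetP[u + ->]|xW].
  by rewrite in_setD => /andP[uQ uI]; apply: inP; rewrite // /sw (negbTE uQ).
case: (boolP (x \in Cl 0)) => [|c0].
  rewrite -phi0_im => /imsetP[u uN ->]; rewrite -h1 //; apply: inP; last exact: N1sw.
  by rewrite in_setC; apply/negP; apply: N1I.
have xY : x \in Cl 4 :|: Cl 5.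
  move: xW c0 c1; rewrite !inE; have := cls7 x; by case: (cls x) => [|[|[|[|[|[|[]]]]]]].
case: (boolP (x \in im)) => [/imsetP[u uI e]|xi].
  rewrite e; apply: inP => //; apply/negP => /andP[uQ _].
  have [/(_ uQ) e1 _ _] := target0_cls (h4 _ (Qa_P0 uQ)).
  by rewrite e e1 eqxx in c1.
have := xY; rewrite -yq_im => /imsetP[q qQ e].
have sq : sw q by rewrite /sw qQ -e xi.
by rewrite e -psiS //; apply: imset_f; apply: QI.
Qed.

End MainEmbedding.

(** Prefixes in the order of [pos] grow by at most one piece at a time. *)
Lemma prefix_threshold (U : finType) (pos : U -> nat) s0 x :
  (forall i, #|[set u | pos u == i]| <= s0) -> x <= #|U| ->
  exists i, x <= #|[set u | pos u < i]| <= x + s0.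
Proof.
move=> hs xU; pose c i := #|[set u | pos u < i]|.
have ex : exists i, x <= c i.
  exists (\max_u pos u).+1; apply: leq_trans xU _; rewrite -cardsT; apply: subset_leq_card.
  by apply/subsetP => u _; rewrite inE ltnS leq_bigmax.
exists (ex_minn ex); case: ex_minnP => -[|i] hi mi; rewrite -/(c _) hi /=.
  by rewrite /c (eq_card0 (A := mem [set u | pos u < 0])) // => u; rewrite !inE ltn0.
have lt : c i < x by rewrite ltnNge; apply/negP => /mi; rewrite ltnn.
have : c i.+1 <= c i + #|[set u | pos u == i]|.
  apply: leq_trans (leq_card_setU _ _); apply: subset_leq_card; apply/subsetP => u.
  by rewrite !inE ltnS leq_eqVlt orbC.
by have := hs i; lia.
Qed.

Lemma same_value_class (U : finType) (S : {set U}) (f : U -> nat) d :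
  (forall u, u \in S -> 0 < f u <= d) -> 0 < #|S| ->
  exists D, 0 < D <= d /\ #|S| <= d * #|[set u in S | f u == D]|.
Proof.
move=> hf S0.
have [/existsP[D /andP[D0 hD]]|no] := boolP [exists D : 'I_d.+1, (0 < D) && (#|S| <= d * #|[set u in S | f u == D]|)].
  by exists (val D); rewrite D0 -ltnS ltn_ord.
exfalso; case/card_gt0P: (S0) => u0 u0S.
have lt (D : 'I_d.+1) : 0 < D -> d * #|[set u in S | f u == D]| < #|S|.
  move=> D0; rewrite ltnNge; apply/negP => h; case/negP: no; apply/existsP; exists D.
  by rewrite D0.
have cS : #|S| = \sum_(D < d.+1 | 0 < D) #|[set u in S | f u == D]|.
  rewrite -sum1_card (partition_big (fun u => inord (f u) : 'I_d.+1) (fun D : 'I_d.+1 => 0 < D)) /=.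
    apply: eq_bigr => D D0; rewrite -sum1_card; apply: eq_bigl => u; rewrite inE.
    case uS : (u \in S) => //=; have /andP[_ fd] := hf _ uS.
    by rewrite -val_eqE /= inordK.
  by move=> u uS; have /andP[f0 fd] := hf _ uS; rewrite inordK.
have d0 : 0 < d by have := hf _ u0S; lia.
have : d * #|S| < d * #|S|; last by rewrite ltnn.
rewrite {1}cS big_distrr /=.
apply: (@leq_trans (\sum_(D < d.+1 | 0 < D) #|S|)); last first.
  rewrite sum_nat_const leq_mul2r; apply/orP; right.
  have -> : #|[pred D : 'I_d.+1 | 0 < D]| = d.
    rewrite -sum1_card big_mkcond big_ord_recl /= add0n.
    by rewrite (eq_bigr (fun=> 1)) // sum1_card card_ord.
  by [].
pose D1 : 'I_d.+1 := inord 1.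
have D10 : 0 < D1 by rewrite inordK.
rewrite (bigD1 D1) //= [X in _ < X](bigD1 D1) //= -addSn; apply: leq_add; first exact: lt.
by apply: leq_sum => D /andP[D0 _]; apply: ltnW; apply: lt.
Qed.

Lemma tree_selection (U : finType) (T : {set {set U}}) (d h x y : nat) :
  is_tree T -> (forall u, degree T u <= d) -> 0 < d -> 0 < h ->
  x + y + 2 * (h * d ^ h) < #|U| ->
  exists (par : U -> U) (dep pos : U -> nat) (Ct : {set U}) (i1 i3 : nat) (Se Sl : {set U}),
  [/\ [/\ (forall u v, te par dep u v = adj T u v),
      (forall v, is_child par dep v -> v \notin Ct -> pos (par v) = pos v) &
      (forall v, is_child par dep v -> v \in Ct -> pos (par v) < pos v)],
    [/\ (forall i, #|[set u | pos u == i]| <= h * d ^ h), #|Ct| * h <= #|U| + h & #|T| < #|U|],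
    [/\ i1 <= i3, x <= #|early pos i1| <= x + h * d ^ h & y <= #|late pos i3| <= y + h * d ^ h],
    [/\ Se \subset early pos i1, spots par dep Ct Se &
      #|early pos i1| <= (d + 1) ^ 2 * #|Ct| + (d + 1) ^ 4 * #|Se|] &
    [/\ Sl \subset late pos i3, spots par dep Ct Sl &
      #|late pos i3| <= (d + 1) ^ 2 * #|Ct| + (d + 1) ^ 4 * #|Sl|]].
Proof.
move=> tree deg d0 h0 hxy.
have [rho [par [dep [dep0 depP adjP adjE]]]] := rooted_tree tree.
have chdE v : is_child par dep v = (v != rho).
  rewrite /is_child; case: (eqVneq v rho) => [->|vr] /=; first by rewrite dep0.
  by rewrite -depP // eqxx.
have teE u v : te par dep u v = adj T u v.
  rewrite /te !chdE; apply/orP/idP => [[/andP[r /eqP <-]|/andP[r /eqP <-]]|/adjE].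
  - exact: adjP.
  - by rewrite adj_sym; exact: adjP.
  by case=> [[r e]|[r e]]; [right|left]; rewrite r e eqxx.
have degte u : #|[set v | te par dep u v]| <= d.
  by apply: leq_trans (deg u); rewrite /degree; apply: eq_leq; apply: eq_card => v; rewrite !inE teE.
have fewc w : #|[set u | (u != rho) && (par u == w)]| <= d.
  apply: leq_trans (degte w); apply: subset_leq_card; apply/subsetP => v.
  by rewrite !inE /te chdE => ->.
have [Ct [pos [rC cC pN pC [pI pB pS]]]] := tree_cut dep0 depP fewc h0 d0.
set s0 := h * d ^ h in hxy pS *.
have [i1 hi1] := @prefix_threshold U pos s0 x pS ltac:(lia).
have [i3 hi3] := @prefix_threshold U pos s0 (#|U| - y - s0) pS ltac:(lia).
have cl : #|[set u | pos u < i3]| + #|late pos i3| = #|U|.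
  rewrite -(cardsC [set u | pos u < i3]); congr (_ + _); apply: eq_card => u.
  by rewrite !inE -leqNgt.
have ce : #|early pos i1| = #|[set u | pos u < i1]| by [].
have i13 : i1 <= i3.
  rewrite leqNgt; apply/negP => lt.
  have : #|[set u | pos u < i3]| <= #|[set u | pos u < i1]|.
    by apply: subset_leq_card; apply/subsetP => u; rewrite !inE; lia.
  lia.
have [Se [sSe spe] ne] := many_spots Ct (early pos i1) degte.
have [Sl [sSl spl] nl] := many_spots Ct (late pos i3) degte.
exists par, dep, pos, Ct, i1, i3, Se, Sl; split; split=> //.
- by move=> v; rewrite chdE => _; apply: pN.
- by move=> v; rewrite chdE => vr vC; apply: pC.
- have : T \subset [set [set par v; v] | v in [set~ rho]].
    apply/subsetP => e eT; have [gT _ _ _] := tree; have := subsetP gT _ eT; rewrite inE => /cards2P[u [v [uv ee]]].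
    have : adj T u v by rewrite /adj -ee.
    case/adjE=> [[r e']|[r e']]; apply/imsetP.
      by exists u; rewrite ?inE // ee e' setUC.
    by exists v; rewrite ?inE // ee e'.
  move/subset_leq_card => le; apply: leq_ltn_trans le _; apply: leq_ltn_trans (leq_imset_card _ _) _.
  by rewrite cardsC1 ltn_predL; clear -hxy; lia.
by lia.
Qed.

(** * Finite product measures *)

Local Open Scope ring_scope.

Section ProductMeasure.
Variables (R : realFieldType) (J : finType).

(** The expectation of [F] under the product of the laws [mu j]; probabilities are expectations of
    indicators. *)
Definition Pm (S : finType) (mu : J -> S -> R) (F : {ffun J -> S} -> R) : R :=
  \sum_(f : {ffun J -> S}) (\prod_j mu j (f j)) * F f.

Definition is_pmf (S : finType) (mu : J -> S -> R) :=
  (forall j v, 0 <= mu j v) /\ (forall j, \sum_v mu j v = 1).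

Definition mrg (S : finType) (P : {pred J}) (f g : {ffun J -> S}) : {ffun J -> S} :=
  [ffun j => if j \in P then g j else f j].

Definition upd (S : finType) (f : {ffun J -> S}) (j : J) (v : S) : {ffun J -> S} :=
  [ffun i => if i == j then v else f i].

Section OneSpace.
Variables (S : finType) (mu : J -> S -> R).
Hypothesis mu_pmf : is_pmf mu.

Lemma Pm_wt_ge0 (f : {ffun J -> S}) : 0 <= \prod_j mu j (f j).
Proof. by apply: prodr_ge0 => j _; case: mu_pmf => + _; apply. Qed.

Lemma Pm_prod (g : J -> S -> R) :
  Pm mu (fun f => \prod_j g j (f j)) = \prod_j \sum_v mu j v * g j v.
Proof.
rewrite bigA_distr_bigA /Pm; apply: eq_bigr => f _.
by rewrite -big_split.
Qed.

Lemma Pm_cst (c : R) : Pm mu (fun => c) = c.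
Proof.
rewrite /Pm -mulr_suml -[X in X * _]/(\sum_f _).
have -> : \sum_(f : {ffun J -> S}) \prod_j mu j (f j) = 1.
  rewrite -(bigA_distr_bigA (fun j v => mu j v)).
  by rewrite big1 // => j _; case: mu_pmf => _ ->.
by rewrite mul1r.
Qed.

Lemma Pm_ext (F G : {ffun J -> S} -> R) : F =1 G -> Pm mu F = Pm mu G.
Proof. by move=> FG; apply: eq_bigr => f _; rewrite FG. Qed.

Lemma Pm_le (F G : {ffun J -> S} -> R) :
  (forall f, F f <= G f) -> Pm mu F <= Pm mu G.
Proof. by move=> FG; apply: ler_sum => f _; rewrite ler_wpM2l ?Pm_wt_ge0. Qed.

Lemma Pm_ge0 (F : {ffun J -> S} -> R) : (forall f, 0 <= F f) -> 0 <= Pm mu F.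
Proof. by move=> FG; apply: sumr_ge0 => f _; rewrite mulr_ge0 ?Pm_wt_ge0. Qed.

Lemma Pm_le1 (F : {ffun J -> S} -> R) : (forall f, F f <= 1) -> Pm mu F <= 1.
Proof. by move=> F1; rewrite -[leRHS](Pm_cst 1); apply: Pm_le. Qed.

Lemma PmD (F G : {ffun J -> S} -> R) :
  Pm mu (fun f => F f + G f) = Pm mu F + Pm mu G.
Proof. by rewrite /Pm -big_split; apply: eq_bigr => f _; rewrite mulrDr. Qed.

Lemma PmZ (c : R) (F : {ffun J -> S} -> R) :
  Pm mu (fun f => c * F f) = c * Pm mu F.
Proof. by rewrite /Pm mulr_sumr; apply: eq_bigr => f _; rewrite mulrCA. Qed.

Lemma Pm_sum (I : finType) (P : pred I) (F : I -> {ffun J -> S} -> R) :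
  Pm mu (fun f => \sum_(i | P i) F i f) = \sum_(i | P i) Pm mu (F i).
Proof.
rewrite /Pm exchange_big; apply: eq_bigr => f _.
by rewrite mulr_sumr.
Qed.

Lemma mrgK (P : {pred J}) (f g : {ffun J -> S}) :
  mrg P (mrg P f g) (mrg P g f) = f.
Proof. by apply/ffunP => j; rewrite !ffunE; case: (j \in P). Qed.

(* (f, g) |-> (mrg f g, mrg g f) is a weight-preserving involution *)
Lemma Pm_merge (P : {pred J}) (F : {ffun J -> S} -> R) :
  Pm mu F = Pm mu (fun f => Pm mu (fun g => F (mrg P f g))).
Proof.
pose sw (fg : {ffun J -> S} * {ffun J -> S}) := (mrg P fg.1 fg.2, mrg P fg.2 fg.1).
have swK : involutive sw by case=> f g; rewrite /sw /= !mrgK.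
rewrite -[LHS]mulr1 -[X in _ * X](Pm_cst 1) {1}/Pm mulr_suml.
under eq_bigr => f _ do rewrite {1}/Pm mulr_sumr.
rewrite pair_bigA /= (reindex_inj (inv_inj swK)) /=.
rewrite /Pm; under [RHS]eq_bigr => f _ do rewrite mulr_sumr.
rewrite pair_bigA /=; apply: eq_bigr => -[f g] _ /=.
rewrite mulr1 mulrAC [RHS]mulrA; congr (_ * _).
rewrite -!big_split; apply: eq_bigr => j _ /=.
by rewrite !ffunE; case: (j \in P); rewrite // mulrC.
Qed.

Lemma Pm_resample (j : J) (F : {ffun J -> S} -> R) :
  Pm mu F = Pm mu (fun f => \sum_v mu j v * F (upd f j v)).
Proof.
rewrite (Pm_merge (pred1 j)); apply: Pm_ext => f.
transitivity (Pm mu (fun g => F (upd f j (g j)))).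
  apply: Pm_ext => g; congr F; apply/ffunP => i; rewrite !ffunE inE.
  by case: eqP => // ->.
pose G j' v := if j' == j then F (upd f j v) else 1.
transitivity (Pm mu (fun g => \prod_i G i (g i))).
  apply: Pm_ext => g; rewrite (bigD1 j) //= big1 => [|i ij]; first by rewrite /G eqxx mulr1.
  by rewrite /G (negbTE ij).
rewrite Pm_prod (bigD1 j) //= [X in _ * X]big1 => [|i ij].
  by rewrite mulr1; apply: eq_bigr => v _; rewrite /G eqxx.
rewrite /G (negbTE ij); under eq_bigr => v _ do rewrite mulr1.
by case: mu_pmf => _ ->.
Qed.

Definition indep_of (P : {pred J}) (F : {ffun J -> S} -> R) :=
  forall f g : {ffun J -> S}, {in predC P, f =1 g} -> F f = F g.

Lemma Pm_indep (P : {pred J}) (F G : {ffun J -> S} -> R) :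
  indep_of P F -> indep_of (predC P) G ->
  Pm mu (fun f => F f * G f) = Pm mu F * Pm mu G.
Proof.
move=> iF iG; rewrite (Pm_merge P).
transitivity (Pm mu (fun f => Pm mu G * F f)); last by rewrite PmZ mulrC.
apply: Pm_ext => f; rewrite [RHS]mulrC -PmZ; apply: Pm_ext => g; congr (_ * _).
  by apply: iF => j jP; rewrite ffunE ifN.
by apply: iG => j; rewrite !inE negbK => jP; rewrite ffunE ifT.
Qed.

(** Where [X] vanishes, [(X - E) ^+ 2] equals [E ^+ 2], with [E] the mean of [X]. *)
Lemma Pm_chebyshev (X : {ffun J -> S} -> R) :
  0 < Pm mu X ->
  Pm mu (fun f => (X f == 0)%:R) <=
    Pm mu (fun f => X f ^+ 2) / Pm mu X ^+ 2 - 1.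
Proof.
set E := Pm mu X => E0.
have E20 : 0 < E ^+ 2 by rewrite exprn_gt0.
rewrite -(ler_pM2l E20) mulrBr mulr1 mulrCA mulfV ?gt_eqF // mulr1 -PmZ.
have -> : Pm mu (fun f => X f ^+ 2) - E ^+ 2 = Pm mu (fun f => (X f - E) ^+ 2).
  transitivity (Pm mu (fun f => X f ^+ 2 + (- (E *+ 2) * X f + E ^+ 2))).
    by rewrite !PmD PmZ Pm_cst -/E mulNr mulrnAl -expr2 mulr2n opprD -!addrA addNr addr0.
  apply: Pm_ext => f; rewrite sqrrB -addrA; congr (_ + _).
  by rewrite mulNr mulrnAl mulrC.
apply: Pm_le => f; case: eqP => [->|_]; first by rewrite mulr1 sub0r sqrrN.
by rewrite mulr0 sqr_ge0.
Qed.

End OneSpace.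

(** After averaging over coordinate [j] the integrand no longer depends on it, and [mu] and [nu]
    agree on all other coordinates, so the conditional comparison carries over. *)
Lemma Pm_hybrid_step (S : finType) (mu nu : J -> S -> R) (j : J)
    (F F' : {ffun J -> S} -> R) :
  is_pmf mu -> is_pmf nu -> (forall i, i != j -> mu i =1 nu i) ->
  (forall f, \sum_v mu j v * F (upd f j v) <= \sum_v nu j v * F' (upd f j v)) ->
  Pm mu F <= Pm nu F'.
Proof.
move=> pmu pnu munu H.
rewrite (Pm_resample pmu j) (Pm_resample pnu j).
apply: le_trans (Pm_le pmu H) _.
set G := (X in Pm mu X); suff -> : Pm mu G = Pm nu G by [].
have Gi f v : G (upd f j v) = G f.
  by apply: eq_bigr => u _; congr (_ * F' _); apply/ffunP => i; rewrite !ffunE; case: eqP.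
have Pu la : is_pmf la -> (forall i, i != j -> la i =1 nu i) ->
   Pm la G = \sum_(f : {ffun J -> S}) (\prod_(i | i != j) nu i (f i)) * G f * la j (f j).
  move=> _ lanu; apply: eq_bigr => f _.
  rewrite (bigD1 j) //= [la j _ * _]mulrC mulrAC; congr (_ * _ * _).
  by apply: eq_bigr => i ij; rewrite lanu.
rewrite (Pu _ pmu munu) (Pu _ pnu) //.
pose h (f : {ffun J -> S}) := (\prod_(i | i != j) nu i (f i)) * G f.
(* Multiplication by [#|S|] introduces a dummy value that can be exchanged with [f j]; the law at
   [j] then sums to 1. *)
have K la : (forall v, 0 <= la v) -> \sum_v la v = 1 ->
   (#|S|%:R : R) * (\sum_(f : {ffun J -> S}) h f * la (f j)) = \sum_f h f.
  move=> _ la1.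
  have hu f v : h (upd f j v) = h f.
    rewrite /h Gi; congr (_ * _); apply: eq_bigr => i ij.
    by rewrite ffunE (negbTE ij).
  transitivity (\sum_(f : {ffun J -> S}) \sum_v h f * la v); last first.
    by apply: eq_bigr => f _; rewrite -mulr_sumr la1 mulr1.
  transitivity (\sum_(f : {ffun J -> S}) \sum_(v : S) h f * la (f j)).
    by rewrite mulr_sumr; apply: eq_bigr => f _; rewrite sumr_const mulr_natl.
  pose sw (fv : {ffun J -> S} * S) := (upd fv.1 j fv.2, fv.1 j).
  have swK : involutive sw.
    case=> f v; rewrite /sw /= ffunE eqxx; congr (_, _).
    by apply/ffunP => i; rewrite !ffunE; case: eqP => // ->.
  rewrite !pair_bigA /= (reindex_inj (inv_inj swK)) /=.
  by apply: eq_bigr => -[f v] _ /=; rewrite hu ffunE eqxx.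
have [S0|S0] := eqVneq #|S| 0%N.
  have := pmu.2 j; rewrite big_pred0 => [/eqP|v]; first by rewrite eq_sym oner_eq0.
  by have := card0_eq S0 v; rewrite !inE.
have cS : (#|S|%:R : R) != 0 by rewrite pnatr_eq0.
apply: (mulfI cS); rewrite (K (mu j)) ?(K (nu j)) //.
- exact: pnu.1.
- exact: pnu.2.
- exact: pmu.1.
exact: pmu.2.
Qed.

(** Two-stage sampling: first [b], then [f] given [b], with independent coordinates in both stages.
    It allows partial information on every coordinate to be exposed, such as its presence or whether
    its colour lies in [K]. *)
Lemma Pm_mixture (S B : finType) (mu : J -> S -> R) (la : J -> B -> R)
    (nu : B -> J -> S -> R) (F : {ffun J -> S} -> R) :
  (forall j v, mu j v = \sum_b la j b * nu b j v) ->
  Pm mu F = Pm la (fun b => Pm (fun j => nu (b j) j) F).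
Proof.
move=> mix; rewrite /Pm.
under [RHS]eq_bigr => b _ do rewrite mulr_sumr.
rewrite exchange_big /=; apply: eq_bigr => f _.
under eq_bigr => j _ do rewrite mix.
rewrite bigA_distr_bigA mulr_suml; apply: eq_bigr => b _.
by rewrite mulrA big_split.
Qed.

Lemma Pm_map (S S' : finType) (mu : J -> S -> R) (pi : J -> S -> S')
    (F : {ffun J -> S'} -> R) :
  Pm mu (fun f => F [ffun j => pi j (f j)]) =
  Pm (fun j v' => \sum_(v | pi j v == v') mu j v) F.
Proof.
rewrite /Pm.
under [RHS]eq_bigr => g _ do rewrite (bigA_distr_big_dep (fun j v => pi j v == g j)) /= mulr_suml.
rewrite [LHS](partition_big (fun f : {ffun J -> S} => [ffun j => pi j (f j)]) predT) //=.
apply: eq_bigr => g _; apply: congr_big => // f; last by move/eqP => <-.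
apply/eqP/familyP => [<- j|H]; first by rewrite ffunE unfold_in eqxx.
by apply/ffunP => j; rewrite ffunE; have := H j; rewrite unfold_in => /eqP.
Qed.

End ProductMeasure.

Lemma bernoulli_inv (R : realFieldType) (x : R) (n : nat) :
  0 <= x -> x <= 1 -> (1 - x) ^+ n <= (1 + n%:R * x)^-1.
Proof.
move=> x0 x1.
have p : 0 < 1 + n%:R * x by rewrite ltr_pwDl // mulr_ge0.
rewrite -[leRHS]mul1r ler_pdivlMr //.
elim: n p => [|n IH] p; first by rewrite expr0 mul0r addr0 mulr1.
have p' : 0 < 1 + n%:R * x by rewrite ltr_pwDl // mulr_ge0.
apply: le_trans (IH p'); rewrite exprSr -mulrA; apply: ler_wpM2l.
  by rewrite exprn_ge0 // subr_ge0.
rewrite -natr1; have n0 : 0 <= n%:R :> R by [].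
have h : 0 <= n%:R * (x * x) by rewrite !mulr_ge0.
by nra.
Qed.

Lemma bernoulli_ge (R : realFieldType) (x : R) (n : nat) :
  0 <= x -> x <= 1 -> 1 - n%:R * x <= (1 - x) ^+ n.
Proof.
move=> x0 x1; elim: n => [|n IH]; first by rewrite mul0r subr0 expr0.
have h : (1 - x) * (1 - n%:R * x) <= (1 - x) ^+ n.+1.
  by rewrite exprS ler_wpM2l // subr_ge0.
apply: le_trans h; rewrite -natr1.
have h : 0 <= n%:R * (x * x) by rewrite !mulr_ge0.
by nra.
Qed.

(** * A lower tail bound for surviving stars *)

Section Chernoff.
Variables (R : realFieldType) (J : finType) (Q : finType) (D : nat).
Variables (la : J -> bool -> R) (lam : R) (ed : Q -> 'I_D -> J).
Hypothesis la_pmf : is_pmf la.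
Hypothesis ed_inj : injective (fun p : Q * 'I_D => ed p.1 p.2).
Hypothesis la_true : forall q l, la (ed q l) true = lam.

Definition survives (b : {ffun J -> bool}) (q : Q) := [forall l, b (ed q l)].

Lemma Pm_all_true (q : Q) : Pm la (fun b => (survives b q)%:R) = lam ^+ D.
Proof.
pose g j (v : bool) : R := if j \in codom (ed q) then v%:R else 1.
transitivity (Pm la (fun b => \prod_j g j (b j))).
  apply: Pm_ext => b; rewrite /survives; case: forallP => [h|h].
    rewrite big1 // => j _; rewrite /g; case: ifP => // /codomP[l ->].
    by rewrite h.
  have /forallPn[l nl] : ~~ [forall l, b (ed q l)] by apply/forallP.
  by rewrite (bigD1 (ed q l)) //= /g codom_f (negbTE nl) mul0r.
rewrite Pm_prod.
have -> : \prod_j \sum_v la j v * g j v = \prod_(j in codom (ed q)) lam.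
  rewrite [RHS]big_mkcond /=; apply: eq_bigr => j _; rewrite /g.
  case: ifP => [/codomP[l ->]|_]; last first.
    by under eq_bigr => v _ do rewrite mulr1; apply: la_pmf.2.
  by rewrite big_bool /= mulr1 mulr0 addr0 la_true.
rewrite prodr_const; congr (_ ^+ _); rewrite card_codom ?card_ord // => l l' e.
by have := @ed_inj (q, l) (q, l') e => -[].
Qed.

(** The exponential moment with base [1/2] of the number of survivors. The sets of coordinates
    belonging to different [q] are disjoint, so it factorises. *)
Lemma Pm_half_pow (s : {set Q}) :
  Pm la (fun b => \prod_(q in s) (if survives b q then 2^-1 else 1)) =
  (1 - lam ^+ D / 2) ^+ #|s|.
Proof.
have [n] := ubnP #|s|; elim: n s => // n IH s.
have [->|/set0Pn[q qs]] := eqVneq s set0.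
  rewrite cards0 expr0 => _; rewrite -[RHS](Pm_cst la_pmf 1).
  by apply: Pm_ext => b; rewrite big_set0.
have cs : #|s| = #|s :\ q|.+1 by rewrite (cardsD1 q) qs.
rewrite cs ltnS => sn.
have := @Pm_indep R J bool la la_pmf [pred j | j \in codom (ed q)]
  (fun b => \prod_(q' in s :\ q) (if survives b q' then 2^-1 else 1))
  (fun b => if survives b q then 2^-1 else 1).
move=> /(_ _ _) h.
transitivity (Pm la (fun b => (\prod_(q' in s :\ q) (if survives b q' then 2^-1 else 1)) *
   (if survives b q then 2^-1 else 1 : R))).
  by apply: Pm_ext => b; rewrite (big_setD1 q) //= mulrC.
rewrite h; last first.
- move=> b b' bb; have -> // : survives b q = survives b' q.
  by apply: eq_forallb => l; apply: bb; rewrite !inE negbK codom_f.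
- move=> b b' bb; apply: eq_bigr => q'; rewrite !inE => /andP[nq _].
  have -> // : survives b q' = survives b' q'.
  apply: eq_forallb => l; apply: bb; rewrite !inE; apply/codomP => -[l' e].
  by have := @ed_inj (q', l) (q, l') e => -[e1 _]; rewrite e1 eqxx in nq.
rewrite IH // exprSr; congr (_ * _).
transitivity (Pm la (fun b => 1 + (- 2^-1) * (survives b q)%:R)).
  by apply: Pm_ext => b; case: (survives b q); rewrite ?mulr1 ?mulr0 ?addr0 //; lra.
by rewrite PmD PmZ Pm_cst // Pm_all_true; lra.
Qed.

(** Markov's inequality for [2 ^ -X], with [X] the number of survivors and [t] the bound on it. Its
    mean is at most [4 ^ -t], because [(1 - 1 / (2 * Z)) ^ (8 * Z) <= 1 / 5], and on the event it is
    at least [2 ^ -t]. *)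
Lemma chernoff (Z : nat) (s : {set Q}) : (0 < Z)%N -> Z%:R^-1 <= lam ^+ D -> lam ^+ D <= 1 ->
  Pm la (fun b => (#|[set q in s | survives b q]| <= #|s| %/ (8 * Z))%:R)
   <= (2^-1) ^+ (#|s| %/ (8 * Z)).
Proof.
move=> Z0 lZ l1; set t := (_ %/ _)%N.
have h1 : (1 - lam ^+ D / 2) ^+ #|s| <= (4^-1) ^+ t.
  have lb : 0 <= 1 - lam ^+ D / 2 by lra.
  have Zp : (0 : R) < Z%:R by rewrite ltr0n.
  have lp : 0 < lam ^+ D by apply: lt_le_trans lZ; rewrite invr_gt0.
  have st : (8 * Z * t <= #|s|)%N by rewrite mulnC leq_divM.
  apply: le_trans (_ : (1 - lam ^+ D / 2) ^+ (8 * Z * t) <= _).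
    by apply: ler_wiXn2l => //; lra.
  rewrite exprM; apply: lerXn2r; rewrite ?nnegrE ?exprn_ge0 //; first by lra.
  apply: le_trans (bernoulli_inv _ _ _) _; [lra|lra|].
  rewrite lef_pV2 ?posrE //; last by rewrite natrM; nra.
  have : Z%:R * Z%:R^-1 = 1 :> R by rewrite mulfV ?gt_eqF.
  by rewrite natrM; nra.
have h2 : Pm la (fun b => (2^-1) ^+ t * (#|[set q in s | survives b q]| <= t)%:R) <=
   (4^-1) ^+ t.
  apply: le_trans h1; rewrite -Pm_half_pow; apply: Pm_le => // b.
  have -> : \prod_(q in s) (if survives b q then 2^-1 else 1) =
     (2^-1 : R) ^+ #|[set q in s | survives b q]|.
    rewrite -big_mkcondr /= prodr_const; congr (_ ^+ _); apply: eq_card => q.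
    by rewrite !inE.
  case: leqP => h; rewrite ?mulr1 ?mulr0; last by apply: exprn_ge0; lra.
  by apply: ler_wiXn2l => //; lra.
have p2 : (0 : R) < (2^-1) ^+ t by apply: exprn_gt0; lra.
rewrite PmZ in h2; rewrite -(ler_pM2l p2); apply: le_trans h2 _.
by rewrite -exprMn; apply: lerXn2r; rewrite ?nnegrE; lra.
Qed.

End Chernoff.

Section FallingProduct.
Variables (R : realFieldType) (k : nat).
Hypothesis k0 : (0 < k)%N.

(** The probability that [n] independent uniform colours out of [k] are distinct. *)
Definition fall (n : nat) : R := \prod_(l < n) (1 - l%:R / k%:R).

Let kp : (0 : R) < k%:R. Proof. by rewrite ltr0n. Qed.

Lemma fallS n : fall n.+1 = fall n * (1 - n%:R / k%:R).
Proof. by rewrite /fall big_ord_recr. Qed.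

Lemma fall0 : fall 0 = 1. Proof. by rewrite /fall big_ord0. Qed.

Lemma fall_term l : (l < k)%N -> 0 < 1 - l%:R / k%:R :> R.
Proof. by move=> lk; rewrite subr_gt0 ltr_pdivrMr // mul1r ltr_nat. Qed.

Lemma fall_gt0 n : (n <= k)%N -> 0 < fall n.
Proof.
elim: n => [|n IH] nk; first by rewrite fall0.
by rewrite fallS mulr_gt0 ?fall_term // IH // ltnW.
Qed.

Lemma fall_le n p : (n <= p)%N -> (p <= k)%N -> fall p <= fall n.
Proof.
move=> /subnK <-; elim: (p - n)%N => [|j IH] jk; first by rewrite add0n.
rewrite addSn in jk *; apply: le_trans (IH (ltnW jk)).
rewrite fallS ger_pMr ?fall_gt0 1?ltnW //.
by rewrite lerBlDr lerDl divr_ge0 ?ler0n.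
Qed.

Lemma fall_le1 n : (n <= k)%N -> fall n <= 1.
Proof. by move=> nk; rewrite -fall0 fall_le. Qed.

Lemma fall_ge n : (n <= k)%N -> 1 - (n ^ 2)%:R / k%:R <= fall n.
Proof.
elim: n => [|n IH] nk; first by rewrite fall0 mul0r subr0.
rewrite fallS; have := IH (ltnW nk); have := fall_le1 (ltnW nk); have := fall_term nk.
have f0 := fall_gt0 (ltnW nk).
have n0 : 0 <= n%:R / k%:R :> R by rewrite divr_ge0.
have -> : (n.+1 ^ 2)%:R / k%:R = (n ^ 2)%:R / k%:R + 2 * (n%:R / k%:R) + k%:R^-1 :> R.
  by rewrite !natrX -natr1; field; rewrite gt_eqF.
have : 0 < k%:R^-1 :> R by rewrite invr_gt0.
by nra.
Qed.

End FallingProduct.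

Lemma pow_quarter (R : realFieldType) (a : nat) : 4^-1 <= (a%:R / a.+1%:R : R) ^+ a.
Proof.
have ap : (0 : R) < a.+1%:R by rewrite ltr0n.
set x : R := a.+1%:R^-1.
have x0 : 0 < x by rewrite invr_gt0.
have x1 : x <= 1 by rewrite invf_le1 // ler1n.
have ex : a%:R / a.+1%:R = 1 - x :> R by rewrite -[a%:R](addrK 1) natr1 mulrBl mulfV ?gt_eqF // mul1r.
rewrite ex; pose b := uphalf a.
have hb : 2^-1 <= (1 - x) ^+ b.
  apply: le_trans (bernoulli_ge _ (ltW x0) x1).
  have : (b.*2 <= a.+1)%N by rewrite /b; lia.
  rewrite -(ler_nat R) -muln2 natrM => h.
  have e1 : a.+1%:R * x = 1 by rewrite mulfV ?gt_eqF.
  by have := ler_wpM2r (ltW x0) h; rewrite e1; lra.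
apply: le_trans (_ : (1 - x) ^+ (b.*2) <= _).
  by rewrite -mul2n exprM exprAC expr2; nra.
apply: ler_wiXn2l; [by rewrite subr_ge0|by rewrite lerBlDr lerDl ltW|].
by rewrite /b; lia.
Qed.

(** A bound that stays useful up to [n = k], where [fall] is exponentially small. It follows from
    [fall k.+1 n.+1 = fall k n * (k / k.+1) ^ n] and [(k / k.+1) ^ k >= 1 / 4]. *)
Lemma fall_ge_quarter (R : realFieldType) (k n : nat) :
  (n <= k)%N -> (4^-1) ^+ n <= fall R k n.
Proof.
elim: n k => [|n IH] k; first by rewrite expr0 fall0.
case: k => // k; rewrite ltnS => nk.
have kp : (0 : R) < k.+1%:R by rewrite ltr0n.
have e : fall R k.+1 n.+1 = fall R k n * (k%:R / k.+1%:R) ^+ n.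
  rewrite /fall big_ord_recl /= mul0r subr0 mul1r.
  have -> : (k%:R / k.+1%:R : R) ^+ n = \prod_(l < n) (k%:R / k.+1%:R).
    by rewrite prodr_const card_ord.
  rewrite -big_split /=.
  apply: eq_bigr => l _; rewrite /bump /=.
  have k0 : (k%:R : R) != 0 by rewrite pnatr_eq0; case: (k) nk l => // ; case: n {IH} => // _ [].
  by rewrite add1n -!natr1; field; rewrite k0 natr1 gt_eqF.
rewrite e exprSr; apply: ler_pM; [by apply: exprn_ge0; lra|lra|exact: IH|].
apply: le_trans (pow_quarter R k) _; apply: ler_wiXn2l => //.
  by rewrite divr_ge0.
by rewrite ler_pdivrMr // mul1r ler_nat.
Qed.

(** * Correlation of two rainbow events *)

Section UniformInjective.
Variables (R : realFieldType) (J S : finType) (K : {set S}) (nu : J -> S -> R).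
Let k := #|K|.
Hypothesis k0 : (0 < k)%N.
Hypothesis nu_pmf : is_pmf nu.
Variable T : {set J}.
Hypothesis nuT : forall e v, e \in T -> v \in K -> nu e v = k%:R^-1.

Implicit Types (Y Z : {set J}) (f : {ffun J -> S}).

Definition rainbow_on (Z : {set J}) (f : {ffun J -> S}) :=
  [forall e in Z, f e \in K] && dinjectiveb f (mem Z).

Lemma rainbow_on_upd Y e f v : e \notin Y ->
  rainbow_on (e |: Y) (upd f e v) = rainbow_on Y f && (v \in K :\: f @: Y).
Proof.
move=> eY.
have ne y : y \in Y -> y != e by apply: contraTneq => ->.
apply/andP/andP => [[/forallP hK /dinjectiveP hI]|[/andP[/forallP hK /dinjectiveP hI]]].
  have hK' y : y \in Y -> f y \in K.
    move=> yY; have := hK y; rewrite !inE yY orbT /= ffunE.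
    by rewrite (negbTE (ne _ yY)).
  split.
    apply/andP; split; first by apply/forallP => y; apply/implyP; apply: hK'.
    apply/dinjectiveP => y y' yY yY' ef; apply: hI; rewrite ?inE ?yY ?yY' ?orbT //.
    by rewrite !ffunE (negbTE (ne _ yY)) (negbTE (ne _ yY')).
  rewrite inE; apply/andP; split; last first.
    by have := hK e; rewrite !inE eqxx /= ffunE eqxx.
  apply/imsetP => -[y yY ev].
  have := hI e y; rewrite !inE eqxx yY orbT !ffunE eqxx (negbTE (ne _ yY)) => /(_ isT isT ev) eY'.
  by move: yY; rewrite -eY' (negbTE eY).
rewrite inE => /andP[vY vK]; split.
  apply/forallP => y; apply/implyP; rewrite !inE ffunE; case: eqP => [//|_] /= yY.
  by have /implyP/(_ yY) := hK y.
apply/dinjectiveP => y y'; rewrite !inE !ffunE.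
case: (eqVneq y e) => [-> _|_ /= yY]; case: (eqVneq y' e) => [-> //|_ /= yY'].
- by move=> ev; case/imsetP: vY; exists y'.
- by move=> _ ev; case/imsetP: vY; exists y.
by move=> ef; apply: hI.
Qed.

Lemma Pm_rainbow_step Z Y e : e \in T -> e \notin Z -> e \notin Y ->
  Pm nu (fun f => (rainbow_on Z f)%:R * (rainbow_on (e |: Y) f)%:R) =
  (1 - #|Y|%:R / k%:R) * Pm nu (fun f => (rainbow_on Z f)%:R * (rainbow_on Y f)%:R).
Proof.
move=> eT eZ eY; rewrite (Pm_resample nu_pmf e) -PmZ; apply: Pm_ext => f.
have kn : (k%:R : R) != 0 by rewrite pnatr_eq0 -lt0n.
have rZ v : rainbow_on Z (upd f e v) = rainbow_on Z f.
  have ne y : y \in Z -> (y == e) = false by move=> yZ; apply: contraTF yZ => /eqP->.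
  congr (_ && _).
    by apply: eq_forallb => y; case: (boolP (y \in Z)) => //= yZ; rewrite ffunE ne.
  apply/dinjectiveP/dinjectiveP => hI y y' yZ yZ' ef; apply: hI; rewrite ?ffunE ?ne //.
  by move: ef; rewrite !ffunE !ne.
under eq_bigr => v _ do rewrite rZ rainbow_on_upd //.
case rY : (rainbow_on Y f) => /=; last by rewrite big1 ?mulr0 // => v _; rewrite !mulr0.
rewrite !mulr1.
transitivity ((rainbow_on Z f)%:R * \sum_(v in K :\: f @: Y) nu e v).
  rewrite [X in _ * X]big_mkcond mulr_sumr; apply: eq_bigr => v _; rewrite mulrCA; congr (_ * _).
  by case: (v \in _); rewrite ?mulr1 ?mulr0.
rewrite mulrC; congr (_ * _).
transitivity (\sum_(v in K :\: f @: Y) (k%:R^-1 : R)).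
  by apply: eq_bigr => v; rewrite inE => /andP[_ vK]; apply: nuT.
rewrite sumr_const.
case/andP: rY => /forallP hK /dinjectiveP hI.
have sub : f @: Y \subset K.
  by apply/subsetP => _ /imsetP[y yY ->]; have /implyP/(_ yY) := hK y.
have -> : #|K :\: f @: Y| = (k - #|Y|)%N.
  by rewrite cardsDS // card_in_imset.
have yk : (#|Y| <= k)%N by rewrite -(card_in_imset hI) subset_leq_card.
by rewrite -[LHS]mulr_natl natrB // mulrBl mulfV.
Qed.

(** Remove the edges of [Y] outside [Z] one at a time. Whatever happens on [Z], such an edge has a
    uniform colour and avoids those of the remaining edges of [Y], [y] in number, with probability
    [1 - y / k]. Once [Y] is contained in [Z], its rainbow event is implied. So the correlation
    depends only on the size of the intersection. *)
Lemma Pm_rainbow2 Z Y : Z \subset T -> Y \subset T -> (#|Z| <= k)%N -> (#|Y| <= k)%N ->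
  Pm nu (fun f => (rainbow_on Z f)%:R * (rainbow_on Y f)%:R) * fall R k #|Z :&: Y| =
  Pm nu (fun f => (rainbow_on Z f)%:R) * fall R k #|Y|.
Proof.
move=> ZT; have [n] := ubnP #|Y :\: Z|; elim: n Y => // n IH Y.
have [sub _ YT Zk Yk|/set0Pn[e]] := eqVneq (Y :\: Z) set0.
  have YZ : Y \subset Z by rewrite -setD_eq0 sub.
  rewrite (setIidPr YZ); congr (_ * _); apply: Pm_ext => f.
  case: (boolP (rainbow_on Z f)); rewrite ?mul0r // mul1r => /andP[/forallP hK /dinjectiveP hI].
  have -> // : rainbow_on Y f = true.
  apply/andP; split.
    by apply/forallP => y; apply/implyP => yY; have /implyP := hK y; apply; apply: (subsetP YZ).
  by apply/dinjectiveP => y y' yY yY'; apply: hI; apply: (subsetP YZ).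
rewrite inE => /andP[eZ eY] Yn YT Zk Yk.
have eYe : Y = e |: Y :\ e by rewrite setD1K.
have cY : #|Y| = #|Y :\ e|.+1 by rewrite (cardsD1 e) eY.
have cI : Z :&: Y = Z :&: (Y :\ e).
  by apply/setP => y; rewrite !inE; case: (eqVneq y e) => [->|]; rewrite ?(negbTE eZ).
have h : Pm nu (fun f => (rainbow_on Z f)%:R * (rainbow_on (Y :\ e) f)%:R) *
    fall R k #|Z :&: (Y :\ e)| = Pm nu (fun f => (rainbow_on Z f)%:R) * fall R k #|Y :\ e|.
  apply: IH => //.
  - rewrite -ltnS; apply: leq_trans Yn; rewrite ltnS; apply: proper_card.
    apply/properP; split; first by apply: setSD; apply: subD1set.
    by exists e; rewrite !inE ?eqxx ?eZ ?eY.
  - by apply: subset_trans YT; apply: subD1set.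
  - by apply: leq_trans Yk; rewrite cY.
rewrite cY fallS mulrA -h -cI {1}eYe Pm_rainbow_step ?inE ?eqxx //; last by apply: (subsetP YT).
by rewrite [RHS]mulrC mulrA.
Qed.

Lemma Pm_rainbow Y : Y \subset T -> (#|Y| <= k)%N ->
  Pm nu (fun f => (rainbow_on Y f)%:R) = fall R k #|Y|.
Proof.
move=> YT Yk; have := @Pm_rainbow2 set0 Y (sub0set _) YT _ Yk.
rewrite cards0 set0I cards0 fall0 mulr1 => /(_ isT).
have r0 f : rainbow_on set0 f.
  apply/andP; split; first by apply/forallP => y; rewrite inE.
  by apply/dinjectiveP => y y'; rewrite inE.
rewrite (Pm_ext _ (G := fun f => (rainbow_on Y f)%:R)) => [->|f]; last by rewrite r0 mul1r.
by rewrite (Pm_ext _ (G := fun => 1)) ?Pm_cst ?mul1r // => f; rewrite r0.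
Qed.

End UniformInjective.

(** * Rainbow perfect matchings *)

Section Asymptotics.
Variable R : realType.

Lemma inv_small (eps : R) : 0 < eps ->
  exists N : nat, forall n, (N <= n)%N -> n.+1%:R^-1 <= eps.
Proof.
move=> e0; exists (Num.truncn eps^-1) => n hn.
rewrite -[leRHS]invrK lef_pV2 ?posrE ?invr_gt0 ?ltr0n //.
apply: le_trans (ltW (truncnS_gt _)) _; first by rewrite ler_nat.
Qed.

Lemma half_pow_le (n : nat) : (2^-1 : R) ^+ n <= n.+1%:R^-1.
Proof.
rewrite exprVn lef_pV2 ?posrE ?exprn_gt0 // ?ltr0n //.
by rewrite -natrX ler_nat ltn_expl.
Qed.

Lemma half_pow_small (eps : R) : 0 < eps ->
  exists N : nat, forall n, (N <= n)%N -> (2^-1 : R) ^+ n <= eps.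
Proof.
move=> /inv_small[N HN]; exists N => n /HN; exact/le_trans/half_pow_le.
Qed.

Lemma lin_half_pow_small (a : nat) (eps : R) : (0 < a)%N -> 0 < eps ->
  exists N : nat, forall n, (N <= n)%N -> n%:R * (2^-1 : R) ^+ (n %/ a) <= eps.
Proof.
move=> a0 e0.
have ap : (0 : R) < a%:R by rewrite ltr0n.
have [N HN] := inv_small (divr_gt0 e0 (mulr_gt0 (ltr0n R 2 : 0 < 2) ap)).
exists (2 * N * a)%N => n hn; set t := (n %/ a)%N.
pose u := (t %/ 2)%N.
have tN : (2 * N <= t)%N by rewrite /t leq_divRL.
have uN : (N <= u)%N by rewrite /u; lia.
have hu := HN u uN.
have nb : (n <= a * (2 * u.+1))%N.
  have : (n < a * t.+1)%N by rewrite mulnC; apply: ltn_ceil.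
  have : (t.+1 <= 2 * u.+1)%N by rewrite /u; lia.
  by move=> h1 h2; apply: ltnW; apply: leq_trans h2 _; rewrite leq_mul2l h1 orbT.
have h2 : (2^-1 : R) ^+ t <= u.+1%:R^-1 * u.+1%:R^-1.
  apply: le_trans (_ : (2^-1 : R) ^+ (u + u) <= _).
    by apply: ler_wiXn2l; [lra|lra|rewrite /u; lia].
  by rewrite exprD; apply: ler_pM; rewrite ?half_pow_le //; apply: exprn_ge0; lra.
have up : (0 : R) < u.+1%:R by rewrite ltr0n.
apply: le_trans (_ : (a * (2 * u.+1))%:R * (u.+1%:R^-1 * u.+1%:R^-1) <= _).
  apply: ler_pM; rewrite ?ler0n ?ler_nat //; apply: exprn_ge0; lra.
have -> : (a * (2 * u.+1))%:R * (u.+1%:R^-1 * u.+1%:R^-1) = a%:R * 2 * u.+1%:R^-1 :> R.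
  by rewrite !natrM; move: up; move: (u.+1%:R : R) => v up; field; rewrite gt_eqF.
apply: le_trans (ler_wpM2l _ hu) _; first by rewrite mulr_ge0.
by rewrite le_eqVlt; apply/orP; left; apply/eqP; field; rewrite gt_eqF.
Qed.

Lemma exp_quad_small (a : nat) (eps : R) : (0 < a)%N -> 0 < eps ->
  exists N : nat, forall n, (N <= n)%N ->
    (4 : R) ^+ n * (2^-1) ^+ (n ^ 2 %/ a) <= eps.
Proof.
move=> a0 e0; have [N HN] := half_pow_small e0.
exists (N + 3 * a)%N => n hn.
have h3 : (3 * n <= n ^ 2 %/ a)%N by rewrite leq_divRL //; nia.
apply: le_trans (HN n _); last by lia.
apply: le_trans (_ : (4 : R) ^+ n * (2^-1) ^+ (3 * n) <= _).
  apply: ler_wpM2l; first by apply: exprn_ge0.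
  by apply: ler_wiXn2l; lra || lia.
by rewrite exprM -exprMn; apply: lerXn2r; rewrite ?nnegrE; lra.
Qed.

(** Since [(2 * B) ^ j / j!] is bounded in [j], the terms are dominated by a multiple of [2 ^ -j].
    The estimate is uniform in [i0], which later grows with the number of hubs. *)
Lemma exp_series_tail (B : nat) (eps : R) : 0 < eps ->
  exists L : nat, forall i0, \sum_(L.+1 <= j < i0.+1) (B%:R ^+ j / j`!%:R : R) <= eps.
Proof.
move=> e0; pose b := (2 * B).+1.
have fp j : (0 : R) < j`!%:R by rewrite ltr0n fact_gt0.
pose C4 : R := b%:R ^+ b.
have C40 : 0 < C4 by apply: exprn_gt0; rewrite ltr0n.
have hb1 : (1 : R) <= b%:R by rewrite ler1n.
have hBb : 0 <= 2 * (B%:R : R) by rewrite mulr_ge0.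
have hBle : 2 * (B%:R : R) <= b%:R by rewrite -natrM ler_nat /b; lia.
have h1 j : (2 * B%:R) ^+ j / j`!%:R <= C4 :> R.
  elim: j => [|j IH]; first by rewrite expr0 fact0 invr1 mulr1 exprn_ege1.
  have [jb|bj] := leqP j.+1 b.
    rewrite ler_pdivrMr //; apply: le_trans (_ : C4 * 1 <= _); last first.
      by apply: ler_wpM2l; [exact: ltW|rewrite ler1n fact_gt0].
    rewrite mulr1; apply: le_trans (_ : b%:R ^+ j.+1 <= _).
      by apply: lerXn2r; rewrite ?nnegrE.
    by apply: ler_weXn2l.
  apply: le_trans IH.
  have jp : (0 : R) < j.+1%:R by rewrite ltr0n.
  have -> : (2 * B%:R) ^+ j.+1 / j.+1`!%:R = (2 * B%:R) ^+ j / j`!%:R * (2 * B%:R / j.+1%:R) :> R.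
    rewrite factS natrM exprSr; move: jp (fp j); move: (j.+1%:R : R) (j`!%:R : R) => x y x0 y0.
    by field; rewrite !gt_eqF.
  rewrite -[leRHS]mulr1; apply: ler_wpM2l.
    by rewrite divr_ge0 ?exprn_ge0.
  by rewrite ler_pdivrMr // mul1r -natrM ler_nat; lia.
have h2 j : B%:R ^+ j / j`!%:R <= C4 * (2^-1) ^+ j :> R.
  have -> : B%:R ^+ j / j`!%:R = (2 * B%:R) ^+ j / j`!%:R * (2^-1) ^+ j :> R.
    by rewrite mulrAC -exprMn; congr (_ ^+ _ / _); field.
  by apply: ler_wpM2r => //; apply: exprn_ge0; lra.
have [L HL] := half_pow_small (divr_gt0 e0 C40).
exists L => i0.
apply: le_trans (_ : C4 * (2^-1) ^+ L <= _); last first.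
  have := HL L (leqnn _); rewrite ler_pdivlMr //; lra.
apply: le_trans (_ : C4 * ((2^-1) ^+ L - (2^-1) ^+ (maxn L i0)) <= _); last first.
  apply: ler_wpM2l; [exact: ltW|].
  have : 0 <= (2^-1 : R) ^+ (maxn L i0) by apply: exprn_ge0; lra.
  by lra.
have [i0L|Li0] := leqP i0 L.
  by rewrite big_geq // subrr mulr0.
have -> : i0 = ((i0 - L) + L)%N by lia.
elim: (i0 - L)%N => [|j IH]; first by rewrite big_geq // add0n subrr mulr0.
rewrite addSn big_nat_recr /=; last by lia.
have ex : (2^-1 : R) ^+ (j + L).+1 = 2^-1 * 2^-1 ^+ (j + L) by rewrite exprS.
have := h2 (j + L).+1; move: IH; rewrite ex.
set x := (2^-1) ^+ (j + L); set y := \sum_(_ <= _ < _) _.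
have x0 : 0 <= x by apply: exprn_ge0; lra.
by set z := _ / _; nra.
Qed.

End Asymptotics.

(** * The second moment of the number of rainbow perfect matchings *)

Section SecondMoment.
Variables (R : realType) (J S : finType) (K : {set S}) (nu : J -> S -> R) (T : {set J}).
Variables (D s c : nat) (E : rel 'I_s) (ed : 'I_s -> 'I_s -> 'I_D -> J).
Let k := #|K|.
Hypothesis nu_pmf : is_pmf nu.
Hypothesis nuT : forall e v, e \in T -> v \in K -> nu e v = k%:R^-1.
Hypothesis ed_inj : injective (fun p : ('I_s * 'I_s) * 'I_D => ed p.1.1 p.1.2 p.2).
Hypothesis edT : forall i j l, E i j -> ed i j l \in T.
Hypothesis kE : k = (s * D)%N.
Hypothesis D0 : (0 < D)%N.
Hypothesis c0 : (0 < c)%N.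
Hypothesis sc : (32 * c <= s)%N.
Hypothesis many_chains : forall (t : {perm 'I_s}) w,
  (s ^ 4 <= c * #|[set v | chain E t w (t w) v]|)%N.

Definition medges (t : {perm 'I_s}) : {set J} :=
  [set ed p.1 (t p.1) p.2 | p : 'I_s * 'I_D].

Lemma card_medges t : #|medges t| = k.
Proof.
rewrite card_imset ?cardsT ?card_prod ?card_ord ?kE // => -[i l] [i' l'] /= e.
by have := @ed_inj ((i, t i), l) ((i', t i'), l') e => -[-> _ ->].
Qed.

Lemma card_medgesI t u : #|medges t :&: medges u| = (n_agree t u * D)%N.
Proof.
have -> : medges t :&: medges u =
   [set ed p.1 (t p.1) p.2 | p in setX [set i | t i == u i] [set: 'I_D]].
  apply/setP => e; rewrite inE; apply/andP/imsetP => [[/imsetP[[i l] _ ->]]|].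
    case/imsetP=> -[i' l'] _ /= e'.
    have := @ed_inj ((i, t i), l) ((i', u i'), l') e' => -[ii tu _].
    by exists (i, l); rewrite // !inE /= tu -ii eqxx.
  case=> -[i l]; rewrite !inE /= andbT => /eqP tu ->; split; apply/imsetP; exists (i, l) => //=.
  by rewrite tu.
rewrite card_in_imset ?cardsX ?cardsT ?card_ord // => -[i l] [i' l'] _ _ /= e.
by have := @ed_inj ((i, t i), l) ((i', t i'), l') e => -[-> _ ->].
Qed.

Lemma n_agree_le (t u : {perm 'I_s}) : (n_agree t u <= s)%N.
Proof. by rewrite -[X in (_ <= X)%N](card_ord s) max_card. Qed.

(** Up to [i0] agreements the bound [card_agree_ge] applies. As [s <= M * i0], a pair with more
    agreements can be charged to the term for [i0], at the price of the exponent [D * M] in place of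
    [D]. *)
Let i0 := (s %/ (16 * c))%N.
Let M := (32 * c)%N.

(** By Chebyshev the failure probability is at most the mean of [rho j - 1] over pairs of perfect
    matchings, where [j] counts agreements and [rho j] is the inverse of [fall (j * D)]. Pairs with
    at most [L] agreements give the first term. For the others [rho j <= 4 ^ (j * D)], which the
    factorial in [card_agree_ge] outweighs. *)
Lemma second_moment (L : nat) : (L < i0)%N ->
  Pm nu (fun f => (~~ [exists t in perfect_matchings E, rainbow_on K (medges t) f])%:R)
  <= (fall R k (L * D))^-1 - 1 +
     \sum_(L.+1 <= j < i0.+1) ((2 * c * 4 ^ (D * M))%N%:R ^+ j / j`!%:R).
Proof.
move=> Li0.
have s0 : (0 < s)%N by lia.
have k0 : (0 < k)%N by rewrite kE muln_gt0 s0.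
have ti0 : (s < 16 * c * i0.+1)%N by rewrite mulnC; apply: ltn_ceil; lia.
have ti0' : (16 * c * i0 <= s)%N by rewrite mulnC leq_divM.
have sM : (s <= M * i0)%N by rewrite /M; nia.
have i0s : (2 * c * (6 + 4 * i0) <= s)%N.
  by have : (12 * c + 8 * c * i0 <= s)%N; [nia|lia].
set PM := perfect_matchings E.
have PM0 : (0 < #|PM|)%N by apply: (perfect_matchings_gt0 many_chains) => //; lia.
have Np : (0 : R) < #|PM|%:R by rewrite ltr0n.
have mT t : t \in PM -> medges t \subset T.
  rewrite inE => /forallP h; apply/subsetP => _ /imsetP[[i l] _ ->] /=.
  exact: edT.
pose X (f : {ffun J -> S}) : R := \sum_(t in PM) (rainbow_on K (medges t) f)%:R.
have fk : 0 < fall R k k by apply: fall_gt0.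
have EX : Pm nu X = #|PM|%:R * fall R k k.
  rewrite Pm_sum (eq_bigr (fun => fall R k k)).
    by rewrite sumr_const mulr_natl.
  move=> t tP; rewrite (Pm_rainbow _ nu_pmf nuT) ?card_medges //; exact: mT.
have EX2 : Pm nu (fun f => X f ^+ 2) =
   \sum_(t in PM) \sum_(u in PM) fall R k k ^+ 2 / fall R k (n_agree t u * D).
  transitivity (Pm nu (fun f => \sum_(t in PM) \sum_(u in PM)
      (rainbow_on K (medges t) f)%:R * (rainbow_on K (medges u) f)%:R)).
    apply: Pm_ext => f; rewrite expr2 /X mulr_suml; apply: eq_bigr => t _.
    by rewrite mulr_sumr.
  rewrite Pm_sum; apply: eq_bigr => t tP; rewrite Pm_sum; apply: eq_bigr => u uP.
  have fp : 0 < fall R k (n_agree t u * D).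
    by apply: fall_gt0 => //; rewrite kE leq_mul2r n_agree_le orbT.
  apply: (mulIf (negbT (gt_eqF fp))); rewrite divfK ?gt_eqF //.
  rewrite -card_medgesI (Pm_rainbow2 _ nu_pmf nuT) ?card_medges ?mT //.
  by rewrite (Pm_rainbow _ nu_pmf nuT) ?card_medges ?mT.
have EX0 : 0 < Pm nu X by rewrite EX mulr_gt0.
apply: le_trans (_ : Pm nu (fun f => (X f == 0)%:R) <= _).
  apply: Pm_le => // f; case: (boolP [exists _ in _, _]); rewrite ?ler0n //=.
  move=> /existsPn h; rewrite /X big1 ?eqxx // => t tP.
  by have := h t; rewrite tP /= => /negbTE ->.
apply: le_trans (Pm_chebyshev nu_pmf EX0) _.
pose rho j := (fall R k (j * D))^-1.
have -> : Pm nu (fun f => X f ^+ 2) / Pm nu X ^+ 2 - 1 =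
   (\sum_(t in PM) \sum_(u in PM) (rho (n_agree t u) - 1)) / #|PM|%:R ^+ 2.
  rewrite EX EX2 exprMn; apply/eqP; rewrite subr_eq; apply/eqP.
  have -> : \sum_(t in PM) \sum_(u in PM) (rho (n_agree t u) - 1) =
     \sum_(t in PM) \sum_(u in PM) rho (n_agree t u) - #|PM|%:R ^+ 2.
    rewrite expr2 -{2}[#|PM|%:R]mulr1 -{1}[#|PM|%:R]/(1 *+ #|PM|) -sumr_const mulr_suml -sumrB.
    apply: eq_bigr => t _; rewrite sumrB; congr (_ - _).
    by rewrite mul1r sumr_const mulr1.
  rewrite mulrBl divff ?subrK ?expf_eq0 ?gt_eqF // .
  have -> : \sum_(t in PM) \sum_(u in PM) fall R k k ^+ 2 / fall R k (n_agree t u * D) =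
     fall R k k ^+ 2 * \sum_(t in PM) \sum_(u in PM) rho (n_agree t u).
    rewrite mulr_sumr; apply: eq_bigr => t _; rewrite mulr_sumr; exact: eq_bigr.
  by field; rewrite !gt_eqF.
have pw j : (j <= s)%N -> rho j - 1 <= rho L - 1 +
   \sum_(L.+1 <= i < i0.+1) (4 ^ (D * M))%N%:R ^+ i * (i <= j)%N%:R.
  move=> js.
  have jk : (j * D <= k)%N by rewrite kE leq_mul2r js orbT.
  have sum0 : 0 <= \sum_(L.+1 <= i < i0.+1) (4 ^ (D * M))%N%:R ^+ i * (i <= j)%N%:R :> R.
    by apply: sumr_ge0 => i _; rewrite mulr_ge0 ?exprn_ge0.
  have i0s' : (i0 <= s)%N by nia.
  have Lk : (L * D <= k)%N by rewrite kE leq_mul2r; apply/orP; right; lia.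
  have rho1 : 1 <= rho L by rewrite /rho invf_ge1 ?fall_le1 ?fall_gt0.
  have [jL|Lj] := leqP j L.
    have : rho j <= rho L.
      rewrite /rho lef_pV2 ?posrE ?fall_gt0 // fall_le // leq_mul2r jL orbT //.
    by lra.
  have big4 i : (L < i)%N -> (i <= i0)%N -> (i <= j)%N ->
     (4 ^ (D * M))%N%:R ^+ i <= \sum_(L.+1 <= i < i0.+1) (4 ^ (D * M))%N%:R ^+ i * (i <= j)%N%:R :> R.
    move=> Li ii ij; rewrite (bigD1_seq i) ?iota_uniq //=; last by rewrite mem_index_iota Li ltnS.
    rewrite ij mulr1 lerDl; apply: sumr_ge0 => i' _; rewrite mulr_ge0 ?exprn_ge0 //.
  have r4 : rho j <= 4 ^+ (j * D).
    rewrite /rho -[leRHS]invrK lef_pV2 ?posrE ?fall_gt0 // ?invr_gt0 ?exprn_gt0 //.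
    by rewrite -exprVn fall_ge_quarter.
  suff : rho j <= \sum_(L.+1 <= i < i0.+1) (4 ^ (D * M))%N%:R ^+ i * (i <= j)%N%:R by lra.
  apply: le_trans r4 _.
  have M0 : (0 < M)%N by rewrite /M; lia.
  have [ji|ij] := leqP j i0.
    apply: le_trans (big4 j Lj ji (leqnn _)); rewrite natrX -exprM.
    by apply: ler_weXn2l; [lra|nia].
  apply: le_trans (big4 i0 Li0 (leqnn _) (ltnW ij)); rewrite natrX -exprM.
  by apply: ler_weXn2l; [lra|nia].
have inner t : t \in PM -> \sum_(u in PM) (rho (n_agree t u) - 1) <=
   #|PM|%:R * (rho L - 1 +
     \sum_(L.+1 <= j < i0.+1) ((2 * c * 4 ^ (D * M))%N%:R ^+ j / j`!%:R)).
  move=> tP; apply: le_trans (ler_sum _ (fun u _ => pw _ (n_agree_le t u))) _.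
  rewrite big_split /= sumr_const mulrDr mulr_natl lerD2l.
  rewrite exchange_big /= mulr_sumr !big_nat; apply: ler_sum => j /andP[_ ji0].
  rewrite -mulr_sumr natrM exprMn.
  have -> : \sum_(u in PM) (j <= n_agree t u)%N%:R = #|[set u in PM | (j <= n_agree t u)%N]|%:R :> R.
    rewrite -sum1_card natr_sum [RHS](eq_bigl (fun u => (u \in PM) && (j <= n_agree t u)%N)).
      by rewrite [RHS]big_mkcondr /=; apply: eq_bigr => u _; case: leqP.
    by move=> u; rewrite inE.
  have fp : (0 : R) < j`!%:R by rewrite ltr0n fact_gt0.
  have := @card_agree_ge s E c many_chains t j tP s0 _.
  move=> /(_ ltac:(nia)); rewrite -(ler_nat R) !natrM natrX natrM => h.
  have -> : #|PM|%:R * ((2 * c%:R) ^+ j * (4 ^ (D * M))%N%:R ^+ j / j`!%:R) =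
    (4 ^ (D * M))%N%:R ^+ j * ((2 * c%:R) ^+ j * #|PM|%:R / j`!%:R) :> R by ring.
  apply: ler_wpM2l; first by apply: exprn_ge0.
  by rewrite ler_pdivlMr.
rewrite -/(rho L) ler_pdivrMr ?exprn_gt0 // expr2 mulrA mulrAC.
apply: le_trans (ler_sum _ inner) _.
rewrite sumr_const -[leLHS]mulr_natl; set b := (_ + _).
by rewrite le_eqVlt; apply/orP; left; apply/eqP; ring.
Qed.

End SecondMoment.

Lemma card_pairs (I : finType) (P : rel I) :
  #|[set p : I * I | P p.1 p.2]| = (\sum_a \sum_b (P a b : nat))%N.
Proof.
rewrite pair_bigA -sum1_card big_mkcond /=; apply: eq_bigr => -[a b] _.
by rewrite inE /=; case: (P a b).
Qed.

Section FinalPhase.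
Variable R : realType.

(* Expose first which edges get a colour in [K]: degrees and densities survive by Chernoff bounds,
   which gives many switching chains, and the remaining randomness is uniform in [K]. *)
Lemma final_phase (D L0 L3 Lb Lm : nat) (eps : R) :
  (0 < D)%N -> (0 < L0)%N -> (0 < Lm)%N -> (4 * L0 <= L3)%N -> 0 < eps ->
  exists s0 : nat, forall s, (s0 <= s)%N ->
  forall (J S : finType) (K : {set S}) (mu : J -> S -> R) (m : nat)
    (comp : rel 'I_s) (ed : 'I_s -> 'I_s -> 'I_D -> J),
  is_pmf mu -> #|K| = (s * D)%N -> (s * D < m)%N -> (m <= Lm * s)%N ->
  injective (fun p : ('I_s * 'I_s) * 'I_D => ed p.1.1 p.1.2 p.2) ->
  (forall i j l v, comp i j -> v \in K -> mu (ed i j l) v = m%:R^-1) ->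
  (forall w, s <= L0 * \sum_x (comp w x : nat))%N ->
  (forall x, s <= L0 * \sum_w (comp w x : nat))%N ->
  (forall A X : {set 'I_s}, s <= L3 * #|A| -> s <= L3 * #|X| ->
     s ^ 2 <= Lb * ecard comp A X)%N ->
  1 - eps <= Pm mu (fun f => [exists t : {perm 'I_s},
     [forall i, comp i (t i)] && rainbow_on K (medges ed t) f]%:R).
Proof.
move=> D0 L00 Lm0 h43 e0.
(* An edge gets a colour in [K] with probability at least [1 / Lm], so all [D] edges of a pair do
   with probability at least [1 / Z]. By [chernoff] degrees and densities drop by at most [8 * Z],
   which fixes [L1] and [L2]; [Lk] is the density threshold required by [many_chains_of_dense]. *)
pose Z := (Lm ^ D)%N; have Z0 : (0 < Z)%N by rewrite expn_gt0 Lm0.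
pose L1 := (L0 * (8 * Z))%N; pose Lk := (2 * L0 * L1 + Lb)%N.
pose L2 := (Lk * (8 * Z))%N; pose c := (L2 ^ 3)%N.
have L10 : (0 < L1)%N by rewrite /L1 muln_gt0 L00 muln_gt0 Z0.
have Lk0 : (0 < Lk)%N by rewrite /Lk ltn_addr // muln_gt0 L10 andbT muln_gt0 L00.
have L20 : (0 < L2)%N by rewrite /L2 muln_gt0 Lk0 muln_gt0 Z0.
have c0 : (0 < c)%N by rewrite /c expn_gt0 L20.
pose M := (32 * c)%N.
have e4 : 0 < eps / 8 by lra.
have [L HL] := exp_series_tail (2 * c * 4 ^ (D * M)) e4.
have [N1 HN1] := lin_half_pow_small L10 e4.
have [N2 HN2] := exp_quad_small L20 e4.
have [N3 HN3] : exists N : nat, forall n, (N <= n)%N ->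
    n.+1%:R^-1 <= Num.min 2^-1 (eps / 8) / (2 * ((L * D) ^ 2)%N.+1%:R) :> R.
  apply: inv_small; apply: divr_gt0; last by rewrite mulr_gt0 // ltr0n.
  by rewrite lt_min; apply/andP; split; lra.
exists (N1 + N2 + N3 + 32 * c * L.+2)%N.+1 => s hs J S K mu m comp ed mup cK ksm mLm edI muE row col bid.
have [s0 sc] : (0 < s)%N /\ (32 * c * L.+2 <= s)%N by move: hs; move: (32 * c * L.+2)%N => q; clear; lia.
have [sN1 sN2 sN3] : [/\ N1 <= s, N2 <= s & N3 < s]%N by move: hs; move: (32 * c * L.+2)%N => q; clear; split; lia.
have [h2p h20 h21] : [/\ (0 : R) < 2^-1, (0 : R) <= 2^-1 & (2^-1 : R) <= 1] by split; clear; lra.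
have [L16 sc'] : (L < s %/ (16 * c))%N /\ (32 * c <= s)%N.
  have c16 : (0 < 16 * c)%N by rewrite muln_gt0 c0.
  by rewrite (leq_divRL _ _ c16); clear c16; clearbody c; split; apply: leq_trans sc; move: (c) => c'; clear; nia.
have m0 : (0 < m)%N by lia.
have mp : (0 : R) < m%:R by rewrite ltr0n.
pose k := #|K|; have k0 : (0 < k)%N by rewrite /k cK muln_gt0 s0.
have kp : (0 : R) < k%:R by rewrite ltr0n.
pose lam : R := k%:R / m%:R.
have lam0 : 0 < lam by rewrite divr_gt0.
have lam1 : lam < 1 by rewrite ltr_pdivrMr // mul1r ltr_nat /k cK.
pose T : {set J} := [set ed p.1.1 p.1.2 p.2 | p : ('I_s * 'I_s) * 'I_D & comp p.1.1 p.1.2].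
have muT e v : e \in T -> v \in K -> mu e v = m%:R^-1.
  by case/imsetP=> -[[i j] l] /=; rewrite inE => cij -> vK; apply: muE.
have sumK e : e \in T -> \sum_(v in K) mu e v = lam.
  move=> eT; rewrite (eq_bigr (fun => m%:R^-1)) => [|v]; last exact: muT.
  by rewrite sumr_const -[LHS]mulr_natl.
have sumKc e : e \in T -> \sum_(v | v \notin K) mu e v = 1 - lam.
  by move=> eT; rewrite -(mup.2 e) [X in _ = X - _](bigID (mem K)) /= (sumK _ eT) addrAC subrr add0r.
pose la (j : J) (b : bool) : R := if b then lam else 1 - lam.
have lap : is_pmf la.
  split=> [j []|j]; rewrite /la; [exact: ltW|by rewrite subr_ge0 ltW|].
  by rewrite big_bool /= addrC subrK.
(* The law of a colour given whether it lies in [K]; outside [T] the bit is ignored. The strict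
   inequality [s * D < m] keeps the denominator [1 - lam] positive. *)
pose nu (b : bool) (j : J) (v : S) : R :=
  if j \in T then (if b then (v \in K)%:R / k%:R else (v \notin K)%:R * mu j v / (1 - lam))
  else mu j v.
have nup b : is_pmf (nu b).
  have [mu0 mu1] := mup.
  split=> [j v|j]; rewrite /nu.
    case: (j \in T); last exact: mu0.
    case: b; first by rewrite divr_ge0.
    by rewrite divr_ge0 ?mulr_ge0 // subr_ge0 ltW.
  case: (boolP (j \in T)) => jT; last exact: mu1.
  case: b; rewrite -mulr_suml.
    rewrite -natr_sum (eq_bigr (fun v => if v \in K then 1%N else 0%N)).
      by rewrite -big_mkcond sum1_card mulfV // gt_eqF.
    by move=> v _; case: (v \in K).
  have -> : \sum_v (v \notin K)%:R * mu j v = 1 - lam.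
    rewrite -(sumKc j jT) [RHS]big_mkcond /=; apply: eq_bigr => v _.
    by case: (v \in K); rewrite ?mul0r ?mul1r.
  by rewrite mulfV // gt_eqF // subr_gt0.
have nubp (b : {ffun J -> bool}) : is_pmf (fun j => nu (b j) j).
  by split=> [j v|j]; [exact: (nup _).1 | exact: (nup _).2].
have mix j v : mu j v = \sum_b la j b * nu b j v.
  rewrite big_bool /= /nu; case: ifP => jT; last by rewrite -mulrDl addrC subrK mul1r.
  case: (boolP (v \in K)) => vK /=.
    rewrite !mul0r mulr0 addr0 mul1r muT // /lam; field.
    by rewrite !gt_eqF.
  by rewrite mul0r mulr0 add0r mul1r mulrCA mulfV ?mulr1 // gt_eqF // subr_gt0.
pose good (f : {ffun J -> S}) := [exists t : {perm 'I_s},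
     [forall i, comp i (t i)] && rainbow_on K (medges ed t) f].
suff bad : Pm mu (fun f => (~~ good f)%:R) <= eps.
  have : Pm mu (fun f => 1 + (- 1) * (~~ good f)%:R) = Pm mu (fun f => (good f)%:R).
    by apply: Pm_ext => f; case: (good f); rewrite /= ?mulr0 ?mulr1 ?addr0 ?subrr.
  by rewrite PmD PmZ Pm_cst // => <-; lra.
rewrite (Pm_mixture _ mix).
pose Q : finType := ('I_s * 'I_s)%type.
pose ed' (q : Q) l := ed q.1 q.2 l.
have ed'I : injective (fun p : Q * 'I_D => ed' p.1 p.2) by exact: edI.
have laT q l : la (ed' q l) true = lam by [].
have lamZ : Z%:R^-1 <= lam ^+ D.
  rewrite /Z natrX -exprVn; apply: lerXn2r; rewrite ?nnegrE; [by rewrite invr_ge0|exact: ltW|].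
  have Lmp : (0 : R) < Lm%:R by rewrite ltr0n.
  rewrite ler_pdivlMr // mulrC ler_pdivrMr // -natrM ler_nat /k cK.
  by apply: leq_trans mLm _; rewrite mulnC leq_mul2r leq_pmulr ?orbT.
have lamD1 : lam ^+ D <= 1 by rewrite exprn_ile1 // ltW.
pose bd (q : {set Q}) (b : {ffun J -> bool}) : bool :=
  (#|[set p in q | survives ed' b p]| <= #|q| %/ (8 * Z))%N.
have che (q : {set Q}) : Pm la (fun b => (bd q b)%:R) <= (2^-1) ^+ (#|q| %/ (8 * Z)).
  exact: (@chernoff R J Q D la lam ed' lap ed'I laT Z q Z0 lamZ lamD1).
pose Qr w : {set Q} := [set p | (p.1 == w) && comp p.1 p.2].
pose Qc x : {set Q} := [set p | (p.2 == x) && comp p.1 p.2].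
pose Qx (AX : {set 'I_s} * {set 'I_s}) : {set Q} :=
  [set p | [&& p.1 \in AX.1, p.2 \in AX.2 & comp p.1 p.2]].
pose big AX := (s ^ 2 <= Lk * #|Qx AX|)%N.
have sumQr (P : rel 'I_s) w : #|[set p : Q | (p.1 == w) && P p.1 p.2]| = (\sum_x (P w x : nat))%N.
  rewrite (card_pairs (fun a b => (a == w) && P a b)) (bigD1 w) //= [X in (_ + X)%N]big1 ?addn0.
    by apply: eq_bigr => x _; rewrite eqxx.
  by move=> a aw; rewrite big1 // => x _; rewrite (negbTE aw).
have sumQc (P : rel 'I_s) x : #|[set p : Q | (p.2 == x) && P p.1 p.2]| = (\sum_w (P w x : nat))%N.
  rewrite (card_pairs (fun a b => (b == x) && P a b)); apply: eq_bigr => w _.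
  rewrite (bigD1 x) //= eqxx /= [X in (_ + X)%N]big1 ?addn0 // => a aw.
  by rewrite (negbTE aw).
have sumQx (P : rel 'I_s) (A X : {set 'I_s}) :
   #|[set p : Q | [&& p.1 \in A, p.2 \in X & P p.1 p.2]]| = ecard P A X.
  rewrite (card_pairs (fun a b => [&& a \in A, b \in X & P a b])).
  rewrite /ecard [RHS]big_mkcond /=; apply: eq_bigr => a _.
  case: ifP => aA; last by rewrite big1.
  by rewrite [RHS]big_mkcond /=; apply: eq_bigr => x _; case: (x \in X).
(* Rows and columns are [2 * s] events of probability exponentially small in [s]. Pairs of sets are
   [4 ^ s] events, affordable because each has probability exponentially small in [s ^ 2]. *)
pose badb b := [|| [exists w, bd (Qr w) b], [exists x, bd (Qc x) b] |
   [exists AX, big AX && bd (Qx AX) b]].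
have Pbad : Pm la (fun b => (badb b)%:R) <= 3 * (eps / 8).
  have exle (I : finType) (P : pred I) : ([exists i, P i])%:R <= \sum_i (P i)%:R :> R.
    case: existsP => [[i Pi]|_]; last by apply: sumr_ge0.
    by rewrite (bigD1 i) //= Pi lerDl sumr_ge0.
  apply: le_trans (_ : Pm la (fun b => (\sum_w (bd (Qr w) b)%:R + \sum_x (bd (Qc x) b)%:R)
      + \sum_(AX | big AX) (bd (Qx AX) b)%:R) <= _).
    apply: Pm_le => // b.
    apply: le_trans (_ : ([exists w, bd (Qr w) b])%:R + ([exists x, bd (Qc x) b])%:R +
      ([exists AX, big AX && bd (Qx AX) b])%:R <= _).
      rewrite /badb -!natrD ler_nat.
      by case: [exists w, _]; case: [exists x, _]; case: [exists AX, _].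
    apply: lerD; [apply: lerD; exact: exle|].
    apply: le_trans (exle _ _) _; rewrite [leRHS]big_mkcond /=; apply: ler_sum => AX _.
    by case: (big AX).
  rewrite !PmD !Pm_sum.
  have r1 : \sum_w Pm la (fun b => (bd (Qr w) b)%:R) <= eps / 8.
    apply: le_trans (_ : \sum_(w < s) (2^-1) ^+ (s %/ L1) <= _); last first.
      by rewrite sumr_const card_ord -[leLHS]mulr_natl; exact: HN1.
    apply: ler_sum => w _; apply: le_trans (che _) _; apply: ler_wiXn2l; [exact: h20|exact: h21|].
    rewrite /L1 -(@divnMl L0 #|_|) // leq_div2r // sumQr; exact: row.
  have r2 : \sum_x Pm la (fun b => (bd (Qc x) b)%:R) <= eps / 8.
    apply: le_trans (_ : \sum_(w < s) (2^-1) ^+ (s %/ L1) <= _); last first.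
      by rewrite sumr_const card_ord -[leLHS]mulr_natl; exact: HN1.
    apply: ler_sum => x _; apply: le_trans (che _) _; apply: ler_wiXn2l; [exact: h20|exact: h21|].
    rewrite /L1 -(@divnMl L0 #|_|) // leq_div2r // sumQc; exact: col.
  have r3 : \sum_(AX | big AX) Pm la (fun b => (bd (Qx AX) b)%:R) <= eps / 8.
    apply: le_trans (_ : \sum_(AX : {set 'I_s} * {set 'I_s}) (2^-1) ^+ (s ^ 2 %/ L2) <= _); last first.
      rewrite sumr_const card_prod -!cardsT -!powersetT !card_powerset !cardsT card_ord.
      rewrite -expnMn -[leLHS]mulr_natl natrX; exact: HN2.
    rewrite [leLHS]big_mkcond /=; apply: ler_sum => AX _.
    case: ifP => [bAX|_]; last exact: exprn_ge0.
    apply: le_trans (che _) _; apply: ler_wiXn2l; [exact: h20|exact: h21|].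
    by rewrite /L2 -(@divnMl Lk #|_|) // leq_div2r.
  have -> : 3 * (eps / 8) = eps / 8 + eps / 8 + eps / 8 by clear; lra.
  by apply: lerD => //; apply: lerD.
apply: le_trans (_ : Pm la (fun b => (badb b)%:R + eps / 2) <= _); last first.
  by rewrite PmD Pm_cst //; move: Pbad e0; clear; lra.
apply: Pm_le => // b; case gb : (badb b).
  apply: le_trans (_ : 1 <= _); first by apply: Pm_le1 => // f; case: (good f).
  by rewrite lerDl divr_ge0 // ltW.
rewrite add0r.
move: gb => /negbT; rewrite !negb_or => /and3P[/existsPn nr /existsPn nc /existsPn nx].
pose E : rel 'I_s := fun i j => comp i j && survives ed' b (i, j).
have bigdiv (q : {set Q}) (r : {set Q}) : r = [set p in q | survives ed' b p] -> ~~ bd q b ->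
    (#|q| <= 8 * Z * #|r|)%N.
  move=> ->; rewrite /bd -ltnNge ltn_divLR ?muln_gt0 // => h.
  by rewrite mulnC ltnW.
have eqQ (P : pred Q) : [set p in [set p | P p && comp p.1 p.2] | survives ed' b p] =
    [set p | P p && E p.1 p.2].
  by apply/setP => -[i j]; rewrite !inE /E /= andbA.
have chains (t : {perm 'I_s}) w : (s ^ 4 <= c * #|[set v | chain E t w (t w) v]|)%N.
  apply: (@many_chains_of_dense s L0 L1 L2 L3 Lk Lb comp E s0 row col bid) => //.
  - move=> w'; apply: leq_trans (row w') _; rewrite /L1 -mulnA leq_mul2l -sumQr -(sumQr E).
    by rewrite (bigdiv _ _ _ (nr w')) ?orbT // eqQ.
  - move=> x'; apply: leq_trans (col x') _; rewrite /L1 -mulnA leq_mul2l -sumQc -(sumQc E).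
    by rewrite (bigdiv _ _ _ (nc x')) ?orbT // eqQ.
  - move=> A X; rewrite -!sumQx => h; apply: leq_trans (h) _; rewrite /L2 -mulnA leq_mul2l.
    have := nx (A, X); rewrite negb_and.
    case: (boolP (big (A, X))) => [_ /= nbd|/=].
      rewrite (bigdiv _ _ _ nbd) ?orbT //; apply/setP => -[i j].
      by rewrite !inE /= /E !andbA.
    by case/negP; exact: h.
  - by rewrite /Lk leq_addr.
  - by rewrite /Lk leq_addl.
pose Tb : {set J} := [set e in T | b e].
have nuTb e v : e \in Tb -> v \in K -> nu (b e) e v = #|K|%:R^-1.
  by rewrite inE => /andP[eT be] vK; rewrite /nu eT be vK mul1r.
have edTb i j l : E i j -> ed i j l \in Tb.
  case/andP=> cij /forallP/(_ l) bl; rewrite inE bl andbT.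
  by apply/imsetP; exists ((i, j), l); rewrite ?inE.
have := @second_moment R J S K (fun j => nu (b j) j) Tb D s c E ed (nubp b) nuTb edI edTb cK D0 c0 sc' chains L L16.
move=> h; apply: le_trans (_ : _ <= eps / 8 + eps / 8) _; last by clear -e0; lra.
apply: le_trans (le_trans h _).
  apply: Pm_le => [|f]; first exact: nubp.
  rewrite ler_nat; case: (boolP (good f)) => //= ng.
  case: (boolP [exists _ in _, _]) => // /exists_inP[t tP rt].
  case/negP: ng; apply/existsP; exists t; rewrite rt andbT.
  by move: tP; rewrite inE => /forallP h'; apply/forallP => i; have /andP[] := h' i.
apply: lerD; last exact: HL.
rewrite -/k.
pose x : R := ((L * D) ^ 2)%N%:R / k%:R.
have LDk : (L * D <= k)%N by rewrite /k cK leq_mul2r; apply/orP; right; move: sc c0; move: (c) => c'; clear; nia.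
have x0 : 0 <= x by rewrite divr_ge0.
have xs : x <= Num.min 2^-1 (eps / 8) / 2.
  have := HN3 k.-1 ltac:(have := leq_pmulr s D0; rewrite /k cK; clear -sN3 s0; lia).
  rewrite prednK // => hk.
  rewrite /x; set a := ((L * D) ^ 2)%N in hk *.
  have ap : (0 : R) < a.+1%:R by rewrite ltr0n.
  apply: le_trans (_ : a.+1%:R * k%:R^-1 <= _).
    by rewrite ler_wpM2r ?invr_ge0 ?ler_nat // ltW.
  apply: le_trans (ler_wpM2l (ltW ap) hk) _.
  rewrite le_eqVlt; apply/orP; left; apply/eqP.
  by move: ap; move: (a.+1%:R : R) => y y0; field; rewrite gt_eqF.
have [xs1 xs2] : x <= 2^-1 / 2 /\ x <= eps / 8 / 2.
  split; apply: le_trans xs _; rewrite ler_pM2r ?invr_gt0 //.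
    by rewrite ge_min lexx.
  by rewrite ge_min lexx orbT.
have f1 : 1 - x <= fall R k (L * D) by apply: fall_ge.
have fp : 0 < fall R k (L * D) by apply: fall_gt0.
rewrite lerBlDr -[leLHS]mul1r ler_pdivrMr //.
by move: xs1 xs2 f1 fp x0 e0; clear; move: (fall _ _ _) => y; nra.
Qed.

End FinalPhase.

(** * Removing the colours: a coupling of McDiarmid type *)

Lemma big_option_sum (R : pzRingType) (S : finType) (G : option S -> R) :
  \sum_v G v = G None + \sum_c G (Some c).
Proof.
rewrite (bigD1 None) //=; congr (_ + _).
transitivity (\sum_(v in Some @: [set: S]) G v).
  apply: eq_bigl => -[c|]; first by rewrite imset_f.
  by apply/esym/negP => /imsetP[].
by rewrite big_imset /= => [|? ? _ _ []] //; apply: eq_bigl => c; rewrite inE.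
Qed.

Section McDiarmid.
Variables (R : realFieldType) (J Y : finType) (St : Y -> {set J}) (m : nat) (p q : J -> R).
Hypothesis m0 : (0 < m)%N.
Hypothesis q0 : forall e, 0 <= q e.
Hypothesis qp : forall e, q e <= p e.
Hypothesis p1 : forall e, p e <= 1.

(* The colour of [e] matters only for [e] in [Q], see [has_rainbow]. *)
Definition cmu (Q : {set J}) (e : J) (v : option 'I_m) : R :=
  let r := if e \in Q then p e else q e in
  if v is Some c then r / m%:R else 1 - r.

Definition rainbow_in (Q : {set J}) (f : {ffun J -> option 'I_m}) (y : Y) :=
  [forall e in St y, f e != None] &&
  [forall e in St y :&: Q, forall e' in St y :&: Q, (f e == f e') ==> (e == e')].

Definition has_rainbow Q f := [exists y, rainbow_in Q f y].

Let mp : (0 : R) < m%:R. Proof. by rewrite ltr0n. Qed.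

Lemma cmu_sum r : 1 - r + \sum_(c < m) r / m%:R = 1 :> R.
Proof. by rewrite sumr_const card_ord -[X in _ + X]mulr_natl mulrCA divff ?gt_eqF // mulr1 subrK. Qed.

Lemma cmu_pmf Q : is_pmf (cmu Q).
Proof.
split=> [e v|e]; last by rewrite big_option_sum /cmu cmu_sum.
rewrite /cmu; have := q0 e; have := qp e; have := p1 e => h1 h2 h3.
case: v => [c|]; case: (e \in Q); rewrite ?divr_ge0 ?subr_ge0 //; [exact: le_trans h3 h2|exact: le_trans h2 h1].
Qed.

(* given the other coordinates, either a structure avoids [e], or a structure through [e]
   remains rainbow for every colour of [e] outside the at most [k] colours it uses *)
Lemma cmu_step (Q : {set J}) e k : e \notin Q -> (forall y, #|St y :&: Q| <= k)%N -> (k <= m)%N ->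
  q e * m%:R <= p e * (m - k)%:R ->
  Pm (cmu Q) (fun f => (has_rainbow Q f)%:R) <= Pm (cmu (e |: Q)) (fun f => (has_rainbow (e |: Q) f)%:R).
Proof.
move=> eQ hk km hq.
apply: (Pm_hybrid_step (j := e)); [exact: cmu_pmf|exact: cmu_pmf| |].
  by move=> i ie v; rewrite /cmu !inE (negbTE ie).
move=> f.
have upd_ne v i : i != e -> upd f e v i = f i by move=> ie; rewrite ffunE (negbTE ie).
have upd_e v : upd f e v e = v by rewrite ffunE eqxx.
have inQ i y : i \in St y :&: Q -> i != e.
  by rewrite inE => /andP[_ iQ]; apply: contraNneq eQ => <-.
have tot S' : \sum_v cmu S' e v = 1 by case: (cmu_pmf S').
case: (boolP (has_rainbow Q (upd f e None))) => [/existsP[y /andP[/forall_inP h1 /forall_inP h2]]|nF].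
  have ey : e \notin St y by apply/negP => /h1; rewrite upd_e.
  have SE : St y :&: (e |: Q) = St y :&: Q.
    apply/setP => i; rewrite !inE; case: eqP => [->|//]; by rewrite (negbTE ey).
  have all1 v : has_rainbow (e |: Q) (upd f e v).
    apply/existsP; exists y; apply/andP; split.
      apply/forall_inP => i iS; have := h1 _ iS; rewrite !upd_ne //;
      by apply: contraTneq iS => ->.
    rewrite SE; apply/forall_inP => i iS; apply/forall_inP => j jS.
    by have /forall_inP/(_ j jS) := h2 i iS; rewrite !upd_ne // (inQ _ y).
  apply: (@le_trans _ _ 1).
    rewrite -[leRHS](tot Q); apply: ler_sum => v _; rewrite -[leRHS]mulr1.
    by apply: ler_wpM2l; [exact: (cmu_pmf Q).1|case: (has_rainbow _ _)].
  by rewrite -[leLHS](tot (e |: Q)); apply: ler_sum => v _; rewrite all1 mulr1.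
rewrite !big_option_sum (negbTE nF) mulr0 add0r.
have N0 : 0 <= cmu (e |: Q) e None * (has_rainbow (e |: Q) (upd f e None))%:R.
  by apply: mulr_ge0; [exact: (cmu_pmf _).1|].
rewrite /cmu (negbTE eQ) !inE eqxx /= in N0 *.
case: (pickP (fun c => has_rainbow Q (upd f e (Some c)))) => [c0 /existsP[y /andP[/forall_inP h1 /forall_inP h2]]|no]; last first.
  rewrite big1 => [|c _]; last by rewrite no mulr0.
  apply: addr_ge0 => //; apply: sumr_ge0 => c _; rewrite mulr_ge0 // divr_ge0 //.
  exact: le_trans (q0 e) (qp e).
pose Us := [set c | [exists e' in St y :&: Q, f e' == Some c]].
have cUs : (#|Us| <= k)%N.
  apply: leq_trans (hk y); pose g i := odflt c0 (f i).
  apply: leq_trans (leq_imset_card g _); apply: subset_leq_card; apply/subsetP => c.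
  rewrite inE => /existsP[i /andP[iS /eqP fi]]; apply/imsetP; exists i => //.
  by rewrite /g fi.
have good c : c \notin Us -> has_rainbow (e |: Q) (upd f e (Some c)).
  move=> cU; apply/existsP; exists y; apply/andP; split.
    apply/forall_inP => i iS; have := h1 _ iS; case: (eqVneq i e) => [->|ie]; first by rewrite !upd_e.
    by rewrite !upd_ne.
  have cl i : i \in St y :&: (e |: Q) -> i != e -> i \in St y :&: Q.
    by move=> + ie; rewrite !inE (negbTE ie).
  have cn i : i \in St y :&: Q -> f i != Some c.
    move=> iS; apply: contra cU => h; rewrite inE; apply/existsP; exists i; by rewrite iS.
  apply/forall_inP => i iS; apply/forall_inP => j jS.
  case: (eqVneq i e) => [ie|ie]; case: (eqVneq j e) => [je|je].
  - by rewrite ie je !eqxx.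
  - by rewrite ie upd_e upd_ne // eq_sym (negbTE (cn _ (cl _ jS je))).
  - by rewrite je upd_e upd_ne // (negbTE (cn _ (cl _ iS ie))).
  by have /forall_inP/(_ j (cl _ jS je)) := h2 i (cl _ iS ie); rewrite !upd_ne.
apply: (@le_trans _ _ (q e)).
  apply: (@le_trans _ _ (\sum_(c < m) q e / m%:R)).
    apply: ler_sum => c _; rewrite -[leRHS]mulr1; apply: ler_wpM2l; last by case: (has_rainbow _ _).
    by rewrite divr_ge0.
  by rewrite sumr_const card_ord -[leLHS]mulr_natl mulrCA divff ?gt_eqF // mulr1.
apply: (@le_trans _ _ (\sum_(c in ~: Us) p e / m%:R)).
  have mn : m%:R != 0 :> R by rewrite gt_eqF.
  rewrite sumr_const -[leRHS]mulr_natl mulrCA -[leLHS](mulfK mn).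
  rewrite mulrA ler_wpM2r ?invr_ge0 //; apply: le_trans hq _.
  apply: ler_wpM2l; first exact: le_trans (q0 e) (qp e).
  by rewrite ler_nat; have := cardsC Us; rewrite card_ord; lia.
rewrite -[leLHS]add0r; apply: lerD => //.
rewrite big_mkcond; apply: ler_sum => c _; rewrite inE; case: (boolP (c \in Us)) => /= [_|/good ->].
  by rewrite mulr_ge0 // divr_ge0 //; exact: le_trans (q0 e) (qp e).
by rewrite mulr1.
Qed.

Lemma cmu_steps (S Q : {set J}) k : [disjoint S & Q] -> (forall y, #|St y :&: (S :|: Q)| <= k)%N ->
  (k <= m)%N -> (forall e, e \in S -> q e * m%:R <= p e * (m - k)%:R) ->
  Pm (cmu Q) (fun f => (has_rainbow Q f)%:R) <= Pm (cmu (S :|: Q)) (fun f => (has_rainbow (S :|: Q) f)%:R).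
Proof.
elim: {S}_.+1 {-2}S (ltnSn #|S|) Q => // n IH S Sn Q dS hk km hq.
case: (set_0Vmem S) => [->|[e eS]]; first by rewrite set0U.
have eQ : e \notin Q by apply: contraTN eS => eQ; apply/negP => eS; move: dS; rewrite disjoint_subset => /subsetP/(_ e eS); rewrite inE eQ.
have SE : S :|: Q = (S :\ e) :|: (e |: Q).
  by apply/setP => i; rewrite !inE; case: eqP => [->|//]; rewrite eS.
apply: (@le_trans _ _ (Pm (cmu (e |: Q)) (fun f => (has_rainbow (e |: Q) f)%:R))).
  apply: (@cmu_step Q e k) => //; last exact: hq.
  by move=> y; apply: leq_trans (hk y); apply: subset_leq_card; rewrite setIS // subsetUr.
rewrite SE; apply: IH.
- by move: Sn; rewrite (cardsD1 e S) eS.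
- rewrite disjoint_subset; apply/subsetP => i; rewrite !inE => /andP[/negbTE-> iS] /=.
  by move: dS; rewrite disjoint_subset => /subsetP/(_ i iS); rewrite inE.
- by rewrite -SE.
- by [].
by move=> i; rewrite inE => /andP[_ /hq].
Qed.

(** The price of an edge depends on how many edges of a structure are coloured by then. Treating
    [J1] first bounds this number by [k1] for its edges; only the remaining ones pay for [k2]. *)
Theorem mcdiarmid_coupling (J1 : {set J}) k1 k2 :
  (forall y, #|St y :&: J1| <= k1)%N -> (forall y, #|St y| <= k2)%N -> (k1 <= m)%N -> (k2 <= m)%N ->
  (forall e, e \in J1 -> q e * m%:R <= p e * (m - k1)%:R) ->
  (forall e, e \notin J1 -> q e * m%:R <= p e * (m - k2)%:R) ->
  Pm (cmu set0) (fun f => (has_rainbow set0 f)%:R) <= Pm (cmu setT) (fun f => (has_rainbow setT f)%:R).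
Proof.
move=> h1 h2 k1m k2m q1 q2.
have := @cmu_steps J1 set0 k1; rewrite setU0 => st1.
apply: le_trans (st1 _ h1 k1m q1) _; first by rewrite disjoint_sym disjoint_subset; apply/subsetP => i; rewrite inE.
have -> : setT = ~: J1 :|: J1 by rewrite setUC setUCr.
apply: (@cmu_steps (~: J1) J1 k2) => //.
- by rewrite disjoint_subset; apply/subsetP => i; rewrite !inE.
- by move=> y; apply: leq_trans (h2 y); rewrite subset_leq_card // subsetIl.
by move=> e; rewrite inE => /q2.
Qed.

Definition bmu (r : J -> R) (e : J) (b : bool) : R := if b then r e else 1 - r e.

Lemma bmu_pmf (r : J -> R) : (forall e, 0 <= r e <= 1) -> is_pmf (bmu r).
Proof.
move=> h; split=> [e b|e]; have /andP[a b1] := h e; last by rewrite big_bool /= addrC subrK.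
by case: b; rewrite /bmu // subr_ge0.
Qed.

(** For empty [Q] colours do not matter, so the coupling starts from an uncoloured random graph with
    edge probabilities [q]. *)
Lemma Pm_presence (F : {ffun J -> bool} -> R) :
  Pm (cmu set0) (fun f => F [ffun e => f e != None]) = Pm (bmu q) F.
Proof.
rewrite (Pm_map (cmu set0) (fun e v => v != None)); apply: eq_bigr => f _; congr (_ * _).
apply: eq_bigr => e _; rewrite big_mkcond big_option_sum /cmu in_set0 /bmu.
case: (f e); rewrite /= ?add0r.
  by rewrite sumr_const card_ord -[LHS]mulr_natl mulrCA divff ?gt_eqF // mulr1.
by rewrite big1 ?addr0.
Qed.

Lemma bmu_absent (r : J -> R) (Es : {set J}) : (forall e, 0 <= r e <= 1) ->
  Pm (bmu r) (fun b => [forall e in Es, ~~ b e]%:R) = \prod_(e in Es) (1 - r e).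
Proof.
move=> h; pose g e (b : bool) : R := if e \in Es then (~~ b)%:R else 1.
transitivity (Pm (bmu r) (fun b => \prod_e g e (b e))).
  apply: Pm_ext => b; case: (boolP [forall e in Es, ~~ b e]) => [/forall_inP a|/forall_inPn[e eE be]].
    rewrite big1 // => e _; rewrite /g; case: ifP => // /a.
    by move=> ->.
  by rewrite (bigD1 e) //= /g eE (negbTE be) mul0r.
rewrite Pm_prod [RHS]big_mkcond; apply: eq_bigr => e _; rewrite big_bool /= /g /bmu.
by case: (e \in Es) => /=; rewrite ?mulr0 ?mulr1 ?add0r // addrC subrK.
Qed.

End McDiarmid.

(** * Typical properties of the thinned graph *)

Section RandomGraph.
Variables (R : realFieldType) (V : finType) (r : {set V} -> R).
Hypothesis r01 : forall e, 0 <= r e <= 1.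

Definition joinedb (A : {set V}) beta (b : {ffun {set V} -> bool}) :=
  [forall XZ : {set V} * {set V},
    [&& XZ.1 \subset ~: A, XZ.2 \subset ~: A, [disjoint XZ.1 & XZ.2], #|XZ.1| == beta & #|XZ.2| == beta] ==>
    [exists x in XZ.1, exists z in XZ.2, b [set x; z]]].

(** Union bound over at most [4 ^ #|V|] pairs of sets, each needing [beta ^ 2] absent edges. For
    [beta] linear in [#|V|], an edge probability of a large constant over [#|V|] suffices. *)
Lemma joined_prob (A : {set V}) beta (r0 : R) : 0 <= r0 -> r0 <= 1 ->
  (forall x z, x \notin A -> z \notin A -> x != z -> r0 <= r [set x; z]) ->
  Pm (bmu r) (fun b => (~~ joinedb A beta b)%:R) <= 4 ^+ #|V| * (1 - r0) ^+ (beta ^ 2).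
Proof.
move=> r00 r01' hr.
have bp := bmu_pmf r01.
pose Q (XZ : {set V} * {set V}) :=
   [&& XZ.1 \subset ~: A, XZ.2 \subset ~: A, [disjoint XZ.1 & XZ.2], #|XZ.1| == beta & #|XZ.2| == beta].
pose Es (XZ : {set V} * {set V}) : {set {set V}} := [set [set p.1; p.2] | p in setX XZ.1 XZ.2].
apply: (@le_trans _ _ (Pm (bmu r) (fun b => \sum_(XZ | Q XZ) [forall e in Es XZ, ~~ b e]%:R))).
  apply: Pm_le => // b; case: (boolP (joinedb A beta b)) => [_|].
    by apply: sumr_ge0 => XZ _; case: [forall _ in _, _].
  case/forallPn=> XZ; rewrite negb_imply -/(Q XZ) => /andP[QX /existsPn nx].
  rewrite (bigD1 XZ) //= (_ : [forall e in Es XZ, ~~ b e]).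
    by rewrite -[leLHS]addr0 lerD2l; apply: sumr_ge0 => ? _; case: [forall _ in _, _].
  apply/forall_inP => _ /imsetP[[x z] + ->] /=; rewrite inE /= => /andP[xX zZ].
  have := nx x; rewrite xX /= => /existsPn/(_ z); by rewrite zZ.
rewrite Pm_sum.
apply: (@le_trans _ _ (\sum_(XZ : {set V} * {set V}) (1 - r0) ^+ (beta ^ 2))); last first.
  rewrite sumr_const card_prod -!cardsT -!powersetT !card_powerset cardsT -expnMn -[leLHS]mulr_natl natrX.
  by [].
rewrite big_mkcond; apply: ler_sum => XZ _; case: ifP => [/and5P[X1 X2 dX /eqP c1 /eqP c2]|_]; last first.
  by rewrite exprn_ge0 // subr_ge0.
have inA x (S : {set V}) : S \subset ~: A -> x \in S -> x \notin A by move=> /subsetP h /h; rewrite inE.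
have dx x z : x \in XZ.1 -> z \in XZ.2 -> x != z.
  move=> xX zZ; apply: contraTneq zZ => <-; move: dX; rewrite disjoint_subset => /subsetP/(_ x xX).
  by rewrite inE.
have cE : #|Es XZ| = (beta ^ 2)%N.
  rewrite card_in_imset ?cardsX ?c1 ?c2 ?mulnn //.
  move=> [x z] [x' z'] /=; rewrite !inE /= => /andP[a1 a2] /andP[a3 a4] e.
  have := set21 x z; rewrite e !inE => /orP[/eqP ex|/eqP ex]; last first.
    by have := dx _ _ a1 a4; rewrite ex eqxx.
  have := set22 x z; rewrite e !inE => /orP[/eqP ez|/eqP ez].
    by have := dx _ _ a3 a2; rewrite ez eqxx.
  by rewrite ex ez.
rewrite bmu_absent // -cE -prodr_const; apply: ler_prod => e /imsetP[[x z]]; rewrite inE /= => /andP[xX zZ] ->.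
have /andP[_ r1] := r01 [set x; z]; rewrite subr_ge0 r1 /= lerD2l lerN2.
by apply: hr; [apply: inA xX|apply: inA zZ|apply: dx].
Qed.

(** This is [chernoff] with one edge per item and [Z = 2], whence the divisor 16. *)
Lemma nbrs_prob (v : V) (S : {set V}) : (forall y, y \in S -> r [set v; y] = 2^-1) -> v \notin S ->
  Pm (bmu r) (fun b => (#|[set y in S | b [set v; y]]| <= #|S| %/ 16)%:R) <= (2^-1) ^+ (#|S| %/ 16).
Proof.
move=> hS vS; have bp := bmu_pmf r01.
pose Q : finType := {y | y \in S}.
pose ed (y : Q) (l : 'I_1) : {set V} := [set v; val y].
have edI : injective (fun p : Q * 'I_1 => ed p.1 p.2).
  move=> [y l] [y' l'] /= e; rewrite (ord1 l) (ord1 l'); congr (_, _); apply: val_inj.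
  have := set22 v (val y); rewrite -/(ed y l) e !inE => /orP[/eqP h|/eqP //].
  by have := valP y; rewrite h (negbTE vS).
have lt (y : Q) l : bmu r (ed y l) true = 2^-1 by rewrite /bmu hS // (valP y).
have := @chernoff R {set V} Q 1 (bmu r) 2^-1 ed bp edI lt 2 setT.
have cS : #|[set: Q]| = #|S| by rewrite cardsT card_sig; apply: eq_card => y; rewrite !inE.
rewrite cS expr1 => ch; apply: le_trans (ch _ _ _) => //; last by lra.
apply: Pm_le => // b; rewrite ler_nat (_ : #|[set y in S | b [set v; y]]| = #|[set q in [set: Q] | survives ed b q]|) //.
have -> : [set y in S | b [set v; y]] = val @: [set q in [set: Q] | survives ed b q].
  apply/setP => y; apply/idP/imsetP => [|[q]].
    rewrite inE => /andP[yS by']; exists (Sub y yS : Q) => //; rewrite !inE /=.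
    by apply/forallP => l; rewrite /ed /= .
  by rewrite !inE /= => /forallP/(_ ord0) h ->; rewrite (valP q).
by rewrite card_imset //; apply: val_inj.
Qed.

End RandomGraph.

(** * The perturbed graph as a product measure *)

Section Conversion.
Variables (R : realType) (V U : finType) (G0 : {set {set V}}) (T : {set {set U}}) (p : R) (m : nat).
Hypothesis p0 : 0 <= p.
Hypothesis p1 : p <= 1.
Hypothesis m0 : (0 < m)%N.

Definition edge_prob (e : {set V}) : R := if e \in G0 then 1 else if e \in vpairs V then p else 0.

(** The event [has_rainbow_copy] for a colouring encoded as a function on all vertex sets, with
    [None] for absent edges: the index set of a product measure cannot depend on the random
    graph. *)
Definition coloured_copy (f : {ffun {set V} -> option 'I_m}) :=
  [exists phi : {ffun U -> V}, [&& injectiveb phi, [forall e in image_graph phi T, f e != None] &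
    [forall e in image_graph phi T, forall e' in image_graph phi T, (f e == f e') ==> (e == e')]]].

(** Colourings of [E] inject into the encoded ones by [h], with equal weights, and functions outside
    the image have weight 0. *)
Lemma colouring_prob_ge (E : {set {set V}}) :
  Pm (fun e v => if e \in E then (if v is Some c then m%:R^-1 else 0) else (v == None)%:R : R)
    (fun f => (coloured_copy f)%:R) <= colouring_prob R (fun c : colouring E m => has_rainbow_copy T c).
Proof.
pose h (c : colouring E m) : {ffun {set V} -> option 'I_m} :=
  [ffun e => if insub e is Some e' then Some (c e') else None].
have hin c (e : {set V}) (eE : e \in E) : h c e = Some (c (Sub e eE)).
  by rewrite ffunE insubT.
have hval c (e : edge E) : h c (val e) = Some (c e) by rewrite ffunE valK.
have hout c e : e \notin E -> h c e = None by move=> eE; rewrite ffunE insubN.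
have hinj : injective h.
  move=> c c' e; apply/ffunP => x; have := congr1 (fun f : {ffun _} => f (val x)) e.
  by rewrite !hval => -[].
pose i0 : 'I_m := Ordinal m0.
rewrite /Pm (bigID (mem (h @: [set: colouring E m]))) /= [X in _ + X]big1 ?addr0; last first.
  move=> f nf; apply/eqP; rewrite mulf_eq0; apply/orP; left; apply/negPn/negP => w0.
  case/negP: nf; have w e : (if e \in E then (if f e is Some c then m%:R^-1 else 0) else (f e == None)%:R) != 0 :> R.
    by have /prodf_neq0/(_ e isT) := w0.
  apply/imsetP; exists [ffun e : edge E => odflt i0 (f (val e))]; rewrite ?inE //.
  apply/ffunP => e; have := w e; case: (boolP (e \in E)) => eE.
    by rewrite hin ffunE /=; case: (f e) => //; rewrite eqxx.
  by rewrite hout //; case: (f e) => //=; rewrite eqxx.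
rewrite big_imset /=; last by move=> c c' _ _; apply: hinj.
rewrite /colouring_prob [X in _ <= X]big_mkcond /=; rewrite [X in X <= _](eq_bigl predT); last by move=> c; rewrite inE.
apply: ler_sum => c _.
have -> : \prod_(j : {set V}) (if j \in E then (if h c j is Some _ then m%:R^-1 else 0) else (h c j == None)%:R) = \prod_(e : edge E) m%:R^-1 :> R.
  rewrite [RHS]prodr_const card_sig -prodr_const [RHS]big_mkcond; apply: eq_bigr => e _; rewrite inE.
  by case: (boolP (e \in E)) => eE; [rewrite hin | rewrite hout].
case: (boolP (coloured_copy _)) => [/existsP[phi /and3P[pi pE pr]]|_]; last first.
  by rewrite mulr0; case: ifP => // _; apply: prodr_ge0 => e _; rewrite invr_ge0.
rewrite mulr1 ifT //; apply/existsP; exists phi; rewrite pi /=; apply/andP; split.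
  apply/subsetP => e eI; have /forall_inP/(_ e eI) := pE.
  by apply: contraNT => eE; rewrite hout.
apply/dinjectiveP => x y; rewrite !inE => xI yI e.
have /forall_inP/(_ _ xI)/forall_inP/(_ _ yI) := pr; rewrite !hval e eqxx /=.
by move/eqP/val_inj.
Qed.

(** By [Pm_mixture] the random graph [H] is drawn first; given [H], exactly the members of
    [G0 :|: H] receive a colour. *)
Lemma perturbed_prob_ge q :
  Pm (cmu (m := m) edge_prob q setT) (fun f => (coloured_copy f)%:R) <=
  perturbed_prob G0 p (fun E (c : colouring E m) => has_rainbow_copy T c).
Proof.
pose r e : R := if e \in vpairs V then p else 0.
pose nu (b : bool) (e : {set V}) (v : option 'I_m) : R :=
  if (e \in G0) || b then (if v is Some c then m%:R^-1 else 0) else (v == None)%:R.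
rewrite (@Pm_mixture R _ _ _ (cmu (m := m) edge_prob q setT) (bmu r) nu); last first.
  move=> e v; rewrite big_bool /= /nu /bmu /cmu in_setT /edge_prob -/(r e).
  case: (boolP (e \in G0)) => eG /=.
    by case: v => [c|]; rewrite ?mulr0 ?addr0 ?subrr // -mulrDl [r e + _]addrC subrK.
  rewrite -/(r e); case: v => [c|] /=; first by rewrite mulr0 addr0.
  by rewrite mulr0 add0r mulr1.
rewrite {1}/Pm /perturbed_prob.
have r01 e : 0 <= r e <= 1 by rewrite /r; case: ifP => _; rewrite ?p0 ?p1 ?lexx ?ler01.
pose hb (H : {set {set V}}) : {ffun {set V} -> bool} := [ffun e => e \in H].
have hbi : bijective hb.
  exists (fun b : {ffun {set V} -> bool} => [set e | b e]) => [H|b].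
    by apply/setP => e; rewrite inE ffunE.
  by apply/ffunP => e; rewrite ffunE inE.
rewrite (reindex hb) /=; last by apply: onW_bij.
rewrite [leRHS]big_mkcond /=; apply: ler_sum => H _.
case: ifP => gH; last first.
  have /subsetPn[e eH eV] : ~~ (H \subset vpairs V) by rewrite -/(is_graph H) gH.
  by rewrite (bigD1 e) //= /bmu ffunE eH /r (negbTE eV) !mul0r.
have -> : \prod_j bmu r j (hb H j) = gnp_mass p H.
  rewrite /gnp_mass [RHS]big_mkcond; apply: eq_bigr => e _; rewrite /bmu ffunE /r.
  case: (boolP (e \in vpairs V)) => // eV; rewrite ifN ?subr0 //.
  by apply: contra eV; apply: (subsetP gH).
apply: ler_wpM2l.
  by apply: prodr_ge0 => e _; case: ifP => _; rewrite ?subr_ge0.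
apply: le_trans (colouring_prob_ge (G0 :|: H)).
rewrite le_eqVlt; apply/orP; left; apply/eqP; rewrite /Pm; apply: eq_bigr => f _; congr (_ * _).
by apply: eq_bigr => e _; rewrite /nu ffunE inE.
Qed.

End Conversion.

(** * Almost spanning structures and their completion *)

Local Close Scope ring_scope.

Section Structure.
Variables (U V : finType) (T : {set {set U}}) (m s D : nat).
Variables (hub : 'I_s -> U) (nb : 'I_s -> 'I_D -> U) (a : 'I_s -> 'I_D -> V) (B Zs : {set V}).

Definition Aset : {set V} := [set a p.1 p.2 | p : 'I_s * 'I_D].
Definition hubs : {set U} := [set hub i | i : 'I_s].
(* the pairs whose state is used in the first phase *)
Definition Omega : {set {set V}} :=
  [set e : {set V} | (#|e| == 2) && ([disjoint e & Aset] || ~~ [disjoint e & Zs])].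
Definition TE : {set {set U}} := [set e in T | [disjoint e & hubs]].

(** Only the values off the hubs matter. That uncovered vertices lie in [B] ensures that the second
    phase needs no pairs other than those from tuples to [B]. *)
Definition is_structure (phi : {ffun U -> V}) :=
  [&& dinjectiveb phi (mem (~: hubs)), [forall i, forall l, phi (nb i l) == a i l],
      [forall x, (x \in phi @: (~: hubs)) || (x \in B)] & [forall e in TE, phi @: (e : {set U}) \in Omega]].

Definition structure := {phi : {ffun U -> V} | is_structure phi}.
Definition St (y : structure) : {set {set V}} := [set (val y) @: (e : {set U}) | e in TE].

Hypothesis hub_inj : injective hub.
Hypothesis nbI : forall i l, nb i l \notin hubs.
Hypothesis TI : forall e, e \in T -> ~~ [disjoint e & hubs] -> exists i l, e = [set hub i; nb i l].
Hypothesis a_inj : injective (fun p : 'I_s * 'I_D => a p.1 p.2).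
Hypothesis aB : forall i l, a i l \notin B.
Hypothesis aZ : forall i l, a i l \notin Zs.
Hypothesis BZ : [disjoint B & Zs].

Lemma St_Omega y e : e \in St y -> e \in Omega.
Proof. by case/imsetP=> e' eT ->; have /and4P[_ _ _ /forall_inP] := valP y; apply. Qed.

Lemma ed_notOmega i l x : x \in B -> [set a i l; x] \notin Omega.
Proof.
move=> xB; rewrite inE negb_and negb_or negbK; apply/orP; right; apply/andP; split.
  have aA : a i l \in Aset by apply/imsetP; exists (i, l).
  by apply/negP => /disjointFr/(_ (set21 _ _)); rewrite aA.
rewrite disjoint_subset; apply/subsetP => z; rewrite !inE => /orP[] /eqP->; first exact: aZ.
by apply/negP => xZ; have := disjointFr BZ xB; rewrite xZ.
Qed.

(** [f] and [g] are independent samples; the merged one reads [Omega] from [f] and everything else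
    from [g]. The structure lives inside [Omega], the edges at the hubs outside it, and the colours
    in [K] keep the two parts apart. *)
Lemma mrg_copy (f g : {ffun {set V} -> option 'I_m}) (y : structure) (K : {set option 'I_m})
  (r : 'I_s -> V) (t : {perm 'I_s}) :
  rainbow_in St setT f y -> injective r -> (forall j, r j \notin val y @: (~: hubs)) -> (forall j, r j \in B) ->
  None \notin K -> (forall e, e \in St y -> f e \notin K) ->
  rainbow_on K (medges (fun i j l => [set a i l; r j]) t) g ->
  coloured_copy T (mrg [predC Omega] f g).
Proof.
move=> /andP[/forall_inP fN /forall_inP fI] rI rim rB NK fK /andP[/forall_inP gK /dinjectiveP gI].
have /and4P[/dinjectiveP pI /forallP pN _ _] := valP y.
set phi := val y in rim pI pN.
pose F : {ffun U -> V} := [ffun u => if [pick i | hub i == u] is Some i then r (t i) else phi u].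
have Fh i : F (hub i) = r (t i).
  rewrite ffunE; case: pickP => [j /eqP/hub_inj -> //|/(_ i)]; by rewrite eqxx.
have Fn u : u \notin hubs -> F u = phi u.
  move=> uI; rewrite ffunE; case: pickP => // i /eqP e; case/negP: uI; rewrite -e; exact: imset_f.
have hubP u : u \in hubs -> exists i, u = hub i by case/imsetP=> i _ ->; exists i.
pose ed i j l : {set V} := [set a i l; r j].
have cases e : e \in image_graph F T -> (e \in St y /\ mrg [predC Omega] f g e = f e) \/
   (e \in medges ed t /\ mrg [predC Omega] f g e = g e).
  case/imsetP=> e' eT ->; case: (boolP [disjoint e' & hubs]) => dj.
    left; have -> : F @: e' = phi @: e'.
      apply: eq_in_imset => u ue; apply: Fn; apply/negP => uI.
      by have := disjointFr dj ue; rewrite uI.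
    have eS : phi @: e' \in St y by apply: imset_f; rewrite inE eT.
    by split=> //; rewrite ffunE inE /= (St_Omega eS).
  right; have [i [l ->]] := TI eT dj.
  have -> : F @: [set hub i; nb i l] = ed i (t i) l.
    rewrite imsetU !imset_set1 Fh Fn // /ed setUC; congr (_ |: _).
    by have /forallP/(_ l)/eqP -> := pN i.
  split; first by apply/imsetP; exists (i, l).
  by rewrite ffunE inE /= ed_notOmega.
apply/existsP; exists F; apply/and3P; split.
- apply/injectiveP => u v e.
  case: (boolP (u \in hubs)) => [/hubP[i ei]|uI]; case: (boolP (v \in hubs)) => [/hubP[j ej]|vI].
  + by move: e; rewrite ei ej !Fh => /rI/perm_inj ->.
  + move: e; rewrite ei Fh (Fn v) // => e; have := rim (t i); rewrite e imset_f //.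
    by rewrite inE.
  + move: e; rewrite ej Fh (Fn u) // => e; have := rim (t j); rewrite -e imset_f //.
    by rewrite inE.
  by move: e; rewrite !Fn // => e; apply: pI; rewrite ?inE.
- apply/forall_inP => e /cases[[eS ->]|[eM ->]]; first exact: fN.
  by apply: contraNneq NK => <-; apply: gK.
apply/forall_inP => e /cases ce; apply/forall_inP => e' /cases ce'; apply/implyP => /eqP.
case: ce => -[eS ->]; case: ce' => -[eS' ->] ee.
- have := fI e; rewrite !inE eS => /(_ isT)/forall_inP/(_ e'); rewrite !inE eS' => /(_ isT).
  by rewrite ee eqxx.
- by have := fK _ eS; rewrite ee gK.
- by have := fK _ eS'; rewrite -ee gK.
by apply/eqP; apply: gI.
Qed.

Hypothesis cUV : #|U| = #|V|.

Lemma leftover_enum (y : structure) : exists r : 'I_s -> V,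
  [/\ injective r, (forall j, r j \notin val y @: (~: hubs)) & (forall j, r j \in B)].
Proof.
have /and4P[/dinjectiveP pI _ /forallP pB _] := valP y.
pose L := ~: (val y @: (~: hubs)).
have cL : #|L| = s.
  have := cardsC (val y @: (~: hubs)); rewrite -/L card_in_imset //.
  have := cardsC hubs; rewrite card_imset // card_ord; move: cUV; clear; lia.
exists (fun j => enum_val (cast_ord (esym cL) j)); split=> [i j /enum_val_inj/cast_ord_inj //|j|j].
  by have := enum_valP (cast_ord (esym cL) j); rewrite inE.
have := enum_valP (cast_ord (esym cL) j); rewrite inE => h.
by have := pB (enum_val (cast_ord (esym cL) j)); rewrite (negbTE h).
Qed.

Lemma card_St y : #|St y| <= #|TE|.
Proof. exact: leq_imset_card. Qed.

Lemma unused_colours (f : {ffun {set V} -> option 'I_m}) (y : structure) :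
  #|TE| + s * D <= m -> exists K : {set option 'I_m},
  [/\ #|K| = s * D, None \notin K & forall e, e \in St y -> f e \notin K].
Proof.
move=> h; have [|K sK cK] := @subset_card _ ([set Some c | c : 'I_m] :\: f @: St y) (s * D) _.
  rewrite cardsD card_imset ?card_ord; last by move=> ? ? [].
  have : #|[set Some c | c : 'I_m] :&: f @: St y| <= #|TE|.
    apply: leq_trans (card_St y); apply: leq_trans (leq_imset_card f _).
    by rewrite subset_leq_card // subsetIr.
  by move: h; clear; lia.
exists K; split=> //.
  by apply/negP => /(subsetP sK); rewrite inE => /andP[_ /imsetP[]].
by move=> e eS; apply/negP => /(subsetP sK); rewrite inE imset_f.
Qed.

(** Each vertex of [Zs] carries at most one vertex of the tree, which has at most [d] edges. *)
Lemma card_St_touch y d : (forall u, degree T u <= d) -> is_graph T ->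
  #|St y :&: [set e : {set V} | ~~ [disjoint e & Zs]]| <= d * #|Zs|.
Proof.
move=> deg gT; have /and4P[/dinjectiveP pI _ _ _] := valP y.
set phi := val y in pI *.
pose Uz := [set u in ~: hubs | phi u \in Zs].
have cUz : #|Uz| <= #|Zs|.
  rewrite -(card_in_imset (f := phi) (D := mem Uz)).
    by apply: subset_leq_card; apply/subsetP => _ /imsetP[u + ->]; rewrite inE => /andP[].
  by move=> u v; rewrite !inE => /andP[a1 _] /andP[b1 _]; apply: pI; rewrite inE.
pose EE := \bigcup_(u in Uz) [set [set u; v] | v in [set v | adj T u v]].
have sub : St y :&: [set e : {set V} | ~~ [disjoint e & Zs]] \subset (fun e : {set U} => phi @: e) @: EE.
  apply/subsetP => e; rewrite inE => /andP[/imsetP[e' + ->]]; rewrite !inE => /andP[eT dj].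
  rewrite -setI_eq0 => /set0Pn[z]; rewrite inE => /andP[/imsetP[u ue ->] uZ].
  apply/imsetP; exists e' => //; apply/bigcupP; exists u.
    by rewrite !inE uZ andbT; apply/negP => uI; have := disjointFr dj ue; rewrite uI.
  have := subsetP gT _ eT; rewrite inE => /cards2P[x [x' [xx ee]]].
  move: ue; rewrite ee !inE => /orP[] /eqP ->; apply/imsetP.
    by exists x'; rewrite // inE /adj -ee.
  by exists x; [rewrite inE /adj setUC -ee | rewrite setUC].
apply: leq_trans (subset_leq_card sub) _; apply: leq_trans (leq_imset_card _ _) _.
apply: leq_trans (card_bigcup_le _ _) _.
apply: (@leq_trans (\sum_(u in Uz) d)); last by rewrite sum_nat_const mulnC leq_mul2l cUz orbT.
by apply: leq_sum => u _; apply: leq_trans (leq_imset_card _ _) (deg u).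
Qed.

End Structure.

Local Open Scope ring_scope.

(** * Combining the two phases *)

Section TwoPhases.
Variables (R : realType) (U V : finType) (T : {set {set U}}) (G0 : {set {set V}}) (p : R) (m s D d : nat).
Variables (hub : 'I_s -> U) (nb : 'I_s -> 'I_D -> U) (a : 'I_s -> 'I_D -> V) (B Zs : {set V}).
Notation Omega := (Omega a Zs).
Notation structure := (structure T hub nb a B Zs).
Notation St := (@St U V T s D hub nb a B Zs).

(* Edges touching the reserves are few in a structure, so colouring them only costs a factor 2. *)
Definition thin_prob (e : {set V}) : R :=
  if e \in Omega then (if (e \in G0) && ~~ [disjoint e & Zs] then 2^-1 else (s * D)%:R / m%:R * p) else 0.

Hypothesis m0 : (0 < m)%N.
Hypothesis p0 : 0 <= p.
Hypothesis p1 : p <= 1.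
Hypothesis sDm : (s * D <= m)%N.

Let zeta1 : (s * D)%:R / m%:R <= 1 :> R.
Proof. by rewrite ler_pdivrMr ?ltr0n // mul1r ler_nat. Qed.

Let zeta0 : 0 <= (s * D)%:R / m%:R :> R.
Proof. by rewrite divr_ge0. Qed.

Lemma edge_probP e : 0 <= edge_prob G0 p e <= 1.
Proof. by rewrite /edge_prob; case: ifP => _; [|case: ifP => _]; rewrite ?lexx ?ler01 ?p0 ?p1. Qed.

Lemma edge_prob_Omega e : e \in Omega -> p <= edge_prob G0 p e.
Proof. by rewrite inE /edge_prob => /andP[c _]; case: ifP => // _; rewrite inE c. Qed.

Lemma thin_prob_ge0 e : 0 <= thin_prob e.
Proof. by rewrite /thin_prob; case: ifP => // _; case: ifP => _; rewrite ?invr_ge0 // mulr_ge0. Qed.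

Lemma thin_prob_le e : thin_prob e <= edge_prob G0 p e.
Proof.
rewrite /thin_prob; case: ifP => eO; last by case/andP: (edge_probP e).
case: ifP => [/andP[eG _]|_]; first by rewrite /edge_prob eG; lra.
apply: le_trans (edge_prob_Omega eO); rewrite -[leRHS]mul1r; exact: ler_wpM2r.
Qed.

Lemma thin_prob01 e : 0 <= thin_prob e <= 1.
Proof.
rewrite thin_prob_ge0 /=; apply: le_trans (thin_prob_le e) _; by case/andP: (edge_probP e).
Qed.

Hypothesis gT : is_graph T.
Hypothesis degT : forall u, (degree T u <= d)%N.
Hypothesis hub_inj : injective hub.
Hypothesis nbI : forall i l, nb i l \notin hubs hub.
Hypothesis TI : forall e, e \in T -> ~~ [disjoint e & hubs hub] -> exists i l, e = [set hub i; nb i l].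
Hypothesis aZ : forall i l, a i l \notin Zs.
Hypothesis BZ : [disjoint B & Zs].
Hypothesis cUV : #|U| = #|V|.
Hypothesis cTE : (#|TE T hub| + s * D <= m)%N.
Hypothesis cZ : (2 * (d * #|Zs|) <= m)%N.
Hypothesis cZ2 : (s * D + d * #|Zs| <= m)%N.

Notation mu := (cmu (m := m) (edge_prob G0 p) thin_prob setT).

(** The sample is merged from two independent ones. Given a rainbow structure in the first, [Hfin]
    completes it from the second, for whichever vertices and colours are left. The first phase is
    the coupling with [k2 = m - s * D], a bound on the edges of a structure: the loss [(m - k2) / m]
    is the factor [s * D / m] of [thin_prob]. For pairs touching the reserves [k1 = d * #|Zs|] is at
    most [m / 2]. *)
Lemma two_phases (e1 e2 : R) (good : {ffun {set V} -> bool} -> bool) : e1 <= 1 ->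
  (forall b, good b -> exists y : structure, forall e, e \in St y -> b e) ->
  1 - e2 <= Pm (bmu thin_prob) (fun b => (good b)%:R) ->
  (forall (r : 'I_s -> V) (K : {set option 'I_m}), injective r -> (forall j, r j \in B) ->
     #|K| = (s * D)%N -> None \notin K ->
     1 - e1 <= Pm mu (fun g => [exists t : {perm 'I_s},
        rainbow_on K (medges (fun i j l => [set a i l; r j]) t) g]%:R)) ->
  (1 - e1) * (1 - e2) <= perturbed_prob G0 p (fun E (c : colouring E m) => has_rainbow_copy T c).
Proof.
move=> e11 Hgood Pgood Hfin.
have p01 e : edge_prob G0 p e <= 1 by case/andP: (edge_probP e).
have mup : is_pmf mu by exact: cmu_pmf m0 thin_prob_ge0 thin_prob_le p01 setT.
have mup0 : is_pmf (cmu (m := m) (edge_prob G0 p) thin_prob set0) by exact: cmu_pmf m0 thin_prob_ge0 thin_prob_le p01 set0.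
apply: le_trans (perturbed_prob_ge G0 T p0 p1 m0 thin_prob).
rewrite (Pm_merge mup [predC Omega]).
apply: (@le_trans _ _ (Pm mu (fun f => (1 - e1) * (has_rainbow St setT f)%:R))); last first.
  apply: Pm_le => // f; case: (boolP (has_rainbow St setT f)) => [/existsP[y oky]|_]; last first.
    by rewrite mulr0; apply: Pm_ge0.
  rewrite mulr1.
  have [r [rI rim rB]] := leftover_enum hub_inj cUV y.
  have [K [cK NK fK]] := unused_colours f y cTE.
  apply: le_trans (Hfin r K rI rB cK NK) _; apply: Pm_le => // g; rewrite ler_nat.
  case: (boolP [exists t, _]) => // /existsP[t rt].
  by rewrite (mrg_copy hub_inj nbI TI aZ BZ oky rI rim rB NK fK rt).
rewrite PmZ; apply: ler_wpM2l; first by rewrite subr_ge0.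
have mc := @mcdiarmid_coupling R {set V} structure St m (edge_prob G0 p) thin_prob m0 thin_prob_ge0 thin_prob_le p01
  [set e : {set V} | ~~ [disjoint e & Zs]] (d * #|Zs|) (m - s * D).
apply: le_trans (mc _ _ _ _ _ _).
- apply: le_trans Pgood _; rewrite -(Pm_presence (edge_prob G0 p) thin_prob m0).
  apply: Pm_le => // f; rewrite ler_nat; case: (boolP (good _)) => // /Hgood[y hy].
  rewrite (_ : has_rainbow St set0 f) //; apply/existsP; exists y; apply/andP; split.
    by apply/forall_inP => e /hy; rewrite ffunE.
  by apply/forall_inP => e; rewrite setI0 inE.
- by move=> y; apply: card_St_touch.
- by move=> y; have := card_St y; move: cTE; clear; lia.
- by move: cZ; clear; lia.
- by rewrite leq_subr.
- move=> e; rewrite inE => tZ; rewrite /thin_prob tZ andbT.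
  case: (boolP (e \in Omega)) => eO; last by rewrite mul0r mulr_ge0 //; case/andP: (edge_probP e).
  case: (boolP (e \in G0)) => eG.
    rewrite /edge_prob eG mul1r natrB; last by move: cZ; clear; lia.
    have : (2 * (d * #|Zs|))%:R <= m%:R :> R by rewrite ler_nat.
    by rewrite natrM; lra.
  rewrite mulrAC divfK ?pnatr_eq0 -?lt0n // mulrC; apply: ler_pM => //.
    exact: edge_prob_Omega.
  by rewrite ler_nat; move: cZ2; clear; lia.
move=> e; rewrite inE negbK => tZ; rewrite /thin_prob tZ andbF.
case: (boolP (e \in Omega)) => eO; last by rewrite mul0r mulr_ge0 //; case/andP: (edge_probP e).
rewrite mulrAC divfK ?pnatr_eq0 -?lt0n // mulrC; apply: ler_pM => //.
  exact: edge_prob_Omega.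
by rewrite ler_nat; move: sDm; clear; lia.
Qed.

End TwoPhases.

(** * From typical graphs to structures *)

Section GoodGraph.
Variables (R : realType) (U V : finType) (T : {set {set U}}) (G0 : {set {set V}}) (p : R) (m s D d s0 beta : nat).
Variables (par : U -> U) (dep pos : U -> nat) (Ct : {set U}) (cls : V -> nat).
Variables (hub : 'I_s -> U) (nb : 'I_s -> 'I_D -> U) (a : 'I_s -> 'I_D -> V).
Notation Cl := (Cl cls).
Definition Zs : {set V} := Cl 2 :|: Cl 3 :|: Cl 4.
Notation B := (Cl 1).
Notation I := (hubs hub).
Notation te := (te par dep).
Notation Omega := (Omega a Zs).

Definition nbrs0 x k := [set y in Cl k | adj G0 x y].

(** All that the embedding uses of the random choices. The index [k.+2] runs over the three
    reserves, classes 2, 3 and 4. *)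
Definition goodb (b : {ffun {set V} -> bool}) :=
  joinedb (Cl 0) beta b &&
  [forall x, forall k : 'I_3, #|nbrs0 x k.+2| %/ 16 < #|[set y in nbrs0 x k.+2 | b [set x; y]]|]%N.

Hypothesis gG0 : is_graph G0.
Hypothesis AE : Aset a = Cl 0.

Lemma goodb_prob t : (0 < m)%N -> 0 <= p -> p <= 1 -> (s * D <= m)%N ->
  (s * D)%:R / m%:R * p <= 2^-1 ->
  (forall x (k : 'I_3), t <= #|nbrs0 x k.+2| %/ 16)%N ->
  1 - (4 ^+ #|V| * (1 - (s * D)%:R / m%:R * p) ^+ (beta ^ 2) + (#|V| * 3)%:R * (2^-1) ^+ t) <=
  Pm (bmu (thin_prob G0 p m a Zs)) (fun b => (goodb b)%:R).
Proof.
move=> m0 p0 p1 sDm z2 ht; set r := thin_prob _ _ _ _ _.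
have r01 : forall e, 0 <= r e <= 1.
  move=> e; apply: thin_prob01 => //.
have bp := bmu_pmf r01.
pose bad x (k : 'I_3) (b : {ffun {set V} -> bool}) := (#|[set y in nbrs0 x k.+2 | b [set x; y]]| <= #|nbrs0 x k.+2| %/ 16)%N.
have h1 : 1 - Pm (bmu r) (fun b => (~~ goodb b)%:R) = Pm (bmu r) (fun b => (goodb b)%:R).
  apply/eqP; rewrite subr_eq -PmD; apply/eqP; rewrite -[LHS](Pm_cst bp); apply: Pm_ext => b.
  by case: (goodb b); rewrite ?addr0 ?add0r.
rewrite -h1 lerD2l lerN2.
apply: (@le_trans _ _ (Pm (bmu r) (fun b => (~~ joinedb (Cl 0) beta b)%:R + \sum_x \sum_(k < 3) (bad x k b)%:R))).
  apply: Pm_le => // b.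
  have sge : 0 <= \sum_x \sum_(k < 3) (bad x k b)%:R :> R by do 2![apply: sumr_ge0 => ? _].
  rewrite negb_and; case: (boolP (joinedb _ _ b)) => [_|_] /=; last by rewrite lerDl.
  rewrite add0r; case: (boolP [forall x, _]) => //= /forallPn[x /forallPn[k]]; rewrite -leqNgt => bk.
  rewrite (bigD1 x) //= (bigD1 k) //= [(bad x k b)](_ : _ = true) // -!addrA -[leLHS]addr0 lerD2l.
  by apply: addr_ge0; [apply: sumr_ge0 => ? _|do 2![apply: sumr_ge0 => ? _]].
rewrite PmD; apply: lerD.
  apply: joined_prob => //.
  - by rewrite mulr_ge0 // divr_ge0.
  - by apply: le_trans z2 _; lra.
  move=> x z; rewrite -AE => xA zA xz; rewrite /r /thin_prob.
  have -> : [set x; z] \in Omega.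
    rewrite inE cards2 xz /=; apply/orP; left; rewrite disjoint_subset; apply/subsetP => u.
    by rewrite !inE => /orP[] /eqP->.
  by case: ifP.
have -> : (#|V| * 3)%:R * 2^-1 ^+ t = \sum_(x : V) \sum_(k < 3) 2^-1 ^+ t :> R.
  by rewrite !sumr_const card_ord -mulrnA -[RHS]mulr_natl mulnC.
rewrite Pm_sum; apply: ler_sum => x _; rewrite Pm_sum; apply: ler_sum => k _.
apply: le_trans (nbrs_prob r01 _ _) _.
- move=> y; rewrite inE => /andP[yC xy]; rewrite /r /thin_prob.
  have nd : ~~ [disjoint [set x; y] & Zs].
    apply/negP => /disjointFr/(_ (set22 _ _)); rewrite !inE in yC *; move/eqP: yC => ->.
    by case: k => -[|[|[|]]].
  have -> : [set x; y] \in Omega.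
    by rewrite inE nd orbT andbT; have := subsetP gG0 _ xy; rewrite inE.
  by rewrite [_ \in G0]xy nd.
- rewrite inE /adj; apply/negP => /andP[_ h]; have := subsetP gG0 _ h.
  by rewrite inE setUid cards1.
apply: ler_wiXn2l; [lra|lra|exact: ht].
Qed.

Hypothesis teE : forall u v, te u v = adj T u v.
Hypothesis gT : is_graph T.
Hypothesis posN : forall v, is_child par dep v -> v \notin Ct -> pos (par v) = pos v.
Hypothesis posC : forall v, is_child par dep v -> v \in Ct -> (pos (par v) < pos v)%N.
Hypothesis degT : forall u, (degree T u <= d)%N.
Hypothesis piece_size : forall i, (#|[set u | pos u == i]| <= s0)%N.
Hypothesis beta0 : (0 < beta)%N.
Hypothesis cls7 : forall x, (cls x < 7)%N.

Variables (i1 i3 : nat) (Qa Qc : {set U}) (yq : U -> V) (g0 g1 g2 ell : nat).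
Notation sl := (s0 * (d.+1 * beta))%N.
Notation N1 := (N1 par dep I).
Notation late := (late pos i3).
Notation early := (early pos i1).
Hypothesis i13 : (i1 <= i3)%N.
Hypothesis Iearly : I \subset early.
Hypothesis Qaearly : Qa \subset early.
Hypothesis Qclate : Qc \subset late.
Hypothesis IQa : [disjoint I & Qa].
Hypothesis spotsE : spots par dep Ct (I :|: Qa).
Hypothesis spotsL : spots par dep Ct Qc.
Hypothesis hub_inj : injective hub.
Hypothesis nb_te : forall i l, te (hub i) (nb i l).
Hypothesis nb_all : forall i u, te (hub i) u -> exists l, u = nb i l.
Hypothesis nb_inj : forall i, injective (nb i).
Hypothesis a_inj : injective (fun p : 'I_s * 'I_D => a p.1 p.2).
Hypothesis yq_inj : {in Qa &, injective yq}.
Hypothesis yq_im : yq @: Qa = Cl 4 :|: Cl 5.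
Hypothesis deg0 : forall x, (g0 <= #|nbrs0 x 2| %/ 16)%N.
Hypothesis deg1 : forall x, (g1 <= #|nbrs0 x 3| %/ 16)%N.
Hypothesis deg2 : forall x, (g2 <= #|nbrs0 x 4| %/ 16)%N.
Hypothesis sUV : #|U| = #|V|.
Hypothesis count : (s + #|late| = #|B| + ell)%N.
Hypothesis cQc : #|Qc| = ell.
Hypothesis szB : (#|Qa| + sl <= #|B|)%N.
Hypothesis sz0 : (#|Ct| + d * (s * D) + d * #|Qa| + sl <= g0)%N.
Hypothesis szM0 : (#|early| + sl <= #|Cl 6|)%N.
Hypothesis sz1 : (#|Ct| + sl <= g1)%N.
Hypothesis szL : (#|Cl 3| + sl <= ell)%N.
Hypothesis sz2 : (#|Ct| + d * ell + sl <= g2)%N.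
Hypothesis szM2 : (#|late| + sl <= #|Cl 5|)%N.

Lemma nb_hubs i l : nb i l \notin I.
Proof.
apply/negP => h; have hi : hub i \in I :|: Qa by rewrite inE imset_f.
have hn : nb i l \in I :|: Qa by rewrite inE h.
have e := spotsE.2 _ _ _ hi hn (within2_step (nb_te i l)) (within2_refl _ _ _).
by have := nb_te i l; rewrite -e te_irr.
Qed.

Lemma nb_inj2 : injective (fun p : 'I_s * 'I_D => nb p.1 p.2).
Proof.
move=> [i l] [j l'] /= e.
have hi : hub i \in I :|: Qa by rewrite inE imset_f.
have hj : hub j \in I :|: Qa by rewrite inE imset_f.
have b1 := within2_step (nb_te i l); have b2 := within2_step (nb_te j l'); rewrite -e in b2.
have /hub_inj ij := spotsE.2 _ _ _ hi hj b1 b2.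
by move: e; rewrite -ij => /nb_inj ->.
Qed.

Lemma edges_at_hubs e : e \in T -> ~~ [disjoint e & I] -> exists i l, e = [set hub i; nb i l].
Proof.
move=> eT; rewrite -setI_eq0 => /set0Pn[u]; rewrite inE => /andP[ue /imsetP[i _ eu]].
have := subsetP gT _ eT; rewrite inE => /cards2P[x [y [xy ee]]].
have [w ew tw] : exists2 w, e = [set hub i; w] & te (hub i) w.
  move: ue; rewrite ee !inE -eu => /orP[] /eqP ux.
    by exists y; rewrite ?teE /adj ux -?ee.
  by exists x; rewrite ?teE /adj ux setUC -?ee.
by have [l el] := nb_all tw; exists i, l; rewrite ew el.
Qed.

Lemma N1E : N1 = [set nb p.1 p.2 | p : 'I_s * 'I_D].
Proof.
apply/setP => w; rewrite inE; apply/existsP/imsetP => [[q /andP[/imsetP[i _ ->] t]]|[[i l] _ ->]].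
  by have [l ->] := nb_all t; exists (i, l).
by exists (hub i); rewrite imset_f //= nb_te.
Qed.

Lemma cardTE : (#|TE T hub| + s * D <= #|T|)%N.
Proof.
pose E1 : {set {set U}} := [set [set hub p.1; nb p.1 p.2] | p : 'I_s * 'I_D].
have cE : #|E1| = (s * D)%N.
  rewrite card_imset ?card_prod ?card_ord // => -[i l] [j l'] /= e.
  apply: nb_inj2 => /=; have := set22 (hub i) (nb i l); rewrite e !inE => /orP[/eqP h|/eqP //].
  by have := nb_hubs i l; rewrite h imset_f.
rewrite -cE; have dj : [disjoint TE T hub & E1].
  rewrite disjoint_subset; apply/subsetP => e; rewrite !inE => /andP[_ dj]; apply/negP => /imsetP[[i l] _ ee].
  by have := disjointFr dj (x := hub i); rewrite ee set21 imset_f // => /(_ isT).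
rewrite -(cardsUI (TE T hub)) (_ : _ :&: E1 = set0) ?cards0 ?addn0; last by apply/eqP; rewrite setI_eq0.
apply: subset_leq_card; apply/subsetP => e; rewrite !inE => /orP[/andP[]//|/imsetP[[i l] _ ->]].
by have := nb_te i l; rewrite teE.
Qed.

(** [main_embedding] is applied to the present pairs of [Omega]. The restriction to [Omega] is free:
    the joined sets avoid the tuples, and reserve degrees come from pairs that touch [Zs]. *)
Lemma goodb_structure b : goodb b -> exists y : structure T hub nb a B Zs, forall e, e \in @St U V T s D hub nb a B Zs y -> b e.
Proof.
case/andP=> /forallP J /forallP Dg.
pose G x y := ([set x; y] \in Omega) && b [set x; y].
have Gsym : symmetric G by move=> x y; rewrite /G setUC.
(* Only the values on neighbours of hubs matter; [yq u] is an arbitrary default. *)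
pose phi0 u := if [pick p : 'I_s * 'I_D | nb p.1 p.2 == u] is Some p then a p.1 p.2 else yq u.
have phi0E i l : phi0 (nb i l) = a i l.
  rewrite /phi0; case: pickP => [q /eqP e|/(_ (i, l))]; last by rewrite eqxx.
  by have -> := nb_inj2 (e : nb q.1 q.2 = nb (i, l).1 (i, l).2).
have dg x (k : 'I_3) : (#|nbrs0 x k.+2| %/ 16 <= #|[set y in Cl k.+2 | G x y]|)%N.
  have /forallP/(_ k) h := Dg x; apply: leq_trans (ltnW h) _; apply: subset_leq_card.
  apply/subsetP => y; rewrite !inE => /andP[/andP[yC xy] bxy]; rewrite yC /= /G bxy andbT inE.
  have := subsetP gG0 _ xy; rewrite inE => -> /=; apply/orP; right.
  apply/negP => /disjointFr/(_ (set22 _ _)); rewrite !inE; move/eqP: yC => ->.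
  by case: (k) => -[|[|[|]]].
have [|||||||||phi [h1 h2 h3 h4]] := @main_embedding U V par dep pos Ct d s0 beta G cls posN posC _
  piece_size Gsym beta0 cls7 _ i1 i3 I Qa Qc phi0 yq g0 g1 g2 ell i13 Iearly Qaearly Qclate IQa spotsE spotsL
  _ _ yq_inj yq_im _ _ _ sUV _ cQc szB _ szM0 sz1 szL sz2 szM2.
- by move=> u; apply: leq_trans (degT u); apply: eq_leq; apply: eq_card => v; rewrite !inE teE.
- move=> X Z sX sZ dXZ cX cZ'.
  have [X' sX' cX'] := subset_card cX; have [Z' sZ' cZ''] := subset_card cZ'.
  have /implyP := J (X', Z'); rewrite /= cX' cZ'' !eqxx !andbT (subset_trans sX' sX) (subset_trans sZ' sZ) /=.
  move=> /(_ (disjointWl sX' (disjointWr sZ' dXZ)))/existsP[x /andP[xX /existsP[z /andP[zZ bxz]]]].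
  exists x, z; rewrite (subsetP sX' _ xX) (subsetP sZ' _ zZ) /G bxz andbT; split=> //.
  have xz : x != z.
    apply: contraTneq (subsetP sZ' _ zZ) => <-; by rewrite (disjointFr dXZ) // (subsetP sX').
  have xA := subsetP sX _ (subsetP sX' _ xX); have zA := subsetP sZ _ (subsetP sZ' _ zZ).
  rewrite inE cards2 xz AE /=; apply/orP; left; rewrite disjoint_subset; apply/subsetP => u.
  by rewrite [u \in [set x; z]]inE !inE => /orP[] /eqP ->; [move: xA|move: zA]; rewrite !inE.
- rewrite N1E => _ _ /imsetP[[i l] _ ->] /imsetP[[j l'] _ ->] /=; rewrite !phi0E => e.
  by have [-> ->] := a_inj (e : a (i, l).1 (i, l).2 = a (j, l').1 (j, l').2).
- rewrite N1E -AE -imset_comp; apply: eq_imset => -[i l] /=; exact: phi0E.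
- by move=> x; apply: leq_trans (deg0 x) (dg x ord0).
- by move=> x; apply: leq_trans (deg1 x) (dg x (Ordinal (isT : 1 < 3)%N)).
- by move=> x; apply: leq_trans (deg2 x) (dg x (Ordinal (isT : 2 < 3)%N)).
- by rewrite card_imset // card_ord.
- by rewrite N1E (card_imset _ nb_inj2) card_prod !card_ord.
have edge (e : {set U}) : e \in TE T hub -> (phi @: e \in Omega) && b (phi @: e).
  rewrite inE => /andP[eT dj].
  have := subsetP gT _ eT; rewrite inE => /cards2P[x [y [xy ee]]].
  have xI : x \notin I by rewrite (disjointFr dj) // ee set21.
  have yI : y \notin I by rewrite (disjointFr dj) // ee set22.
  by have := h3 x y xI yI; rewrite teE /adj -ee => /(_ eT); rewrite /G ee imsetU !imset_set1.
pose psi : {ffun U -> V} := finfun phi.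
have psiE (e : {set U}) : psi @: e = phi @: e by apply: eq_imset => u; rewrite ffunE.
have sp : is_structure T hub nb a B Zs psi.
  apply/and4P; split.
  - by apply/dinjectiveP => u v uI vI; rewrite !ffunE; apply: h2.
  - apply/forallP => i; apply/forallP => l; rewrite ffunE h1 ?phi0E ?eqxx // N1E.
    by apply/imsetP; exists (i, l).
  - apply/forallP => x; rewrite psiE; case: (boolP (x \in phi @: ~: I)) => //= /h4 e.
    by rewrite inE e.
  by apply/forall_inP => e /edge/andP[]; rewrite psiE.
by exists (Sub psi sp : structure T hub nb a B Zs) => _ /imsetP[e /edge/andP[_ be] ->]; rewrite SubK psiE.
Qed.

End GoodGraph.

Definition Lth (Ld D : nat) : nat := (2 * (2 * Ld) ^ D)%N.

(** The conclusion of [final_phase] for the compatibility graph, with [L0 = 16 * Lth] and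
    [L3 = 64 * Lth], so that [4 * L0 <= L3]. Naming it lets the threshold on [s] be chosen before
    [D] is known. *)
Definition final_ok (R : realType) (Ld LN D s : nat) (eps : R) : Prop :=
  forall (J S : finType) (K : {set S}) (mu : J -> S -> R) (m : nat)
    (comp : rel 'I_s) (ed : 'I_s -> 'I_s -> 'I_D -> J),
  is_pmf mu -> #|K| = (s * D)%N -> (s * D < m)%N -> (m <= 2 * LN * s)%N ->
  injective (fun p : ('I_s * 'I_s) * 'I_D => ed p.1.1 p.1.2 p.2) ->
  (forall i j l v, comp i j -> v \in K -> mu (ed i j l) v = m%:R^-1) ->
  (forall w, s <= 16 * Lth Ld D * \sum_x (comp w x : nat))%N ->
  (forall x, s <= 16 * Lth Ld D * \sum_w (comp w x : nat))%N ->
  (forall A X : {set 'I_s}, s <= 64 * Lth Ld D * #|A| -> s <= 64 * Lth Ld D * #|X| ->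
     s ^ 2 <= 2 * Lth Ld D * (64 * Lth Ld D) ^ 2 * ecard comp A X)%N ->
  1 - eps <= Pm mu (fun f => [exists t : {perm 'I_s},
     [forall i, comp i (t i)] && rainbow_on K (medges ed t) f]%:R).

Lemma degree_gt0 (U : finType) (T : {set {set U}}) u : is_tree T -> (1 < #|U|)%N -> (0 < degree T u)%N.
Proof.
move=> [_ _ con _] cU.
have [v vu] : exists v, v != u.
  have : (0 < #|[set~ u]|)%N by rewrite cardsC1; case: #|U| cU => [|[]].
  by case/card_gt0P=> v; rewrite !inE; exists v.
have /connectP[[|w p] /= pp e] := con u v; first by rewrite e eqxx in vu.
by case/andP: pp => uw _; apply/card_gt0P; exists w; rewrite inE.
Qed.

Lemma sum_bool_card (I : finType) (P : pred I) : (\sum_i (P i : nat))%N = #|[set i | P i]|.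
Proof.
by rewrite -sum1_card [RHS]big_mkcond; apply: eq_bigr => i _; rewrite inE; case: (P i).
Qed.

(** * Compatibility restricted to the leftover vertices *)

Section CompatibleDegrees.
Variables (V : finType) (G : rel V) (Ld D N s : nat) (a : 'I_N -> 'I_D -> V) (B : {set V}).
Hypothesis cB : #|B| = N.
Hypothesis row : (forall i, N <= 8 * Lth Ld D * #|[set w in B | [forall l, G (a i l) w]]|)%N.
Hypothesis col : (forall w : V, w \in B -> N <= 8 * Lth Ld D * #|[set i | [forall l, G (a i l) w]]|)%N.
Hypothesis bid : (forall (A' : {set 'I_N}) (B' : {set V}), B' \subset B ->
   N <= 128 * Lth Ld D * #|A'| -> N <= 128 * Lth Ld D * #|B'| ->
   #|A'| * #|B'| <= 2 * Lth Ld D * \sum_(i in A') \sum_(w in B') [forall l, G (a i l) w])%N.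
Hypothesis sN : (s <= N)%N.
Hypothesis few : (16 * Lth Ld D * (N - s) <= N)%N.
Hypothesis N2s : (N <= 2 * s)%N.
Variable r : 'I_s -> V.
Hypothesis r_inj : injective r.
Hypothesis rB : forall j, r j \in B.
Let wd := widen_ord sN.
Let comp (i j : 'I_s) := [forall l, G (a (wd i) l) (r j)].

(** Whichever [s] vertices of [B] are left over, a tuple loses at most [N - s] compatible ones, by
    [few] at most half of the guaranteed number. *)
Lemma comp_row i : (s <= 16 * Lth Ld D * \sum_j (comp i j : nat))%N.
Proof.
rewrite sum_bool_card.
have := row (wd i); set S := [set w in B | _] => h.
have : (#|S| <= #|[set j | comp i j]| + (N - s))%N.
  rewrite -(card_imset _ r_inj).
  have -> : (N - s = #|B :\: r @: setT|)%N.
    rewrite cardsDS; first by rewrite card_imset // cardsT card_ord cB.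
    by apply/subsetP => _ /imsetP[j _ ->].
  apply: leq_trans (leq_card_setU _ _); apply: subset_leq_card; apply/subsetP => w.
  rewrite !inE => /andP[wB cw]; rewrite wB andbT orbC; case: (boolP (w \in r @: setT)) => //= /imsetP[j _ e].
  by rewrite e imset_f // inE /comp -e.
move=> h2; have : (16 * Lth Ld D * #|S| <= 16 * Lth Ld D * (#|[set j | comp i j]| + (N - s)))%N by rewrite leq_mul2l h2 orbT.
rewrite mulnDr; move: few h sN; move: (16 * Lth Ld D * #|[set j | comp i j]|)%N => x.
have -> : (16 * Lth Ld D * #|S| = 2 * (8 * Lth Ld D * #|S|))%N by rewrite !mulnA.
by move: (8 * Lth Ld D * #|S|)%N (16 * Lth Ld D * (N - s))%N => y z; clear; lia.
Qed.

Lemma comp_col j : (s <= 16 * Lth Ld D * \sum_i (comp i j : nat))%N.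
Proof.
rewrite sum_bool_card.
have := col (rB j); set S := [set i | _] => h.
have wI : injective wd by move=> x y /(congr1 val) /= e; apply: val_inj.
have : (#|S| <= #|[set i | comp i j]| + (N - s))%N.
  rewrite -(card_imset _ wI).
  have -> : (N - s = #|~: (wd @: setT)|)%N.
    by rewrite cardsCs setCK card_imset // cardsT !card_ord.
  apply: leq_trans (leq_card_setU _ _); apply: subset_leq_card; apply/subsetP => w.
  rewrite !inE => cw; rewrite orbC; case: (boolP (w \in wd @: setT)) => //= /imsetP[i _ e].
  by rewrite e imset_f // inE /comp -e.
move=> h2; have : (16 * Lth Ld D * #|S| <= 16 * Lth Ld D * (#|[set i | comp i j]| + (N - s)))%N by rewrite leq_mul2l h2 orbT.
rewrite mulnDr; move: few h sN; move: (16 * Lth Ld D * #|[set i | comp i j]|)%N => x.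
have -> : (16 * Lth Ld D * #|S| = 2 * (8 * Lth Ld D * #|S|))%N by rewrite !mulnA.
by move: (8 * Lth Ld D * #|S|)%N (16 * Lth Ld D * (N - s))%N => y z; clear; lia.
Qed.

Lemma comp_bid (A X : {set 'I_s}) : (s <= 64 * Lth Ld D * #|A| -> s <= 64 * Lth Ld D * #|X| ->
   s ^ 2 <= 2 * Lth Ld D * (64 * Lth Ld D) ^ 2 * ecard comp A X)%N.
Proof.
move=> hA hX.
have wI : injective wd by move=> x y /(congr1 val) /= e; apply: val_inj.
have h128 c : (s <= 64 * Lth Ld D * c -> N <= 128 * Lth Ld D * c)%N.
  have -> : (128 * Lth Ld D * c = 2 * (64 * Lth Ld D * c))%N by rewrite !mulnA.
  by move: (64 * Lth Ld D * c)%N N2s; clear; lia.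
have := @bid (wd @: A) (r @: X); rewrite !card_imset // => /(_ _ (h128 _ hA) (h128 _ hX)) h.
have {h} : (#|A| * #|X| <= 2 * Lth Ld D * ecard comp A X)%N.
  have -> : ecard comp A X = (\sum_(i in wd @: A) \sum_(w in r @: X) [forall l, G (a i l) w])%N.
    rewrite big_imset /=; last by move=> ? ? _ _; apply: wI.
    by apply: eq_bigr => i _; rewrite big_imset //= => ? ? _ _; apply: r_inj.
  by apply: h; apply/subsetP => _ /imsetP[j _ ->].
have : (s * s <= (64 * Lth Ld D * #|A|) * (64 * Lth Ld D * #|X|))%N by apply: leq_mul.
rewrite -mulnn => h1 h2; apply: leq_trans h1 _.
have : ((64 * Lth Ld D) ^ 2 * (#|A| * #|X|) <= (64 * Lth Ld D) ^ 2 * (2 * Lth Ld D * ecard comp A X))%N.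
  by rewrite leq_mul2l h2 orbT.
rewrite -!mulnn; move: (64 * Lth Ld D)%N (2 * Lth Ld D)%N (ecard _ _ _) => u v e; clear; lia.
Qed.

End CompatibleDegrees.

(** * Choice of the parameters *)

Section Core.
Variables (R : realType) (d Ld Kd LN Cn Lt h w s0 cb t0 t1 t2 ell y3 g0 g1 g2 n : nat).
Notation sl := (s0 * (d.+1 * w))%N.
Notation z := (d + 1)%N.
Hypothesis d0 : (0 < d)%N.
Hypothesis Ld0 : (0 < Ld)%N.
Hypothesis Kd0 : (0 < Kd)%N.
Hypothesis h0 : (0 < h)%N.
Hypothesis w0 : (0 < w)%N.
Hypothesis s0E : s0 = (h * d ^ h)%N.
Hypothesis cbP : forall c, (c * h <= n + h -> c <= cb)%N.
Hypothesis KdP : (4 * (4 * Ld - 1) ^ Kd <= (4 * Ld) ^ Kd)%N.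
Hypothesis dsP : forall D, (0 < D <= d -> dense_structure_ratio Ld D Lt <= LN)%N.
Hypothesis nLN : (LN <= n)%N.
Hypothesis Lt1 : forall D, (0 < D <= d -> 4 * Ld * D <= Lt /\ 2 * (2 * Ld) ^ D * D <= Lt)%N.
Hypothesis g0E : (16 * Kd * g0 = t0)%N.
Hypothesis g1E : (16 * Kd * g1 = t1)%N.
Hypothesis g2E : (16 * Kd * g2 = t2)%N.
Hypothesis wg0 : (w <= g0)%N.
Hypothesis wg1 : (w <= g1)%N.
Hypothesis wg2 : (w <= g2)%N.
Hypothesis pw0 : (n ^ Kd < 2 ^ w)%N.
Hypothesis H1 : (cb + sl <= g1)%N.
Hypothesis H2 : (t1 + sl <= ell)%N.
Hypothesis H3 : (cb + d * ell + sl <= g2)%N.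
Hypothesis H4 : (z ^ 2 * cb + z ^ 4 * ell <= y3)%N.
Hypothesis H5 : (y3 + s0 + sl <= t2)%N.
Hypothesis HN : forall N, (n <= LN * N -> Cn * t2 <= N)%N.
Hypothesis Cn3 : (3 <= Cn)%N.
Hypothesis CnL : forall D, (0 < D <= d -> 16 * Lth Ld D <= Cn)%N.
Hypothesis HL : forall N, (Lt * N <= n ->
  [/\ cb + d * (d * N) + d * (2 * t2) + sl <= g0,
      2 * Ld * ((d + 1) * N + t0 + t1 + t2) <= n,
      n %/ 2 + s0 + sl + (d + 1) * N + t0 + t1 + 2 * t2 <= n,
      2 * (d * (t0 + t1 + t2)) + d * N < n &
      z ^ 2 * cb + z ^ 4 * (d * N + 2 * t2) <= n %/ 2])%N.

(** Everything is assembled here under purely numerical hypotheses. The order of choices matters: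
    [D] comes from the spots of the early part and determines the tuples, hence [N]; then the
    reserves are chosen off the tuples and [B], and only then the hubs among the spots of degree
    [D]. *)
Lemma rainbow_copy_bound (U : finType) (T : {set {set U}}) (G0 : {set {set 'I_n}}) (p e1 : R) :
  #|U| = n -> is_tree T -> (forall u, degree T u <= d)%N -> is_graph G0 ->
  (forall v, n <= Ld * degree G0 v)%N -> 0 <= p -> p <= 2^-1 -> e1 <= 1 ->
  (forall D s, (0 < D <= d)%N -> (n <= 2 * LN * s)%N -> final_ok Ld LN D s e1) ->
  exists D s, [/\ (0 < D)%N, (n <= 2 * LN * s)%N, (s * D <= n.-1)%N &
    (1 - e1) * (1 - (4 ^+ n * (1 - (s * D)%:R / n.-1%:R * p) ^+ (w ^ 2) + (n * 3)%:R * (2^-1) ^+ w)) <=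
    perturbed_prob G0 p (fun E (c : colouring E n.-1) => has_rainbow_copy T c)].
Proof.
move=> cU tree degT gG0 degG p0 p12 e11 FP.
have cV : #|'I_n| = n := card_ord n.
have n0 : (0 < n)%N by have := expn_gt0 2 w; move: pw0 (HL (N := 0)); rewrite muln0 => _ /(_ isT)[_ _ _]; lia.
have n1 : (1 < n)%N.
  have [_ _ + + _] := HL (N := 0) ltac:(by rewrite muln0).
  have := H5; have := g2E; have := wg2; clear -w0 Kd0 n0; nia.
have [_ _ Hx3 _ Hx5] := HL (N := 0) ltac:(by rewrite muln0).
have gT : is_graph T by case: tree.
have [|par [dep [pos [Ct [i1 [i3 [Se [Sl [[teE posN posC] [ps cC cT] [i13 hearly hlate] [sSe spe ne] [sSl spl nl]]]]]]]]]] :=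
   @tree_selection U T d h (n %/ 2) y3 tree degT d0 h0.
  rewrite cU -s0E; move: Hx3 H5 w0 n1; clear; move: (s0 * _)%N => x; lia.
rewrite -s0E in ps hearly hlate; rewrite cU in cC cT; have {}cC := cbP cC.
have ecN : (n %/ 2 <= #|early pos i1|)%N by case/andP: hearly.
(* The case [N = 0] of [HL] already gives enough spots for the pigeonhole on degrees; the full count
   [cSe] follows once [N] is known. *)
have Se0 : (d * 0 + 2 * t2 <= #|Se|)%N.
  move: Hx5 (leq_trans ecN ne) cC; have : (0 < z ^ 4)%N by rewrite expn_gt0 addn1.
  move: (z ^ 4)%N (z ^ 2)%N (#|Ct|) (#|Se|) => z4 z2 c S z40 h1 h2 h3.
  have h4 : (z2 * c <= z2 * cb)%N by rewrite leq_mul2l h3 orbT.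
  by rewrite muln0 in h1 *; rewrite -(leq_pmul2l z40); move: h1 h2 h4; move: (z2 * c)%N (z2 * cb)%N; clear; lia.
have t20 : (0 < t2)%N by move: g2E wg2 w0 Kd0; clear; nia.
have [||D [D0d cSD]] := @same_value_class U Se (degree T) d.
- by move=> u _; rewrite degT (degree_gt0 _ tree) // cU.
- by move: Se0 t20; clear; lia.
have /andP[D0 Dd] := D0d.
set SD := [set u in Se | _] in cSD.
have [LtD1 LtD2] := Lt1 D0d.
have Gsym : symmetric (adj G0) by move=> x y; rewrite /adj setUC.
have degG' (v : 'I_n) : (#|'I_n| <= Ld * #|[set x | adj G0 v x]|)%N by rewrite cV; apply: degG.
have [|N [a' [B [[a'I cB a'B nN LtN] [row col bid]]]]] := @dense_structure 'I_n (adj G0) Ld Gsym degG' D D0 Ld0 Lt _ LtD1 LtD2.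
  by rewrite cV; apply: leq_trans nLN; apply: dsP.
rewrite cV in nN LtN; rewrite -/(Lth Ld D) in row col bid.
have nN' : (n <= LN * N)%N by apply: leq_trans nN _; rewrite leq_mul2r dsP ?orbT.
have CN := HN nN'.
have [L1 L2 L3 L4 L5] := HL LtN.
set lt := #|late pos i3| in hlate nl.
have /andP[lt1 lt2] := hlate.
have ltt2 : (lt + sl <= t2)%N by move: lt2 H5; move: sl; clear; lia.
have ell_lt : (ell <= lt)%N.
  apply: leq_trans lt1; apply: leq_trans H4; apply: leq_trans (leq_addl _ _).
  by rewrite leq_pmull // expn_gt0 addn1.
(* Forced by [count]: exactly [ell] vertices outside [B] and classes 4, 5 must be uncovered before
   the late part. So [s] falls short of [N] by less than the size of the late part. *)
pose s := (N + ell - lt)%N.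
have sN : (s <= N)%N by rewrite /s; move: ell_lt; clear; lia.
have t2N : (t2 <= N)%N by apply: leq_trans CN; rewrite leq_pmull //; move: Cn3; clear; lia.
have Ns : (N - s <= t2)%N by rewrite /s; move: ltt2; clear; lia.
have Ns16 : (16 * Lth Ld D * (N - s) <= N)%N.
  by apply: leq_trans CN; apply: leq_mul => //; apply: CnL.
have Cn2 : (3 * t2 <= N)%N by apply: leq_trans CN; rewrite leq_mul2r Cn3 orbT.
have N2s : (N <= 2 * s)%N by move: Ns Cn2 sN; clear; lia.
have n2s : (n <= 2 * LN * s)%N.
  by apply: leq_trans nN' _; rewrite [(2 * LN)%N]mulnC -mulnA leq_mul2l N2s orbT.
pose wd := widen_ord sN.
have wI : injective wd by move=> x y /(congr1 val) /= e; apply: val_inj.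
pose a i l := a' (wd i) l.
have aI : injective (fun p : 'I_s * 'I_D => a p.1 p.2).
  move=> [i l] [j l'] /= e; have := @a'I (wd i, l) (wd j, l') e; by case=> /val_inj -> ->.
have cA : #|Aset a| = (s * D)%N by rewrite (card_imset _ aI) card_prod !card_ord.
have sDN : (s * D <= d * N)%N by rewrite mulnC; apply: leq_mul.
have AB x : x \in Aset a -> x \notin B by case/imsetP=> -[i l] _ ->; apply: a'B.
pose F0 := Aset a :|: B.
have cF0 : (#|F0| <= (d + 1) * N)%N.
  by apply: leq_trans (leq_card_setU _ _) _; rewrite cA cB mulnDl mul1n leq_add2r.
have pw t : (w <= t)%N -> (n ^ Kd < 2 ^ t)%N.
  by move=> wt; apply: leq_trans pw0 _; rewrite leq_exp2l.
have gt g t : (16 * Kd * g = t -> w <= g -> w <= t)%N.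
  by move=> <- wg; apply: leq_trans wg _; rewrite leq_pmull // muln_gt0.
have dom (F : {set 'I_n}) t : (2 * Ld * (#|F| + t) <= n)%N -> (w <= t)%N ->
  exists Y : {set 'I_n}, [/\ [disjoint Y & F], #|Y| = t & forall v, (t <= Kd * #|[set y in Y | adj G0 v y]|)%N].
  by move=> hF wt; apply: (dominating_set Gsym degG') => //; rewrite cV //; exact: pw.
have [||Z0 [dZ0 cZ0 hZ0]] := dom F0 t0.
- apply: leq_trans L2; rewrite leq_mul2l; apply/orP; right; move: cF0; clear; lia.
- exact: gt g0E wg0.
have [||Z1 [dZ1 cZ1 hZ1]] := dom (F0 :|: Z0) t1.
- apply: leq_trans L2; rewrite leq_mul2l; apply/orP; right.
  have := (leq_card_setU F0 Z0).1; move: cF0 cZ0; clear; lia.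
- exact: gt g1E wg1.
have [||Z2 [dZ2 cZ2 hZ2]] := dom (F0 :|: Z0 :|: Z1) t2.
- apply: leq_trans L2; rewrite leq_mul2l; apply/orP; right.
  have := (leq_card_setU F0 Z0).1; have := (leq_card_setU (F0 :|: Z0) Z1).1; move: cF0 cZ0 cZ1; clear; lia.
- exact: gt g2E wg2.
pose F3 := F0 :|: Z0 :|: Z1 :|: Z2.
have cF3 : (#|F3| <= (d + 1) * N + t0 + t1 + t2)%N.
  have := (leq_card_setU F0 Z0).1; have := (leq_card_setU (F0 :|: Z0) Z1).1.
  have := (leq_card_setU (F0 :|: Z0 :|: Z1) Z2).1; rewrite -/F3; move: cF0 cZ0 cZ1 cZ2; clear; lia.
(* Class 5 gets the size of class 4, so that [2 * t2] absorbing spots match the two classes. *)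
have [|M2 sM2 cM2] := @subset_card _ (~: F3) t2.
  have := cardsC F3; rewrite cV; move: cF3 L3; move: sl; clear; lia.
have inF3 x : x \in M2 -> x \notin F3 by move/(subsetP sM2); rewrite inE.
have dis (Y F : {set 'I_n}) x : [disjoint Y & F] -> x \in Y -> x \notin F by move=> dj xY; rewrite (disjointFr dj).
pose cls (x : 'I_n) := if x \in Aset a then 0%N else if x \in B then 1%N else if x \in Z0 then 2%N
  else if x \in Z1 then 3%N else if x \in Z2 then 4%N else if x \in M2 then 5%N else 6%N.
have cls7 x : (cls x < 7)%N by rewrite /cls; do 6![case: ifP => // _].
have C0 : Cl cls 0 = Aset a by apply/setP => x; rewrite inE /cls; do 6![case: (x \in _) => //].
have C1 : Cl cls 1 = B.
  apply/setP => x; rewrite inE /cls; case: (boolP (x \in Aset a)) => [/AB/negbTE -> //|_].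
  by do 5![case: (x \in _) => //].
have C2 : Cl cls 2 = Z0.
  apply/setP => x; rewrite inE /cls; case: (boolP (x \in Z0)) => [/(dis _ _ _ dZ0)|nx].
    by rewrite in_setU negb_or => /andP[/negbTE -> /negbTE ->].
  by rewrite ?(negbTE nx); do 5![case: (x \in _) => //].
have C3 : Cl cls 3 = Z1.
  apply/setP => x; rewrite inE /cls; case: (boolP (x \in Z1)) => [/(dis _ _ _ dZ1)|nx].
    by rewrite !in_setU !negb_or => /andP[/andP[/negbTE -> /negbTE ->] /negbTE ->].
  by rewrite ?(negbTE nx); do 5![case: (x \in _) => //].
have C4 : Cl cls 4 = Z2.
  apply/setP => x; rewrite inE /cls; case: (boolP (x \in Z2)) => [/(dis _ _ _ dZ2)|nx].
    by rewrite !in_setU !negb_or => /andP[/andP[/andP[/negbTE -> /negbTE ->] /negbTE ->] /negbTE ->].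
  by rewrite ?(negbTE nx); do 5![case: (x \in _) => //].
have C5 : Cl cls 5 = M2.
  apply/setP => x; rewrite inE /cls; case: (boolP (x \in M2)) => [/inF3|nx].
    by rewrite !in_setU !negb_or => /andP[/andP[/andP[/andP[/negbTE -> /negbTE ->] /negbTE ->] /negbTE ->] /negbTE ->].
  by rewrite ?(negbTE nx); do 5![case: (x \in _) => //].
have dC45 : [disjoint Cl cls 4 & Cl cls 5].
  by rewrite disjoint_subset; apply/subsetP => x; rewrite !inE => /eqP ->.
have c45 : #|Cl cls 4 :|: Cl cls 5| = (2 * t2)%N.
  have := cardsUI (Cl cls 4) (Cl cls 5); rewrite (_ : _ :&: _ = set0) ?cards0; last by apply/eqP; rewrite setI_eq0.
  by rewrite C4 C5 cZ2 cM2; clear; lia.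
have cZs : (#|Zs cls| <= t0 + t1 + t2)%N.
  rewrite /Zs C2 C3 C4; have := (leq_card_setU Z0 Z1).1; have := (leq_card_setU (Z0 :|: Z1) Z2).1.
  rewrite cZ0 cZ1 cZ2; move: (#|Z0 :|: Z1 :|: Z2|) (#|Z0 :|: Z1|) => x y; clear; lia.
have C6 : (n <= #|Cl cls 6| + ((d + 1) * N + t0 + t1 + 2 * t2))%N.
  apply: (@leq_trans #|[set: 'I_n]|); first by rewrite cardsT cV.
  have sub : [set: 'I_n] \subset Cl cls 6 :|: (F3 :|: M2).
    apply/subsetP => x _; rewrite !in_setU inE /cls.
    by do 6![case: (x \in _); rewrite ?orbT //].
  apply: leq_trans (subset_leq_card sub) _; apply: leq_trans (leq_card_setU _ _) _; rewrite leq_add2l.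
  apply: leq_trans (leq_card_setU _ _) _; rewrite cM2; move: cF3; clear; lia.
have cSe : (d * N + 2 * t2 <= #|Se|)%N.
  move: L5 (leq_trans ecN ne) cC; have : (0 < z ^ 4)%N by rewrite expn_gt0 addn1.
  move: (z ^ 4)%N (z ^ 2)%N (#|Ct|) (#|Se|) => z4 z2 c S z40 h1 h2 h3.
  have h4 : (z2 * c <= z2 * cb)%N by rewrite leq_mul2l h3 orbT.
  by rewrite -(leq_pmul2l z40); move: h1 h2 h4; move: (z2 * c)%N (z2 * cb)%N (d * N)%N; clear; lia.
have [|I0 sI0 cI0] := @subset_card _ SD s.
  apply: (leq_trans (sN)); rewrite -(leq_pmul2l d0); apply: leq_trans cSD.
  by apply: leq_trans cSe; rewrite leq_addr.
pose hub (i : 'I_s) : U := enum_val (cast_ord (esym cI0) i).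
have hI : injective hub by move=> i j /enum_val_inj/cast_ord_inj.
have hubsE : hubs hub = I0.
  apply/setP => u; apply/imsetP/idP => [[i _ ->]|uI]; first exact: enum_valP.
  by exists (cast_ord cI0 (enum_rank_in uI u)); rewrite // /hub cast_ordK enum_rankK_in.
have hubSD i : hub i \in SD by apply: (subsetP sI0); apply: enum_valP.
have sI0e : I0 \subset Se by apply: subset_trans sI0 _; apply/subsetP => u; rewrite inE => /andP[].
have [|Qa sQa cQa] := @subset_card _ (Se :\: I0) (2 * t2).
  rewrite cardsDS // cI0; move: cSe (sN) (leq_pmull N d0); clear; lia.
have [|Qc sQc cQc] := @subset_card _ Sl ell.
  move: (leq_trans lt1 nl) H4 cC; have : (0 < z ^ 4)%N by rewrite expn_gt0 addn1.
  move: (z ^ 4)%N (z ^ 2)%N (#|Ct|) (#|Sl|) => z4 z2 c S z40 h1 h2 h3.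
  have h4 : (z2 * c <= z2 * cb)%N by rewrite leq_mul2l h3 orbT.
  by rewrite -(leq_pmul2l z40); move: h1 h2 h4; move: (z2 * c)%N (z2 * cb)%N; clear; lia.
have Qae : #|Qa| = #|Cl cls 4 :|: Cl cls 5| by rewrite cQa c45.
have [yq [yqI yqE]] := card_set_bij (fun=> Ordinal n0) Qae.
have cNb i : #|[set v | te par dep (hub i) v]| = D.
  have := hubSD i; rewrite inE => /andP[_ /eqP <-]; apply: eq_card => v; by rewrite !inE teE.
pose nb i (l : 'I_D) : U := enum_val (cast_ord (esym (cNb i)) l).
have nb_te i l : te par dep (hub i) (nb i l).
  by have := enum_valP (cast_ord (esym (cNb i)) l); rewrite inE.
have nb_all i u : te par dep (hub i) u -> exists l, u = nb i l.
  move=> t; have uin : u \in [set v | te par dep (hub i) v] by rewrite inE.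
  by exists (cast_ord (cNb i) (enum_rank_in uin u)); rewrite /nb cast_ordK enum_rankK_in.
have nb_inj i : injective (nb i) by move=> l l' /enum_val_inj/cast_ord_inj.
have IQ : I0 :|: Qa \subset Se by rewrite subUset sI0e (subset_trans sQa (subsetDl _ _)).
have spIQ : spots par dep Ct (hubs hub :|: Qa) by rewrite hubsE; apply: spotsW IQ spe.
have Ie : hubs hub \subset early pos i1 by rewrite hubsE (subset_trans sI0e).
have Qe : Qa \subset early pos i1 by apply: subset_trans sQa (subset_trans (subsetDl _ _) sSe).
have Ql : Qc \subset late pos i3 by apply: subset_trans sQc sSl.
have dIQ : [disjoint hubs hub & Qa].
  rewrite hubsE disjoint_sym; rewrite disjoint_subset; apply/subsetP => u /(subsetP sQa).
  by rewrite !inE => /andP[].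
have spQc : spots par dep Ct Qc by apply: spotsW sQc spl.
have AE : Aset a = Cl cls 0 by rewrite C0.
have dgr t g (Z : {set 'I_n}) x : (16 * Kd * g = t -> t <= Kd * #|[set y in Z | adj G0 x y]| ->
    g <= #|[set y in Z | adj G0 x y]| %/ 16)%N.
  move=> <-; rewrite leq_divRL // [(16 * Kd)%N]mulnC -mulnA leq_pmul2l //; by rewrite mulnC.
have deg0 x : (g0 <= #|nbrs0 G0 cls x 2| %/ 16)%N by rewrite /nbrs0 C2; apply: dgr g0E (hZ0 x).
have deg1 x : (g1 <= #|nbrs0 G0 cls x 3| %/ 16)%N by rewrite /nbrs0 C3; apply: dgr g1E (hZ1 x).
have deg2 x : (g2 <= #|nbrs0 G0 cls x 4| %/ 16)%N by rewrite /nbrs0 C4; apply: dgr g2E (hZ2 x).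
have sUV : #|U| = #|'I_n| by rewrite cU cV.
have cnt : (s + #|late pos i3| = #|Cl cls 1| + ell)%N.
  by rewrite C1 cB -/lt /s; move: ltt2 t2N; move: sl; clear; lia.
have m0 : (0 < n.-1)%N by move: n1; clear; lia.
have p1 : p <= 1 by apply: le_trans p12 _; lra.
have sDm : (s * D < n.-1)%N.
  move: L4 sDN g2E wg2 w0 Kd0 t20 d0; clear; move: (s * D)%N (d * N)%N => x y.
  have := @leq_pmull; nia.
have sDm' := ltnW sDm.
exists D, s; split=> //.
have dZ : (2 * (d * #|Zs cls|) + d * N < n)%N.
  apply: leq_ltn_trans L4; rewrite leq_add2r !leq_mul2l cZs orbT; by rewrite orbT.
have hubsN : forall i l, nb i l \notin hubs hub.
  by move=> i l; apply: nb_hubs nb_te i l; exact: spIQ.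
have TI := @edges_at_hubs U T s D par dep hub nb teE gT nb_all.
have cTE := @cardTE U T s D par dep Ct hub nb teE Qa spIQ hI nb_te nb_inj.
have aZ i l : a i l \notin Zs cls.
  have : a i l \in Cl cls 0 by rewrite C0; apply/imsetP; exists (i, l).
  by rewrite !inE => /eqP ->.
have BZ : [disjoint Cl cls 1 & Zs cls].
  by rewrite disjoint_subset; apply/subsetP => x; rewrite !inE => /eqP ->.
apply: (@two_phases R U 'I_n T G0 p n.-1 s D d hub nb a (Cl cls 1) (Zs cls) m0 p0 p1 sDm' gT degT hI hubsN TI aZ BZ sUV
  _ _ _ e1 _ (goodb G0 w cls)) => //.
- by move: cTE cT; clear; lia.
- by move: dZ; move: (d * #|Zs cls|)%N (d * N)%N => x y; clear; lia.
- by move: dZ sDN; move: (d * #|Zs cls|)%N (d * N)%N (s * D)%N => x y u; clear; lia.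
- move=> b gb.
  apply: (@goodb_structure U 'I_n T G0 s D d s0 w par dep pos Ct cls hub nb a gG0 AE teE gT posN posC degT ps w0 cls7
    i1 i3 Qa Qc yq g0 g1 g2 ell i13 Ie Qe Ql dIQ spIQ spQc hI nb_te nb_all nb_inj aI yqI yqE deg0 deg1 deg2 sUV cnt cQc
    _ _ _ _ _ _ _ b gb).
  + rewrite C1 cB cQa; move: Cn2 ltt2; move: sl; clear; lia.
  + rewrite cQa; apply: leq_trans L1; rewrite !leq_add2r; apply: leq_add => //.
    by rewrite leq_mul2l sDN orbT.
  + have /andP[_ ee] := hearly; move: C6 L3 ee; move: sl (#|Cl cls 6|) (#|early pos i1|) ((d + 1) * N)%N (n %/ 2)%N => x y u v q; clear; lia.
  + by apply: leq_trans H1; rewrite leq_add2r.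
  + by rewrite C3 cZ1.
  + by apply: leq_trans H3; rewrite !leq_add2r.
  by rewrite C5 cM2.
- have := @goodb_prob R 'I_n G0 p n.-1 s D w cls a gG0 AE w m0 p0 p1 sDm'; rewrite cV; apply.
    rewrite -[leRHS]mul1r; apply: ler_pM => //; first by rewrite divr_ge0.
    by rewrite ler_pdivrMr ?ltr0n // mul1r ler_nat.
  by move=> x [[|[|[|//]]] ?] /=; [apply: leq_trans (deg0 x)|apply: leq_trans (deg1 x)|apply: leq_trans (deg2 x)].
move=> r K rI rB cK NK; rewrite C1 in rB.
pose comp (i j : 'I_s) := [forall l, adj G0 (a i l) (r j)].
pose ed i j l : {set 'I_n} := [set a i l; r j].
have aBf i l : a i l \notin B by apply: a'B.
have FPs := @FP D s D0d n2s {set 'I_n} (option 'I_n.-1) K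
   (cmu (m := n.-1) (edge_prob G0 p) (thin_prob G0 p n.-1 a (Zs cls)) setT) n.-1 comp ed.
apply: le_trans (FPs _ cK sDm _ _ _ _ _ _) _.
- by apply: cmu_pmf => // e; [exact: thin_prob_ge0|exact: thin_prob_le|case/andP: (edge_probP G0 p0 p1 e)].
- by apply: leq_trans n2s; rewrite leq_pred.
- move=> [[i j] l] [[i' j'] l'] /= e.
  have ai : a i l = a i' l'.
    have := set21 (a i l) (r j); rewrite -/(ed i j l) e !inE => /orP[/eqP //|/eqP h'].
    by have := aBf i l; rewrite h' rB.
  have rj : r j = r j'.
    have := set22 (a i l) (r j); rewrite -/(ed i j l) e !inE => /orP[/eqP h'|/eqP //].
    by have := aBf i' l'; rewrite -h' rB.
  by have [-> ->] := @aI (i, l) (i', l') ai; rewrite (rI _ _ rj).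
- move=> i j l [c|] cij vK; last by rewrite vK in NK.
  rewrite /cmu in_setT /edge_prob; have -> : ed i j l \in G0 by have /forallP := cij; apply.
  by rewrite mul1r.
- exact: (comp_row cB row sN Ns16 rI rB).
- exact: (comp_col col sN Ns16 rB).
- exact: (comp_bid bid sN N2s rI rB).
apply: Pm_le => [|g]; last first.
  rewrite ler_nat; case: (boolP [exists t, _]) => // /existsP[t /andP[_ rt]].
  by rewrite (_ : [exists t, _]) //; apply/existsP; exists t.
by apply: cmu_pmf => // e; [exact: thin_prob_ge0|exact: thin_prob_le|case/andP: (edge_probP G0 p0 p1 e)].
Qed.

End Core.

Local Close Scope ring_scope.

Lemma poly_lt_exp K c : 0 < K -> 0 < c -> exists w0, forall w, w0 <= w -> (c * w) ^ K < 2 ^ w.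
Proof.
move=> K0 c0; pose q := (4 * K * c) ^ K.
exists (2 * q + 2 * K) => w hw.
pose v := w %/ (2 * K).
have K2 : 0 < 2 * K by rewrite muln_gt0.
have hv : w < 2 * K * v.+1 by rewrite mulnC ltn_ceil.
have vw : 2 * K * v <= w by rewrite mulnC leq_divM.
have v0 : 0 < v by rewrite divn_gt0 //; apply: leq_trans hw; rewrite leq_addl.
have h1 : c * w <= 4 * K * c * 2 ^ v.
  apply: (@leq_trans (c * (2 * K * v.+1))); first by rewrite leq_mul2l ltnW ?orbT.
  have : v.+1 <= 2 * 2 ^ v by apply: leq_trans (_ : 2 ^ v <= _); rewrite ?leq_pmull // ltn_expl.
  move=> h; apply: (@leq_trans (c * (2 * K * (2 * 2 ^ v)))).
    by rewrite !leq_mul2l h !orbT.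
  by apply: eq_leq; move: (2 ^ v) => x; clear; lia.
apply: (@leq_ltn_trans (q * 2 ^ (v * K))).
  by apply: leq_trans (_ : (4 * K * c * 2 ^ v) ^ K <= _); rewrite ?leq_exp2r // expnMn -expnM.
have q2 : q < 2 ^ q by rewrite ltn_expl.
apply: (@leq_trans (2 ^ q * 2 ^ (v * K))); first by rewrite ltn_pmul2r ?expn_gt0.
rewrite -expnD leq_exp2l //.
have : 2 * (v * K) <= w by apply: leq_trans vw; rewrite mulnA [X in _ <= X]mulnAC.
by move: hw; move: (v * K) (q) => x y; clear; lia.
Qed.

(** * Verification of the numerical hypotheses *)

Section Constants.
Variables (d Ld Kd K0 Lt LN Cn h s0 Kq Kb : nat).
Notation z := (d + 1).
Hypothesis d0 : 0 < d.
Hypothesis Ld0 : 0 < Ld.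
Hypothesis KdE : Kd = 3 * (4 * Ld - 1).
Hypothesis K0E : K0 = 64 * d * Ld.
Hypothesis Lt_dense : 1024 * Kd * d * d * K0 * Ld * z ^ 5 <= Lt.
Hypothesis Lt_tuple : Lth Ld d * d <= Lt.
Hypothesis Lt_deg : 4 * Ld * d <= Lt.
Hypothesis LN0 : 0 < LN.
Hypothesis LN_ds : forall D, D <= d -> dense_structure_ratio Ld D Lt <= LN.
Hypothesis Cn0 : 3 <= Cn.
Hypothesis Cz : 128 * d * Kd * z ^ 4 <= Cn.
Hypothesis CL : 16 * Lth Ld d <= Cn.
Hypothesis hE : h = K0 * (LN * Cn * (1536 * Kd ^ 2 * z ^ 4)).
Hypothesis s0E : s0 = h * d ^ h.
Hypothesis KqE : Kq = s0 * z.
Hypothesis KbE : Kb = h * Kq.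

Let Kd0 : 0 < Kd. Proof. by rewrite KdE; clear -Ld0; lia. Qed.
Let K00 : 0 < K0. Proof. by rewrite K0E !muln_gt0 d0 Ld0. Qed.
Let z0 : 0 < z. Proof. by rewrite addn1. Qed.
Let h0 : 0 < h.
Proof.
have u0 : 0 < Kd ^ 2 by rewrite expn_gt0 Kd0.
have v0 : 0 < z ^ 4 by rewrite expn_gt0 z0.
rewrite hE; move: (Kd ^ 2) (z ^ 4) u0 v0 => u v u0 v0.
by rewrite !muln_gt0 K00 LN0 u0 v0 (leq_trans _ Cn0).
Qed.
Let s00 : 0 < s0. Proof. by rewrite s0E muln_gt0 h0 expn_gt0 d0. Qed.
Let Kq2 : 2 <= Kq.
Proof. by rewrite KqE; apply: (@leq_mul 1 2) => //; rewrite addn1. Qed.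
Let Kb0 : 0 < Kb. Proof. by rewrite KbE muln_gt0 h0; apply: leq_trans Kq2. Qed.

Let LthM D : D <= d -> Lth Ld D <= Lth Ld d.
Proof. by move=> h1; rewrite /Lth leq_mul2l leq_pexp2l // muln_gt0. Qed.

Let z4 : d + 1 <= z ^ 4. Proof. by rewrite -[X in X <= _]expn1 leq_pexp2l. Qed.
Let z24 : z ^ 2 <= z ^ 4. Proof. by rewrite leq_pexp2l. Qed.

(* every size below is a multiple of [Q], which also bounds the slack of one piece *)
Lemma rainbow_copy_bound_large (R : realType) n : Kb * Kb <= n -> n ^ Kd < 2 ^ (n %/ Kb) ->
  forall (U : finType) (T : {set {set U}}) (G0 : {set {set 'I_n}}) (p e1 : R),
  #|U| = n -> is_tree T -> (forall u, degree T u <= d) -> is_graph G0 ->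
  (forall v, n <= Ld * degree G0 v) -> (0 <= p)%R -> (p <= 2^-1)%R -> (e1 <= 1)%R ->
  (forall D s, 0 < D <= d -> n <= 2 * LN * s -> final_ok Ld LN D s e1) ->
  exists D s, [/\ 0 < D, n <= 2 * LN * s, s * D <= n.-1 &
    ((1 - e1) * (1 - (4 ^+ n * (1 - (s * D)%:R / n.-1%:R * p) ^+ ((n %/ Kb) ^ 2) + (n * 3)%:R * (2^-1) ^+ (n %/ Kb))) <=
    perturbed_prob G0 p (fun E (c : colouring E n.-1) => has_rainbow_copy T c))%R].
Proof.
move=> nK npw; have Kw : Kb <= n %/ Kb by rewrite leq_divRL.
have nlt : n < Kb * (n %/ Kb) + Kb by rewrite -mulnSr mulnC ltn_ceil.
have nge : Kb * (n %/ Kb) <= n by rewrite mulnC leq_divM.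
move: (n %/ Kb) npw Kw nlt nge => w npw Kw nlt nge.
have w0 : 0 < w by apply: leq_trans Kw.
have [Q QE] : exists Q, Q = Kq * w by eexists.
have [ell ellE] : exists x, x = 96 * Kd * Q by eexists.
have [X XE] : exists x, x = z ^ 4 * ell by eexists.
have [t2 t2E] : exists x, x = 16 * Kd * X by eexists.
have [t0 t0E] : exists x, x = LN * Cn * t2 by eexists.
have wQ : 2 * w <= Q by rewrite QE leq_mul2r Kq2 orbT.
have s0w : s0 <= w.
  apply: leq_trans Kw; rewrite KbE; apply: (@leq_trans Kq); last by rewrite leq_pmull.
  by rewrite KqE leq_pmulr.
(* The factor [1536 = 16 * 96] in [h] is made for this identity. Up to a remainder [w], [n] is thus
   [K0 * t0 = h * Q], so that the number of cut vertices, about [n / h], is below [2 * Q]. *)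
have KwE : Kb * w = K0 * t0.
  rewrite KbE hE t0E t2E XE ellE QE -!mulnn; move: (z ^ 4) => u; clear; lia.
have n1 : K0 * t0 <= n by rewrite -KwE.
have n2 : n <= K0 * t0 + w.
  by move: Kw nlt; rewrite KwE; move: (K0 * t0); clear; lia.
have ellQ : 96 * Q <= ell by rewrite ellE -mulnA leq_mul2l leq_pmull.
have Xell : (d + 1) * ell <= X by rewrite XE leq_mul2r z4 orbT.
have Xt2 : 16 * X <= t2 by rewrite t2E -mulnA leq_mul2l leq_pmull.
have LC : Cn <= LN * Cn by rewrite leq_pmull.
have t2t0 : Cn * t2 <= t0 by rewrite t0E leq_mul2r LC orbT.
have t2z : 128 * (z ^ 4 * t2) <= t0.
  apply: leq_trans t2t0; rewrite mulnA leq_mul2r; apply/orP; right; apply: leq_trans Cz.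
  by rewrite leq_mul2r; apply/orP; right; rewrite -mulnA leq_pmulr // muln_gt0 d0.
have t2t : 128 * t2 <= t0.
  by apply: leq_trans t2z; rewrite leq_mul2l leq_pmull // expn_gt0 z0.
have ellX : ell <= X by rewrite XE leq_pmull // expn_gt0 z0.
have w_le : w <= t0 by move: wQ ellQ ellX Xt2 t2t; clear; lia.
apply: (@rainbow_copy_bound R d Ld Kd LN Cn Lt h w s0 (2 * Q) t0 (48 * Kd * Q) t2 ell (2 * X) (LN * Cn * X) (3 * Q) X n) => //.
- move=> c hc; rewrite -(leq_pmul2r h0); apply: leq_trans hc _.
  apply: leq_trans (_ : K0 * t0 + w + h <= _); first by rewrite leq_add2r.
  have -> : K0 * t0 = Q * h by rewrite -KwE KbE QE; clear; lia.
  rewrite mul2n -addnn mulnDl -addnA leq_add2l.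
  apply: (@leq_trans (w * h + w * h)); first by apply: leq_add; rewrite ?leq_pmulr ?leq_pmull.
  by rewrite -mulnDl addnn -mul2n leq_mul2r wQ orbT.
(* With [c = 4 * Ld - 1], the choice [Kd = 3 * c] gives [4 * c ^ Kd <= (c + 1) ^ Kd]. *)
- rewrite KdE; have := pow_gap (4 * Ld - 1) (3 * (4 * Ld - 1)).
  have -> : 4 * Ld - 1 + 1 = 4 * Ld by clear -Ld0; lia.
  have c0 : 0 < 4 * Ld - 1 by clear -Ld0; lia.
  move: (4 * Ld - 1) c0 => c c0.
  have -> : c + 3 * c = 4 * c by clear; lia.
  by rewrite mulnA leq_pmul2r // mulnC.
- by move=> D /andP[_ Dd]; apply: LN_ds.
- apply: leq_trans n1; apply: (@leq_trans t0); last by rewrite leq_pmull.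
  rewrite t0E -mulnA leq_pmulr // muln_gt0 (leq_trans _ Cn0) //=.
  by move: Xt2 ellX ellQ wQ w0; clear; lia.
- move=> D /andP[D0 Dd]; split.
    by apply: leq_trans Lt_deg; rewrite leq_mul2l Dd orbT.
  by apply: leq_trans Lt_tuple; apply: leq_mul => //; apply: LthM.
- by rewrite t0E t2E; move: (LN * Cn) => u; clear; lia.
- by clear; lia.
- by apply: leq_trans (leq_pmull _ _); [move: wQ ellQ ellX; clear; lia|rewrite muln_gt0 LN0 (leq_trans _ Cn0)].
- by move: wQ; clear; lia.
- by move: wQ ellQ ellX; clear; lia.
- by rewrite QE KqE; clear; lia.
- have -> : s0 * (d.+1 * w) = Q by rewrite QE KqE; clear; lia.
  by rewrite ellE; move: (leq_pmull Q Kd0); rewrite -!mulnA; move: (Kd * Q); clear; lia.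
- have -> : s0 * (d.+1 * w) = Q by rewrite QE KqE; clear; lia.
  apply: leq_trans Xell; rewrite mulnDl mul1n; move: ellQ; move: (d * ell); clear; lia.
- rewrite -XE [2 * X]mul2n -addnn leq_add2r; apply: (@leq_trans (z ^ 2 * ell)).
    by rewrite leq_mul2l; move: ellQ; clear; lia.
  by rewrite XE leq_mul2r z24 orbT.
- have -> : s0 * (d.+1 * w) = Q by rewrite QE KqE; clear; lia.
  by move: Xt2 ellX ellQ wQ s0w; clear; lia.
- move=> N hN; rewrite -(leq_pmul2l LN0); apply: leq_trans hN; apply: leq_trans n1.
  by rewrite t0E -mulnA leq_pmull.
- move=> D /andP[_ Dd]; apply: leq_trans CL.
  by rewrite leq_mul2l LthM ?orbT.
(* The last hypothesis limits the tuples: as [N <= n / Lt], a large [Lt] makes them small compared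
   with the reserves and the set of spots. *)
move=> N hN.
have -> : s0 * (d.+1 * w) = Q by rewrite QE KqE; clear; lia.
have hLt : 1024 * Kd * d * d * K0 * Ld * z ^ 5 * N <= n.
  apply: leq_trans hN; by rewrite leq_mul2r Lt_dense orbT.
have sub u : 0 < u -> forall v, v * u = 1024 * Kd * d * d * K0 * Ld * z ^ 5 -> v * N <= n.
  move=> u0 v e; apply: leq_trans hLt; rewrite -e leq_mul2r leq_pmulr ?orbT //.
have h1 : 32 * (d * (d * N)) <= LN * Cn * X.
  have P0 : 0 < 32 * (K0 * Kd) by rewrite !muln_gt0 K00 Kd0.
  rewrite -(leq_pmul2l P0).
  apply: (@leq_trans n).
    apply: (@leq_trans (1024 * Kd * d * d * K0 * N)); first by apply: eq_leq; clear; lia.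
    apply: (sub (Ld * z ^ 5)); first by rewrite muln_gt0 Ld0 expn_gt0 z0.
    by move: (z ^ 5) => u; clear; lia.
  apply: leq_trans n2 _; apply: (@leq_trans (2 * (K0 * t0))).
    by move: (leq_pmull t0 K00) w_le; move: (K0 * t0); clear; lia.
  by apply: eq_leq; rewrite t0E t2E; move: (LN * Cn) => u; clear; lia.
have h2 : 1024 * (d * (z ^ 4 * N)) <= n.
  have -> : 1024 * (d * (z ^ 4 * N)) = 1024 * d * z ^ 4 * N by move: (z ^ 4) => u; clear; lia.
  apply: (sub (Kd * d * K0 * Ld * z)); first by rewrite !muln_gt0 Kd0 d0 K00 Ld0 z0.
  by rewrite (expnSr z 4); move: (z ^ 4) z => u v; clear; lia.
have h3 : 1024 * (Ld * ((d + 1) * N)) <= n.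
  have -> : 1024 * (Ld * ((d + 1) * N)) = 1024 * Ld * z * N by clear; lia.
  apply: (sub (Kd * d * d * K0 * z ^ 4)); first by rewrite muln_gt0 expn_gt0 z0 andbT !muln_gt0 Kd0 d0 K00.
  by rewrite (expnSr z 4); move: (z ^ 4) z => u v; clear; lia.
have t1t0 : 48 * Kd * Q <= t0.
  by apply: leq_trans (_ : ell <= _); [rewrite ellE; clear; lia|move: ellX Xt2 t2t; clear; lia].
have Qt0 : 128 * Q <= t0 by move: ellQ ellX Xt2 t2t; clear; lia.
have k1 : 64 * (Ld * t0) <= n.
  by apply: leq_trans n1; rewrite K0E; move: (leq_pmull (Ld * t0) d0); clear; lia.
have k2 : 64 * (d * t0) <= n.
  by apply: leq_trans n1; rewrite K0E; move: (leq_pmull (d * t0) Ld0); clear; lia.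
have k3 : 64 * t0 <= n by apply: leq_trans k1; rewrite leq_mul2l leq_pmull.
have zN : 1024 * ((d + 1) * N) <= n by apply: leq_trans h3; rewrite leq_mul2l leq_pmull.
have np : 0 < n by apply: leq_trans nK; rewrite muln_gt0 Kb0.
have t00 : 0 < t0 by apply: leq_trans w_le.
split.
- have h5 : 128 * (d * (Kd * X)) <= LN * Cn * X.
    rewrite !mulnA leq_mul2r; apply/orP; right; apply: leq_trans LC; apply: leq_trans Cz.
    by rewrite leq_pmulr // expn_gt0 z0.
  have h6 : 128 * X <= LN * Cn * X.
    rewrite leq_mul2r; apply/orP; right; apply: leq_trans LC; apply: leq_trans Cz.
    by rewrite -!mulnA leq_pmulr // muln_gt0 d0 muln_gt0 Kd0 expn_gt0 z0.
  have -> : d * (2 * t2) = 32 * (d * (Kd * X)) by rewrite t2E; clear; lia.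
  move: h1 h5 h6 ellX ellQ; move: (LN * Cn * X) (d * (d * N)) (d * (Kd * X)); clear; lia.
- have -> : 2 * Ld * ((d + 1) * N + t0 + 48 * Kd * Q + t2) =
     2 * (Ld * ((d + 1) * N)) + 2 * (Ld * t0) + 2 * (Ld * (48 * Kd * Q)) + 2 * (Ld * t2).
    by move: ((d + 1) * N) (48 * Kd * Q) => u v; clear; lia.
  have : Ld * (48 * Kd * Q) <= Ld * t0 by rewrite leq_mul2l t1t0 orbT.
  have : Ld * t2 <= Ld * t0 by rewrite leq_mul2l (leq_trans _ t2t) ?orbT // leq_pmull.
  move: h3 k1; move: (Ld * ((d + 1) * N)) (Ld * t0) (Ld * (48 * Kd * Q)) (Ld * t2); clear; lia.
- move: zN k3 t1t0 t2t Qt0 s0w wQ np (leq_divM n 2).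
  move: ((d + 1) * N) (48 * Kd * Q) s0 (n %/ 2); clear; lia.
- have -> : 2 * (d * (t0 + 48 * Kd * Q + t2)) = 2 * (d * t0) + 2 * (d * (48 * Kd * Q)) + 2 * (d * t2).
    by move: (48 * Kd * Q) => u; clear; lia.
  have : d * (48 * Kd * Q) <= d * t0 by rewrite leq_mul2l t1t0 orbT.
  have : d * t2 <= d * t0 by rewrite leq_mul2l (leq_trans _ t2t) ?orbT // leq_pmull.
  have : d * N <= (d + 1) * N by rewrite leq_mul2r leq_addr orbT.
  move: zN k2 np; move: ((d + 1) * N) (d * N) (d * t0) (d * (48 * Kd * Q)) (d * t2); clear; lia.
have h7 : z ^ 2 * (2 * Q) <= X.
  rewrite XE; apply: leq_mul => //; move: ellQ; clear; lia.
rewrite mulnDr.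
have -> : z ^ 4 * (d * N) = d * (z ^ 4 * N) by rewrite mulnCA.
have -> : z ^ 4 * (2 * t2) = 2 * (z ^ 4 * t2) by rewrite mulnCA.
have := ltn_ceil n (isT : 0 < 2).
move: h7 h2 t2z Xt2 t2t k3 t00; move: (z ^ 2 * (2 * Q)) (d * (z ^ 4 * N)) (z ^ 4 * t2) (n %/ 2).
clear; lia.
Qed.

End Constants.

Local Open Scope ring_scope.

(** The degree [D] depends on the tree, so the threshold has to serve all [D <= d], finitely
    many. *)
Lemma final_ok_uniform (R : realType) (Ld LN d : nat) (eps : R) : (0 < Ld)%N -> (0 < LN)%N -> 0 < eps ->
  exists S : nat, forall D s, (0 < D <= d)%N -> (S <= s)%N -> final_ok Ld LN D s eps.
Proof.
move=> Ld0 LN0 e0; elim: d => [|d [S HS]]; first by exists 0%N => D s; lia.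
have L0 : (0 < 16 * Lth Ld d.+1)%N by rewrite /Lth !muln_gt0 expn_gt0 muln_gt0 Ld0.
have L4 : (4 * (16 * Lth Ld d.+1) <= 64 * Lth Ld d.+1)%N by rewrite mulnA.
have LN2 : (0 < 2 * LN)%N by rewrite muln_gt0.
have [S' HS'] := final_phase (2 * Lth Ld d.+1 * (64 * Lth Ld d.+1) ^ 2) (ltn0Sn d) L0 LN2 L4 e0.
exists (S + S')%N => D s /andP[D0 Dd] hs.
case: (eqVneq D d.+1) => [->|ne]; first by apply: HS'; move: hs; clear; lia.
by apply: HS; move: hs Dd ne D0; clear; lia.
Qed.

(* 4^n (1 - x)^(w^2) is at most 2^-w as soon as w x is a large multiple of 4^(K+1), because n <= (K+1) w *)
Lemma exp_decay (R : realType) (n w K : nat) (x : R) : (n <= K.+1 * w)%N -> 0 <= x -> x <= 1 ->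
  2 * 4 ^+ K.+1 <= w%:R * x -> 4 ^+ n * (1 - x) ^+ (w ^ 2) <= (2^-1) ^+ w.
Proof.
move=> nw x0 x1 hx.
have p4 : (0 : R) < 4 ^+ K.+1 by apply: exprn_gt0.
apply: (@le_trans _ _ ((4 ^+ K.+1) ^+ w * ((2 * 4 ^+ K.+1)^-1) ^+ w)).
  apply: ler_pM; rewrite ?exprn_ge0 ?subr_ge0 //.
    by rewrite -exprM; apply: ler_weXn2l => //; rewrite ler1n.
  rewrite -mulnn exprM; apply: lerXn2r; rewrite ?nnegrE ?exprn_ge0 ?subr_ge0 ?invr_ge0 ?mulr_ge0 ?exprn_ge0 //.
  apply: le_trans (bernoulli_inv _ x0 x1) _; rewrite lef_pV2 ?posrE ?mulr_gt0 //.
    by apply: le_trans hx _; rewrite lerDr.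
  by apply: ltr_pwDl => //; apply: mulr_ge0.
rewrite -exprMn; apply: lerXn2r; rewrite ?nnegrE ?invr_ge0 ?mulr_ge0 ?invr_ge0 ?mulr_ge0 ?exprn_ge0 //.
by rewrite invfM mulrCA divff ?mulr1 ?gt_eqF.
Qed.

Theorem theorem1p3 (R : realType) (delta : R) (d : nat) :
  0 < delta < 1 -> (2 <= d)%N ->
  exists2 C : R, 0 < C &
  forall eps : R, 0 < eps ->
  exists N : nat, forall n : nat, (N <= n)%N ->
  forall (U : finType) (T : {set {set U}}),
    #|U| = n -> is_tree T -> (forall u, (degree T u <= d)%N) ->
  forall G0 : {set {set 'I_n}},
    is_graph G0 -> (forall v, delta * n%:R <= (degree G0 v)%:R) ->
  1 - eps <= perturbed_prob G0 (C / n%:R)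
               (fun E (c : colouring E n.-1) => has_rainbow_copy T c).
Proof.
move=> /andP[dl0 dl1] d2.
have d0 : (0 < d)%N by apply: leq_trans d2.
(* An integer above [1 / delta], so that the minimum degree condition becomes one on natural
   numbers. *)
pose Ld := (Num.truncn delta^-1).+1.
have Ld0 : (0 < Ld)%N by [].
have LdP : delta^-1 <= Ld%:R by apply: ltW; apply: truncnS_gt.
(* Each constant depends only on the preceding ones. [Lt] bounds the tuples from above before [LN]
   bounds them from below. The piece height [h] follows, and [Kb] comes last because the sets to be
   joined, of size [n %/ Kb], must be small even after multiplication by the piece size [s0]. *)
have [Kd KdE] : exists x, x = (3 * (4 * Ld - 1))%N by eexists.
have [K0 K0E] : exists x, x = (64 * d * Ld)%N by eexists.
have [Lt LtE] : exists x, x = (1024 * Kd * d * d * K0 * Ld * (d + 1) ^ 5 + Lth Ld d * d + 4 * Ld * d)%N by eexists.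
have [LN LNE] : exists x, x = (\sum_(D < d.+1) dense_structure_ratio Ld D Lt + 1)%N by eexists.
have [Cn CnE] : exists x, x = (128 * d * Kd * (d + 1) ^ 4 + 16 * Lth Ld d + 3)%N by eexists.
have [h hE] : exists x, x = (K0 * (LN * Cn * (1536 * Kd ^ 2 * (d + 1) ^ 4)))%N by eexists.
have [s0 s0E] : exists x, x = (h * d ^ h)%N by eexists.
have [Kq KqE] : exists x, x = (s0 * (d + 1))%N by eexists.
have [Kb KbE] : exists x, x = (h * Kq)%N by eexists.
have LN0 : (0 < LN)%N by rewrite LNE addn1.
have Kd0 : (0 < Kd)%N by rewrite KdE; move: Ld0; move: (Ld); clear; lia.
have Kb0 : (0 < Kb)%N.
  have u0 : (0 < Kd ^ 2)%N by rewrite expn_gt0 Kd0.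
  have v0 : (0 < (d + 1) ^ 4)%N by rewrite expn_gt0 addn1.
  have h0 : (0 < h)%N.
    rewrite hE; move: (Kd ^ 2)%N ((d + 1) ^ 4)%N u0 v0 => u v u0 v0.
    by rewrite !muln_gt0 LN0 u0 v0 K0E CnE addnS !muln_gt0 d0.
  by rewrite KbE KqE s0E !muln_gt0 h0 expn_gt0 d0 addn1.
(* Thinning keeps at least a fraction [1 / (2 * LN)] of the edge probability, and [w = n %/ Kb] is
   at least [n / Kb.+1]; this [C] then gives the bound [2 * 4 ^+ Kb.+1 <= w%:R * x] for
   [exp_decay]. *)
pose C : R := 2 * LN%:R * Kb.+1%:R * (2 * 4 ^+ Kb.+1).
have C0 : 0 < C by rewrite /C !mulr_gt0 ?ltr0n // exprn_gt0.
exists C => // eps e0.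
pose e1 := Num.min (eps / 2) 2^-1.
have e10 : 0 < e1 by rewrite lt_min divr_gt0 //= invr_gt0.
have e11 : e1 <= 1 by apply: le_trans (_ : 2^-1 <= _); [rewrite ge_min lexx orbT|lra].
have e1e : e1 <= eps / 2 by rewrite ge_min lexx.
have [S HS] := @final_ok_uniform R Ld LN d e1 Ld0 LN0 e10.
have e8 : 0 < eps / 8 by rewrite divr_gt0.
have [N1 HN1] := lin_half_pow_small Kb0 e8.
have [w1 Hw1] := @poly_lt_exp Kd Kb.+1 Kd0 (ltn0Sn Kb).
exists (Kb * Kb + N1 + Kb * w1 + 2 * LN * S + (Num.truncn (2 * C)).+1 + 2)%N => n hn U T cU tree degT G0 gG0 degG.
have [[nK nN1 nw1] [nS nC n2]] : [/\ Kb * Kb <= n, N1 <= n & Kb * w1 <= n]%N /\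
    [/\ 2 * LN * S < n, (Num.truncn (2 * C)).+1 <= n & 2 <= n]%N.
  move: hn; move: (Kb * Kb)%N (Kb * w1)%N (2 * LN * S)%N (Num.truncn (2 * C)) => x y u v; clear.
  by move=> hn; split; split; lia.
pose w := (n %/ Kb)%N.
have Kw : (Kb <= w)%N by rewrite leq_divRL.
have nw : (n <= Kb.+1 * w)%N.
  have : (n < Kb * w + Kb)%N by rewrite -mulnSr mulnC ltn_ceil.
  by rewrite mulSn; move: Kw; move: (Kb * w)%N (w); clear; lia.
have ww1 : (w1 <= w)%N by rewrite leq_divRL // mulnC.
have npw : (n ^ Kd < 2 ^ w)%N.
  by apply: leq_ltn_trans (Hw1 w ww1); rewrite leq_exp2r.
have np : (0 : R) < n%:R by rewrite ltr0n; apply: leq_trans n2.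
pose p : R := C / n%:R.
have p0 : 0 <= p by rewrite divr_ge0 // ltW.
have p12 : p <= 2^-1.
  rewrite ler_pdivrMr // mulrC ler_pdivlMr // mulrC; apply: le_trans (ltW (truncnS_gt _)) _.
  by rewrite ler_nat.
have degG' v : (n <= Ld * degree G0 v)%N.
  rewrite -(ler_nat R) natrM; apply: le_trans (_ : Ld%:R * (delta * n%:R) <= _); last by apply: ler_wpM2l.
  rewrite mulrA -[leLHS]mul1r ler_pM2r //; apply: le_trans (_ : delta^-1 * delta <= _); first by rewrite mulVf ?gt_eqF.
  by rewrite ler_pM2r.
have [||||||||D [s [D0 ns sDm bound]]] := @rainbow_copy_bound_large d Ld Kd K0 Lt LN Cn h s0 Kq Kb d0 Ld0 KdE K0E _ _ _ LN0 _ _ _ _ hE s0E KqE KbE R n nK npw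
   U T G0 p e1 cU tree degT gG0 degG' p0 p12 e11.
- by rewrite LtE -addnA leq_addr.
- by rewrite LtE -addnA addnCA leq_addr.
- by rewrite LtE leq_addl.
- move=> D Dd; rewrite LNE -ltnS in Dd *.
  by apply: leq_trans (leq_addr _ _); rewrite (bigD1 (Ordinal Dd)) //= leq_addr.
- by rewrite CnE leq_addl.
- by rewrite CnE -addnA leq_addr.
- by rewrite CnE -addnA addnCA leq_addr.
- move=> D s Dd hs; apply: HS => //; rewrite leqNgt; apply/negP => lt.
  move: (leq_trans nS hs); rewrite ltn_pmul2l ?muln_gt0 //; by move: lt; clear; lia.
apply: le_trans bound; rewrite -/w.
have m0 : (0 < n.-1)%N by move: n2; clear; lia.
have mp : (0 : R) < n.-1%:R by rewrite ltr0n.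
pose x : R := (s * D)%:R / n.-1%:R * p.
have z1 : (s * D)%:R / n.-1%:R <= 1 :> R by rewrite ler_pdivrMr // mul1r ler_nat.
have z0 : 0 <= (s * D)%:R / n.-1%:R :> R by rewrite divr_ge0.
have x0 : 0 <= x by rewrite mulr_ge0.
have x1 : x <= 1 by rewrite -[leRHS]mul1r; apply: ler_pM => //; apply: le_trans p12 _; lra.
have zlow : (2 * LN%:R)^-1 <= (s * D)%:R / n.-1%:R :> R.
  rewrite ler_pdivlMr // ler_pdivrMl ?mulr_gt0 ?ltr0n //.
  apply: le_trans (_ : n%:R <= _); first by rewrite ler_nat leq_pred.
  rewrite -!natrM ler_nat; apply: leq_trans ns _; by rewrite leq_mul2l leq_pmulr ?orbT.
have wx : 2 * 4 ^+ Kb.+1 <= w%:R * x.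
  have LNp : (0 : R) < 2 * LN%:R by rewrite mulr_gt0 ?ltr0n.
  have cp : (0 : R) < 2 * 4 ^+ Kb.+1 by rewrite mulr_gt0 // exprn_gt0.
  apply: le_trans (_ : w%:R * ((2 * LN%:R)^-1 * p) <= _); last first.
    by apply: ler_wpM2l => //; apply: ler_wpM2r.
  rewrite /p /C; move: (2 * 4 ^+ Kb.+1) cp => c cp.
  rewrite -[2 * LN%:R * _ * c]mulrA -[2 * LN%:R * _ / _]mulrA mulKf ?gt_eqF //.
  rewrite mulrA ler_pdivlMr // [w%:R * _]mulrA [_ * _ * c]mulrC ler_wpM2l ?(ltW cp) //.
  by rewrite -natrM ler_nat mulnC.
have dec := exp_decay nw x0 x1 wx.
have lin := HN1 n nN1; rewrite -/w in lin.
have hw0 : (0 : R) <= 2^-1 ^+ w by apply: exprn_ge0; rewrite invr_ge0.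
set e2 := (X in _ <= _ * (1 - X)).
have e2b : e2 <= eps / 2.
  rewrite /e2; apply: le_trans (lerD dec (lexx _)) _; rewrite natrM mulrAC.
  have : 2^-1 ^+ w <= n%:R * 2^-1 ^+ w :> R by rewrite ler_peMl // ler1n; apply: leq_trans n2.
  by move: lin; lra.
have e20 : 0 <= e2.
  apply: addr_ge0; apply: mulr_ge0 => //; first exact: exprn_ge0.
  by apply: exprn_ge0; rewrite subr_ge0; exact: x1.
move: e1e e20 e2b e10; move: (e1) (e2); clear => u v; nra.
Qed.
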